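(* Let $\Bbbk=\mathbb{C}$, $\delta\in\mathbb{C}$, $\delta'=0$ and $n\in\mathbb{N}$. Let $0\le k\le n$, $\lambda\vdash k$, let $\mathcal{L}$ be a left cell of $\mathtt{R}_n$ with propagating number $k$, and let $l\in\{n-k,n-k-2,\dots\}$ with $l\ge 0$. Then the $\mathfrak{B}_n(\delta)$-module $$N_l(\lambda)=\left(\mathbf{C}_{\mathcal{L}}^{(l)}/\mathbf{C}_{\mathcal{L}}^{(l+2)}\right)\otimes_{\mathbb{C}[S_k]}\mathcal{S}(\lambda)$$ decomposes into a direct sum as follows: $$N_l(\lambda)\cong\bigoplus_{\mu\in\mathcal{X}_{\lambda,l}}m_{\mu}\,\Delta^{\mathfrak{B}}(\mu),$$ where $\mathcal{X}_{\lambda,l}$ is the set of all $\mu\vdash k+l$ for which the Specht module $\mathcal{S}(\mu)$ of $S_{k+l}$ occurs as a summand in $\mathrm{Ind}_{S_k\times S_l}^{S_{k+l}}(\mathcal{S}(\lambda)\otimes\mathcal{S}((l)))$, and $m_{\mu}$ is the corresponding multiplicity.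
   Context: Diagrams and algebras. Let $\underline{n}=\{1,\dots,n\}$, $\underline{n}'=\{1',\dots,n'\}$, and let $\mathtt{R}_n$ be the set of all set partitions (diagrams) of $\underline{n}\sqcup\underline{n}'$ into parts of size $1$ (singletons) or $2$ (pair parts); $\mathtt{B}_n\subset\mathtt{R}_n$ is the subset of diagrams without singletons. For $d,d'\in\mathtt{R}_n$, let $d|d'$ be the graph obtained by identifying the vertex $i'$ of $d$ with the vertex $i$ of $d'$ for each $i$ (these $n$ vertices form the equator), with edges the pair parts of $d$ and of $d'$. Let $d\circ d'\in\mathtt{R}_n$ be the partition of (the vertices $\underline{n}$ of $d$) $\sqcup$ (the vertices $\underline{n}'$ of $d'$) whose parts are the nonempty intersections of connected components of $d|d'$ with this set. The partial Brauer algebra $\mathfrak{R}_n=\mathfrak{R}_n(\delta,\delta')$ has $\mathbb{C}$-basis $\mathtt{R}_n$ and multiplication $dd'=\delta^{a}{\delta'}^{b}\,d\circ d'$, where $a$ is the number of closed loops contained in the equator and $b$ the number of open strings (paths, including isolated single vertices) contained in the equator. Here $\delta'=0$, so $dd'=0$ whenever $b>0$. The Brauer algebra $\mathfrak{B}_n(\delta)$ is the subalgebra of $\mathfrak{R}_n$ with basis $\mathtt{B}_n$; $\mathfrak{R}_n$-modules are viewed as $\mathfrak{B}_n(\delta)$-modules by restriction. Cell modules. A propagating line of $d$ is a pair part $\{i,j'\}$ with $i\in\underline{n}$, $j'\in\underline{n}'$. Write $d\sim_L d'$ if $d,d'$ have the same parts contained in $\underline{n}'$; the equivalence classes $\mathcal{L}$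 are left cells. All diagrams in $\mathcal{L}$ have the same number $k$ of propagating lines (the propagating number of $\mathcal{L}$) and the same right endpoints $t_1'<\dots<t_k'$ of propagating lines. $\mathbf{C}_{\mathcal{L}}$ is the vector space with basis $\mathcal{L}$ and $\mathfrak{R}_n$-action $d\cdot d'=dd'$ if $dd'\in\mathbf{C}_{\mathcal{L}}$ and $0$ otherwise. $S_k$ acts freely on the right by permuting right endpoints of propagating lines ($\sigma$ replaces $\{s,t_i'\}$ by $\{s,t_{\sigma^{-1}(i)}'\}$), commuting with $\mathfrak{R}_n$. For $l\in\{n-k,n-k-2,\dots\}$ with $l\ge 0$, $\mathbf{C}_{\mathcal{L}}^{(l)}$ is the linear span of all $d\in\mathcal{L}$ with at least $l$ singletons in $\underline{n}$; it is an $\mathfrak{R}_n$-$S_k$-subbimodule of $\mathbf{C}_{\mathcal{L}}$, and $\mathbf{C}_{\mathcal{L}}^{(n-k+2)}=0$. $\mathcal{S}(\lambda)$ denotes the (irreducible, complex) Specht module of $S_k$ for $\lambda\vdash k$; $\mathcal{S}((l))$ is the trivial $S_l$-module. Brauer Specht modules. For $\mu\vdash r$ with $r\le n$, $n-r$ even, $\Delta^{\mathfrak{B}}(\mu)=\mathbf{C}^{\mathfrak{B}}_{\overline{\mathcal{L}}}\otimes_{\mathbb{C}[S_r]}\mathcal{S}(\mu)$, where $\overline{\mathcal{L}}\subset\mathtt{B}_n$ is any nonempty intersection of $\mathtt{B}_n$ with a left cell of propagating number $r$ and $\mathbf{C}^{\mathfrak{B}}_{\overline{\mathcal{L}}}$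 is the $\mathfrak{B}_n(\delta)$-module with basis $\overline{\mathcal{L}}$ and action, for $d\in\mathtt{B}_n$ and $d'\in\overline{\mathcal{L}}$, given by $d\cdot d'=dd'$ if $dd'\in\mathbf{C}^{\mathfrak{B}}_{\overline{\mathcal{L}}}$ and $d\cdot d'=0$ otherwise; $S_r$ acts freely on it on the right by permuting right endpoints of propagating lines (if $q_1'<\dots<q_r'$ are the common right endpoints of the propagating lines of the diagrams in $\overline{\mathcal{L}}$, then $\sigma\in S_r$ replaces $\{s,q_i'\}$ by $\{s,q_{\sigma^{-1}(i)}'\}$), commuting with $\mathfrak{B}_n(\delta)$. *)

(* Defs.v *)
Set Warnings "-notation-overridden,-ambiguous-paths,-redundant-canonical-projection,-projection-no-head-constant".
From HB Require Import structures.
From mathcomp Require Import all_boot all_order all_fingroup all_algebra.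
From mathcomp Require Import boolp reals complex.

Set Implicit Arguments.
Unset Strict Implicit.
Unset Printing Implicit Defensive.

Import GRing.Theory.
Import VectorInternalTheory.

Local Open Scope ring_scope.

(* The union of two partial matchings [a], [b] has maximal degree 2, so that  *)
(* each of its components contains at most two ends.                          *)
Section TwoMatchings.

Variables (T : finType) (a b : rel T).
Hypotheses (a_sym : symmetric a) (b_sym : symmetric b).
Hypothesis a_fun : forall x y z, a x y -> a x z -> y = z.
Hypothesis b_fun : forall x y z, b x y -> b x z -> y = z.

Let mate (r : rel T) x := odflt x [pick y | r x y].

Let mateK (r : rel T) : symmetric r ->
  (forall x y z, r x y -> r x z -> y = z) -> involutive (mate r).
Proof.
move=> rs rf x; rewrite {2}/mate; case: pickP => [y rxy|r0] /=; last first.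
  by rewrite /mate; case: pickP => // y; rewrite r0.
rewrite /mate; case: pickP => [z ryz|/(_ x)] /=; last by rewrite rs rxy.
by apply: (rf y z x ryz); rewrite rs.
Qed.

Let mateE (r : rel T) x y : (forall x y z, r x y -> r x z -> y = z) ->
  r x y -> mate r x = y.
Proof.
move=> rf rxy; rewrite /mate; case: pickP => [z rxz|/(_ y)] /=.
  exact: rf rxz rxy.
by rewrite rxy.
Qed.

Let mate_id (r : rel T) x : r x =1 xpred0 -> mate r x = x.
Proof. by move=> r0; rewrite /mate; case: pickP => // y; rewrite r0. Qed.

Lemma two_matchings_half x y z : b x =1 xpred0 ->
  (a y =1 xpred0) \/ (b y =1 xpred0) -> (a z =1 xpred0) \/ (b z =1 xpred0) ->
  connect (relU a b) x y -> connect (relU a b) x z ->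
  [\/ x = y, x = z | y = z].
Proof.
move=> bx fy fz cxy cxz; pose al := mate a; pose be := mate b.
have alK : involutive al by apply: mateK.
have beK : involutive be by apply: mateK.
pose f u := be (al u).
have f_inj : injective f.
  by move=> u v /(can_inj beK) /(can_inj alK).
have bex : be x = x by apply: mate_id.
have f_al u : f (al (f u)) = al u by rewrite /f -/al alK beK.
have f_be u : f (be (f u)) = be u by rewrite /f beK alK.
have it_al i u : iter i f (al (iter i f u)) = al u.
  by elim: i u => // i IH u; rewrite iterS iterSr IH f_al.
have it_be i u : iter i f (be (iter i f u)) = be u.
  by elim: i u => // i IH u; rewrite iterS iterSr IH f_be.
have orbP u : connect (relU a b) x u -> fconnect f x u.
  case/connectP=> p; elim/last_ind: p u => [u _ ->|p v IH u].
    exact: connect0.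
  rewrite rcons_path last_rcons => /andP[pp st] ->.
  have {IH pp} := IH _ pp erefl; move: (last x p) st => w st xw.
  move: (iter_findex xw); set i := findex _ _ _ => wE.
  rewrite fconnect_sym //; case/orP: st => st.
    have <- : al w = v by apply: mateE st.
    have <- : iter i.+1 f (al w) = x.
      by rewrite iterS -wE it_al /f alK.
    exact: fconnect_iter.
  have <- : be w = v by apply: mateE st.
  have <- : iter i f (be w) = x by rewrite -wE it_be.
  exact: fconnect_iter.
have key u : (a u =1 xpred0) \/ (b u =1 xpred0) -> connect (relU a b) x u ->
    x <> u -> findex f x u = (fingraph.order f x)./2.
  move=> fu cu xu; have xfu := orbP u cu.
  have ltm := findex_max xfu; have uE := iter_findex xfu.
  set i := findex f x u in ltm uE *; set m := fingraph.order f x in ltm *.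
  have i_gt0 : (0 < i)%N.
    by rewrite lt0n; apply: contra_notN xu => /eqP i0; rewrite -uE i0.
  have per j : iter j f x = x -> (0 < j < m.*2)%N -> j = m.
    move=> jx /andP[j0 jm]; have m0 : iter m f x = x by apply: iter_order.
    have small k : iter k f x = x -> (k < m)%N -> k = 0%N.
      by move=> kx km; rewrite -(findex_iter km) kx findex0.
    case: (ltnP j m) => [jltm|mj].
      by move: j0; rewrite (small j jx jltm).
    have: iter (j - m) f x = x.
      by rewrite -{1}m0 -iterD subnK.
    move/small; rewrite ltn_subLR // addnn => /(_ jm) /eqP.
    by rewrite subn_eq0 => jm'; apply/eqP; rewrite eqn_leq jm' mj.
  case: fu => fu.
    have alu : al u = u by apply: mate_id.
    have : iter (i.+1 + i) f x = x.
      by rewrite iterD uE -{1}alu -uE iterS it_al /f alK.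
    move/per; rewrite addSn addnn => <-; first by rewrite /= uphalf_double.
    by rewrite /= ltn_Sdouble.
  have beu : be u = u by apply: mate_id.
  have : iter (i + i) f x = x by rewrite iterD uE -{1}beu -uE it_be.
  move/per; rewrite addnn => <-; first by rewrite doubleK.
  by rewrite double_gt0 i_gt0 ltn_double.
case: (x =P y) => [->|xy]; first by constructor 1.
case: (x =P z) => [->|xz]; first by constructor 2.
constructor 3; rewrite -(iter_findex (orbP y cxy)) -(iter_findex (orbP z cxz)).
by rewrite !key.
Qed.

End TwoMatchings.

Lemma two_matchings (T : finType) (a b : rel T) x y z :
  symmetric a -> symmetric b ->
  (forall x y z, a x y -> a x z -> y = z) ->
  (forall x y z, b x y -> b x z -> y = z) ->
  (a x =1 xpred0) \/ (b x =1 xpred0) -> (a y =1 xpred0) \/ (b y =1 xpred0) ->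
  (a z =1 xpred0) \/ (b z =1 xpred0) ->
  connect (relU a b) x y -> connect (relU a b) x z ->
  [\/ x = y, x = z | y = z].
Proof.
move=> a_s b_s af bf [] fx fy fz; last exact: two_matchings_half.
have swap : relU a b =2 relU b a by move=> u v; apply: orbC.
rewrite !(eq_connect swap); apply: two_matchings_half => //.
  by case: fy; [right | left].
by case: fz; [right | left].
Qed.

(* [inl i] stands for $i$ and [inr i] for $i'$. *)
Notation vtx n := ('I_n + 'I_n)%type.

Section Diagrams.

Variable n : nat.

Definition is_diagram (P : {set {set vtx n}}) :=
  partition P [set: vtx n] && [forall B in P, #|B| <= 2]%N.

Record diagram := Diagram { parts :> {set {set vtx n}}; _ : is_diagram parts }.

HB.instance Definition _ := [isSub for parts].
HB.instance Definition _ := [Finite of diagram by <:].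

Implicit Types (d : diagram).

Definition pair_parts d := [set B in parts d | #|B| == 2%N].

Definition upper_singletons d := [set i : 'I_n | [set inl i] \in parts d].

Definition is_brauer d := [forall B in parts d, #|B| == 2%N].
Definition brauer := {d : diagram | is_brauer d}.

Definition brauer_set := [set d | is_brauer d].

Definition prop_lines d :=
  [set p : 'I_n * 'I_n | [set inl p.1; inr p.2] \in parts d].
Definition prop_number d := #|prop_lines d|.
Definition right_ends d := [set p.2 | p in prop_lines d].

Definition lower_parts d :=
  [set B in parts d | B \subset [set inr i | i : 'I_n]].
Definition left_equiv d d' := lower_parts d == lower_parts d'.
Definition is_left_cell (L : {set diagram}) :=
  L \in equivalence_partition left_equiv [set: diagram].

(* The vertices of $d|d'$: the unprimed vertices of $d$, then the equator,    *)
(* then the primed vertices of $d'$.                                          *)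
Notation gvtx := ('I_n + 'I_n + 'I_n)%type.

Definition gfst (v : vtx n) : gvtx := inl v.
Definition gsnd (v : vtx n) : gvtx :=
  match v with inl i => inl (inr i) | inr i => inr i end.
Definition gout (v : vtx n) : gvtx :=
  match v with inl i => inl (inl i) | inr i => inr i end.
Definition equator : {set gvtx} := [set inl (inr i) | i : 'I_n].

Lemma gfst_inj : injective gfst. Proof. by move=> x y []. Qed.
Lemma gsnd_inj : injective gsnd. Proof. by move=> [x|x] [y|y] // [->]. Qed.
Lemma gout_inj : injective gout. Proof. by move=> [x|x] [y|y] // [->]. Qed.

Definition edges (g : vtx n -> gvtx) d : {set {set gvtx}} :=
  [set g @: (B : {set vtx n}) | B in pair_parts d].

Section Product.

Variables d d' : diagram.

Definition adjacent : rel gvtx :=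
  relU (fun x y => [set x; y] \in edges gfst d)
       (fun x y => [set x; y] \in edges gsnd d').

(* An edge of $d$ and an edge of $d'$ with the same ends count as two. *)
Definition degree (x : gvtx) :=
  (#|[set E in edges gfst d | x \in E]|
   + #|[set E in edges gsnd d' | x \in E]|)%N.

Definition components : {set {set gvtx}} :=
  equivalence_partition (connect adjacent) [set: gvtx].

Definition equator_components := [set K in components | K \subset equator].

(* All degrees in $d|d'$ are at most 2, so that a component is a closed loop  *)
(* when all its degrees are 2, and a path otherwise.                          *)
Definition closed_loops :=
  [set K in equator_components | [forall x in K, degree x == 2%N]].
Definition open_strings := equator_components :\: closed_loops.

Definition comp_parts : {set {set vtx n}} :=
  [set gout @^-1: (K : {set gvtx}) | K in components] :\ set0.

Let edges_sym g (e : diagram) :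
  symmetric (fun x y : gvtx => [set x; y] \in edges g e).
Proof. by move=> x y; rewrite setUC. Qed.

Let edges_fun g (e : diagram) : injective g ->
  forall x y z, [set x; y] \in edges g e -> [set x; z] \in edges g e -> y = z.
Proof.
move=> g_inj x y z /imsetP[B + xyE] /imsetP[C + xzE].
rewrite !inE => /andP[Be /eqP B2] /andP[Ce _].
have /andP[/and3P[_ triv _] _] := valP e.
have BC : B = C.
  have : x \in g @: B by rewrite -xyE set21.
  have : x \in g @: C by rewrite -xzE set21.
  case/imsetP=> u uC -> /imsetP[v vB /g_inj uv]; rewrite -{v}uv in vB.
  by rewrite -(def_pblock triv Be vB) -(def_pblock triv Ce uC).
have c2 : #|[set x; y]| = 2%N by rewrite xyE card_imset.
have xy : x != y by move: c2; rewrite cards2; case: eqVneq.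
have : y \in [set x; z] by rewrite xzE -BC -xyE set22.
by rewrite !inE eq_sym (negPf xy) => /eqP.
Qed.

Let edges_out g (e : diagram) x :
  x \notin codom g -> (fun y => [set x; y] \in edges g e) =1 xpred0.
Proof.
move=> xg y /=; apply: contraNF xg => /imsetP[B _ xyE].
have : x \in g @: B by rewrite -xyE set21.
by case/imsetP=> u _ ->; apply: codom_f.
Qed.

Lemma connect_equiv : equivalence_rel (connect adjacent).
Proof.
have sym : connect_sym adjacent.
  by apply: sym_connect_sym => x y; rewrite /adjacent /= !(setUC [set x]).
move=> x y z; split=> [|xy]; first exact: connect0.
by apply/idP/idP; apply: connect_trans; rewrite // sym.
Qed.

Lemma gout_free v :
  (fun y => [set gout v; y] \in edges gfst d) =1 xpred0 \/
  (fun y => [set gout v; y] \in edges gsnd d') =1 xpred0.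
Proof.
by case: v => i; [right | left]; apply: edges_out; apply/codomP=> -[[]].
Qed.

Lemma comp_parts_diagram : is_diagram comp_parts.
Proof.
pose R u v := connect adjacent (gout u) (gout v).
have RE : {in [set: vtx n] & &, equivalence_rel R}.
  by move=> u v w _ _ _; have [? ?] := connect_equiv (gout u) (gout v) (gout w).
have -> : comp_parts = equivalence_partition R [set: vtx n].
  apply/setP=> B; rewrite !inE; apply/andP/imsetP.
    case=> /set0Pn[v] /[swap] /imsetP[K /imsetP[x _ ->] ->].
    rewrite !inE /= => xv; exists v; rewrite ?inE //.
    apply/setP=> w; rewrite !inE /=.
    by have [_ ->] := connect_equiv x (gout v) (gout w).
  case=> v _ ->; split.
    by apply/set0Pn; exists v; rewrite !inE; apply: connect0.
  apply/imsetP; exists [set y in [set: gvtx] | connect adjacent (gout v) y].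
    by apply/imsetP; exists (gout v).
  by apply/setP=> w; rewrite !inE.
apply/andP; split; first exact: equivalence_partitionP.
apply/forall_inP=> B /imsetP[x _ ->]; rewrite leqNgt.
apply/negP=> /card_gt2P [u [v [w]]].
rewrite !inE => -[[xu xv xw] [uv vw wu]].
have uR t : R x t -> R u t by have [_ /(_ xu) <-] := RE x u t (in_setT _) (in_setT _) (in_setT _).
have := two_matchings (edges_sym gfst d) (edges_sym gsnd d')
  (edges_fun gfst_inj) (edges_fun gsnd_inj) (gout_free u) (gout_free v)
  (gout_free w) (uR _ xv) (uR _ xw).
by case=> /gout_inj E; move: uv vw wu; rewrite E eqxx.
Qed.

Definition comp_diagram : diagram := Diagram comp_parts_diagram.

(* The structure constants of the partial Brauer algebra: the product of the  *)
(* basis elements $d$, $d'$ is [comp_coef delta delta'] times $d \circ d'$.   *)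
Definition comp_coef (C : pzRingType) (delta delta' : C) : C :=
  delta ^+ #|closed_loops| * delta' ^+ #|open_strings|.

End Product.

Section Relabel.

Variables (k : nat) (t : 'I_k -> 'I_n) (t_inj : injective t) (s : 'S_k).

Definition extend_fun (x : 'I_n) : 'I_n :=
  if [pick i | t i == x] is Some i then t (s i) else x.

Lemma extend_fun_inj : injective extend_fun.
Proof.
move=> x y; rewrite /extend_fun.
case: pickP => [i /eqP <-|nx]; case: pickP => [j /eqP <-|ny] //.
- by move/t_inj/perm_inj->.
- by move=> E; have := ny (s i); rewrite E eqxx.
- by move=> E; have := nx (s j); rewrite -E eqxx.
Qed.

(* The permutation $t_i \mapsto t_{s(i)}$, extended by the identity. *)
Definition extend_perm : 'S_n := perm extend_fun_inj.

End Relabel.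

Definition relabel_vtx (p : 'S_n) (v : vtx n) : vtx n :=
  match v with inl i => inl i | inr i => inr (p i) end.

Definition relabel_parts (p : 'S_n) d : {set {set vtx n}} :=
  [set relabel_vtx p @: (B : {set vtx n}) | B in parts d].

Lemma relabel_parts_diagram p d : is_diagram (relabel_parts p d).
Proof.
have p_inj : injective (relabel_vtx p).
  by move=> [x|x] [y|y] //= [] // /perm_inj->.
have /andP[d_part /forall_inP d2] := valP d; apply/andP; split.
  suff <- : relabel_vtx p @: [set: vtx n] = [set: vtx n].
    by rewrite imset_partition.
  by apply/eqP; rewrite eqEcard subsetT card_imset ?leqnn.
by apply/forall_inP=> _ /imsetP[B dB ->]; rewrite card_imset // d2.
Qed.

Definition relabel (p : 'S_n) d : diagram := Diagram (relabel_parts_diagram p d).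

(* $t_1 < \dots < t_k$: on ordinals, [enum_val] is increasing. *)
Definition right_end d k (e : #|right_ends d| = k) (i : 'I_k) : 'I_n :=
  enum_val (cast_ord (esym e) i).

Lemma right_end_inj d k (e : #|right_ends d| = k) : injective (right_end e).
Proof. by move=> i j /enum_val_inj/cast_ord_inj. Qed.

(* Meaningful only if [d] has exactly [k] right ends of propagating lines. *)
Definition right_act k (s : 'S_k) d : diagram :=
  if #|right_ends d| =P k is ReflectT e
  then relabel (extend_perm (@right_end_inj d k e) s^-1) d else d.

End Diagrams.

Lemma card_right_ends n (d : diagram n) : #|right_ends d| = prop_number d.
Proof.
apply: card_in_imset => -[i j] [i' j']; rewrite !inE /= => Bd Bd' jj.
rewrite -{j'}jj in Bd' *.
have /andP[/and3P[_ triv _] _] := valP d.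
have E : [set inl i; inr j] = [set inl i'; inr j] :> {set vtx n}.
  rewrite -(def_pblock triv Bd (set22 _ _)).
  by rewrite -(def_pblock triv Bd' (set22 _ _)).
have : (inl i : vtx n) \in [set inl i'; inr j] by rewrite -E set21.
by rewrite !inE orbF => /eqP[->].
Qed.

Section Spaces.

Variable F : fieldType.

Definition basis_vec (I : finType) (i : I) : {ffun I -> F^o} :=
  [ffun j => (j == i)%:R].

Definition lin_ext (I : finType) (V : vectType F) (phi : I -> V) :
    'Hom({ffun I -> F^o}, V) :=
  linfun (fun f : {ffun I -> F^o} => \sum_i (f i : F) *: phi i).

Lemma lin_ext_basis (I : finType) (V : vectType F) (phi : I -> V) i :
  lin_ext phi (basis_vec i) = phi i.
Proof.
have lin : linear (fun f : {ffun I -> F^o} => \sum_i (f i : F) *: phi i).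
  move=> a f g; rewrite scaler_sumr -big_split; apply: eq_bigr => j _.
  by rewrite !ffunE scalerDl scalerA.
pose H := GRing.isLinear.Build _ _ _ _ _ lin.
pose h : {linear {ffun I -> F^o} -> V} := HB.pack
  (fun f : {ffun I -> F^o} => \sum_i (f i : F) *: phi i) H.
rewrite /lin_ext -[linfun _]/(linfun h) lfunE /= (bigD1 i) //= big1.
  by rewrite ffunE eqxx scale1r addr0.
by move=> j ji; rewrite ffunE (negPf ji) scale0r.
Qed.

(* For $W \subseteq U$, the quotient $U / W$ is realized on the complement    *)
(* [U :\: W] of $W$ in $U$, with [subquot_proj] as the canonical surjection   *)
(* (its restriction to $U$ is onto, with kernel $W$).                         *)
Definition subquot (V : vectType F) (U W : {vspace V}) : vectType F :=
  subvs_of (U :\: W)%VS.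

Definition subquot_proj (V : vectType F) (U W : {vspace V}) (v : V) :
    subquot U W := vsproj (U :\: W) (addv_pi1 U W v).

Lemma subquot_proj_eq0 (V : vectType F) (U W : {vspace V}) u :
  (W <= U)%VS -> u \in U -> (subquot_proj U W u == 0) = (u \in W).
Proof.
move=> WU uU; have uUW : u \in (U + W)%VS by rewrite (addv_idPl WU).
have uE := addv_pi1_pi2 uUW.
have p1 : addv_pi1 U W u \in (U :\: W)%VS by rewrite /addv_pi1 memv_pi.
rewrite /subquot_proj -(inj_eq val_inj) /= vsprojK //.
apply/eqP/idP => [p0|uW]; first by rewrite -uE p0 add0r memv_pi2.
by apply: (addIr (addv_pi2 U W u)); rewrite uE add0r addv_pi2_id.
Qed.

Lemma subquot_proj_val (V : vectType F) (U W : {vspace V})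
  (v : subquot U W) : subquot_proj U W (vsval v) = v.
Proof.
rewrite /subquot_proj /addv_pi1 daddv_pi_id ?capv_diff ?subvsP //.
exact: vsvalK.
Qed.

Definition subquot_end (V : vectType F) (U W : {vspace V}) (f : 'End(V)) :
    'End(subquot U W) :=
  linfun (fun v : subquot U W => subquot_proj U W (f (vsval v))).

(* $V \otimes W$ as the space of matrices indexed by the canonical bases of   *)
(* $V$ and $W$.                                                               *)
Definition tens (V W : vectType F) : vectType F := 'M[F]_(dim V, dim W).

Definition pure_tens (V W : vectType F) (v : V) (w : W) : tens V W :=
  (v2r v)^T *m v2r w.

Definition tens_end (V W : vectType F) (f : 'End(V)) (g : 'End(W)) :
    'End(tens V W) :=
  linfun (fun A : tens V W => (f2mx f)^T *m (A : 'M_(_, _)) *m f2mx g : tens V W).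

Lemma tens_endE (V W : vectType F) (f : 'End(V)) (g : 'End(W)) v w :
  tens_end f g (pure_tens v w) = pure_tens (f v) (g w).
Proof.
have lin : linear (fun A : tens V W =>
    (f2mx f)^T *m (A : 'M_(_, _)) *m f2mx g : tens V W).
  by move=> a A B; rewrite mulmxDr mulmxDl -scalemxAr -scalemxAl.
pose H := GRing.isLinear.Build _ _ _ _ _ lin.
pose h : {linear tens V W -> tens V W} := HB.pack (fun A : tens V W =>
    (f2mx f)^T *m (A : 'M_(_, _)) *m f2mx g : tens V W) H.
rewrite /tens_end -[linfun _]/(linfun h) lfunE /= /pure_tens.
by rewrite !unlock /= !r2vK trmx_mul !mulmxA.
Qed.

End Spaces.

(* A module over an algebra (or a group) is a vector space together with the  *)
(* action of each element of a basis of the algebra (or of the group).        *)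
Record opmod (F : fieldType) (X : Type) := Opmod {
  carrier :> vectType F;
  act : X -> 'End(carrier)
}.

Record bimod (F : fieldType) (X Y : Type) := Bimod {
  bicarrier :> vectType F;
  lact : X -> 'End(bicarrier);
  ract : Y -> 'End(bicarrier)
}.

Section Modules.

Variable F : fieldType.

Definition isomorphic X (M N : opmod F X) : Prop :=
  exists f : {linear M -> N},
    bijective f /\ forall x v, f (act M x v) = act N x (f v).

Definition restrict X X' (f : X' -> X) (M : opmod F X) : opmod F X' :=
  Opmod (fun x => act M (f x)).

Definition zero_mod X : opmod F X := @Opmod F X 'rV[F]_0 (fun=> 0).

Definition dsum X (M N : opmod F X) : opmod F X :=
  @Opmod F X (M * N)%type
    (fun x => linfun (fun p : M * N => (act M x p.1, act N x p.2))).

Definition copies X (m : nat) (M : opmod F X) : opmod F X :=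
  iter m (dsum M) (zero_mod X).

Definition occurs X (W V : opmod F X) : Prop :=
  exists V' : opmod F X, isomorphic V (dsum W V').

(* The largest [m] such that $V \cong W^{\oplus m} \oplus V'$ for some $V'$.  *)
Definition multiplicity X (W V : opmod F X) : nat :=
  \max_(m < (dim V).+1 |
        `[< exists V' : opmod F X, isomorphic V (dsum (copies m W) V') >]) m.

(* $M \otimes_{F[Y]} N$, for a right action of $Y$ on $M$ and a left action   *)
(* of $Y$ on $N$.                                                             *)
Definition tensor_rel X (Y : finType) (M : bimod F X Y) (N : opmod F Y) :
    {vspace tens M N} :=
  (\sum_(y : Y) \sum_(m <- vbasis {:M}) \sum_(v <- vbasis {:N})
     <[pure_tens (ract M y m) v - pure_tens m (act N y v)]>)%VS.

Definition tensor X (Y : finType) (M : bimod F X Y) (N : opmod F Y) :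
    opmod F X :=
  @Opmod F X (subquot fullv (tensor_rel M N))
    (fun x => subquot_end fullv (tensor_rel M N) (tens_end (lact M x) \1)).

Definition outer_tensor X Y (M : opmod F X) (N : opmod F Y) : opmod F (X * Y) :=
  @Opmod F (X * Y) (tens M N) (fun p => tens_end (act M p.1) (act N p.2)).

Definition subquot_bimod X Y (M : bimod F X Y) (U W : {vspace M}) :
    bimod F X Y :=
  @Bimod F X Y (subquot U W) (fun x => subquot_end U W (lact M x))
    (fun y => subquot_end U W (ract M y)).

End Modules.

Definition is_intpartn r (s : seq nat) :=
  [&& sorted geq s, 0%N \notin s & sumn s == r].

(* A partition of [r] has at most [r] parts, each at most [r]. *)
Record intpartn r := Intpartn {
  intpartn_bseq : r.-bseq 'I_r.+1;
  _ : is_intpartn r (map val intpartn_bseq)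
}.

HB.instance Definition _ r := [isSub for @intpartn_bseq r].
HB.instance Definition _ r := [Finite of intpartn r by <:].

Definition intpartn_seq r (mu : intpartn r) : seq nat := map val (intpartn_bseq mu).
Coercion intpartn_seq : intpartn >-> seq.

Section Symmetric.

Variable F : fieldType.

(* Permutations are composed as functions, $(st)(x) = s(t(x))$; this is       *)
(* [(t * s)%g]. All left and right actions refer to this convention.          *)
Definition pcomp r (s t : 'S_r) : 'S_r := (t * s)%g.

(* The boxes of the Young diagram of [sh] are numbered row by row; box [x]    *)
(* has row [reshape_index sh x] and column [reshape_offset sh x]. A tableau   *)
(* [t] has the entry [t x] in box [x].                                        *)
Section Specht.

Variables (r : nat) (sh : seq nat).

Definition row_of (t : 'S_r) (a : 'I_r) := reshape_index sh (t^-1%g a).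
Definition col_of (t : 'S_r) (a : 'I_r) := reshape_offset sh (t^-1%g a).

Definition tabloid (t : 'S_r) : {set 'S_r} :=
  [set t' | [forall a, row_of t' a == row_of t a]].

Definition col_stab (t : 'S_r) : {set 'S_r} :=
  [set p : 'S_r | [forall a, col_of t (p a) == col_of t a]].

Definition polytabloid (t : 'S_r) : {ffun {set 'S_r} -> F^o} :=
  \sum_(p in col_stab t)
    (-1) ^+ odd_perm p *: basis_vec F (tabloid (pcomp p t)).

Definition tabloid_act (s : 'S_r) : 'End({ffun {set 'S_r} -> F^o}) :=
  lin_ext (fun A : {set 'S_r} => basis_vec F [set pcomp s t | t in A]).

Definition specht_space : {vspace {ffun {set 'S_r} -> F^o}} :=
  <<[seq polytabloid t | t : 'S_r]>>%VS.

Definition specht : opmod F 'S_r :=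
  @Opmod F 'S_r (subquot specht_space 0)
    (fun s => subquot_end specht_space 0 (tabloid_act s)).

End Specht.

Definition young_emb k l (p : 'S_k * 'S_l) : 'S_(k + l) :=
  pcomp (extend_perm (@lshift_inj k l) p.1) (extend_perm (@rshift_inj k l) p.2).

Definition group_bimod k l : bimod F 'S_(k + l) ('S_k * 'S_l) :=
  @Bimod F _ _ {ffun 'S_(k + l) -> F^o}
    (fun s => lin_ext (fun t : 'S_(k + l) => basis_vec F (pcomp s t)))
    (fun p => lin_ext (fun t : 'S_(k + l) => basis_vec F (pcomp t (young_emb p)))).

Definition young_ind k l (M : opmod F 'S_k) (N : opmod F 'S_l) :
    opmod F 'S_(k + l) :=
  tensor (group_bimod k l) (outer_tensor M N).

End Symmetric.

Section Cells.

Variables (F : fieldType) (delta delta' : F) (n k : nat).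
Variable S : {set diagram n}.

Notation basis := {d : diagram n | d \in S}.

(* Since $dd'$ is a multiple of the diagram $d \circ d'$, the action is       *)
(* $dd'$ if this lies in the span of [S], and $0$ otherwise.                  *)
Definition cell_lact (d : diagram n) : 'End({ffun basis -> F^o}) :=
  lin_ext (fun d' : basis =>
    if insub (comp_diagram d (val d')) is Some e
    then comp_coef d (val d') delta delta' *: basis_vec F (e : basis) else 0).

Definition cell_ract (s : 'S_k) : 'End({ffun basis -> F^o}) :=
  lin_ext (fun d' : basis =>
    if insub (right_act s (val d')) is Some e
    then basis_vec F (e : basis) else 0).

Definition cell_bimod X (f : X -> diagram n) : bimod F X 'S_k :=
  @Bimod F X 'S_k {ffun basis -> F^o} (fun x => cell_lact (f x)) cell_ract.

Definition cell_filt (l : nat) : {vspace {ffun basis -> F^o}} :=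
  <<[seq basis_vec F d | d : basis
       in [pred d : basis | (l <= #|upper_singletons (val d)|)%N]]>>%VS.

Definition cell_layer (l : nat) : bimod F (diagram n) 'S_k :=
  @subquot_bimod F _ _ (cell_bimod id) (cell_filt l) (cell_filt l.+2).

End Cells.

Definition brauer_val n (d : brauer n) : diagram n := val d.

Definition layer_module (F : fieldType) (delta delta' : F) n k
    (L : {set diagram n}) (l : nat) (la : intpartn k) : opmod F (brauer n) :=
  restrict (@brauer_val n)
    (tensor (cell_layer delta delta' k L l) (specht F k la)).

(* [Lb] is a left cell of the set of all diagrams, to be intersected with the *)
(* set of Brauer diagrams. The value 0 of the second parameter is irrelevant: *)
(* products of Brauer diagrams have no open strings.                          *)
Definition brauer_specht (F : fieldType) (delta : F) n r (Lb : {set diagram n})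
    (mu : intpartn r) : opmod F (brauer n) :=
  tensor (cell_bimod delta 0 r (Lb :&: brauer_set n) (@brauer_val n))
    (specht F r mu).

(* Main.v *)
Require Import Defs.
Set Warnings "-notation-overridden,-ambiguous-paths,-redundant-canonical-projection".
From HB Require Import structures.
From mathcomp Require Import all_boot all_order all_fingroup all_algebra.
From mathcomp Require Import all_solvable mxrepresentation.
From mathcomp Require Import boolp reals complex.
Import Defs.

(* Cutting the last $l$ of the $k + l$ propagating lines of a Brauer diagram  *)
(* into singletons identifies the layer with the quotient of the Brauer cell  *)
(* module by $S_l$, that is, with its tensor product over $S_{k + l}$ with    *)
(* the module induced from $S_k \times S_l$. Call the propagating lines and   *)
(* the singletons of the upper half of a diagram $d$ its defects. A Brauer    *)
(* diagram $b$ kills $d$ in a layer if and only if $b | d$ joins two defects: *)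
(* two joined singletons are an open string, hence contribute $\delta' = 0$,  *)
(* and any other join changes the left cell. This criterion, the closed loops *)
(* and the upper half of $b \circ d$ only depend on $b$ and on the upper half *)
(* of $d$, so that the identification commutes with $b$.                      *)
(*                                                                            *)
(* The induced module is a direct sum of Specht modules: these are            *)
(* irreducible because a column antisymmetrizer has rank 1 on the tabloid     *)
(* module of its own shape, and there are as many of them as conjugacy        *)
(* classes. The product of the row symmetrizer and the column antisymmetrizer *)
(* of shape $\mu$ has rank 1 on the Specht module of $\mu$ and 0 on the      *)
(* others, so that its rank on any module is the multiplicity of this one.    *)

Set Implicit Arguments.
Unset Strict Implicit.
Unset Printing Implicit Defensive.

Import GRing.Theory.
Import VectorInternalTheory.

Local Open Scope ring_scope.

(** * Linear algebra and tensor products *)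

Section LinearAlgebra.

Variable F : fieldType.

(** Let $B$ be the Brauer cell module of [Lb], with its right action of $S_{k+l}$, and let
    $\mathrm{Ind}$ be the module induced from $S_k\times S_l$. The proof is the chain
    $N_l(\lambda)\cong B\otimes_{S_{k+l}}\mathrm{Ind}\cong B\otimes_{S_{k+l}}\bigoplus_\mu
    m_\mu\mathcal{S}(\mu)\cong\bigoplus_\mu m_\mu\Delta^{\mathfrak{B}}(\mu)$.

    The first isomorphism is [layer_induced_iso]. In a fixed left cell a diagram amounts to its
    upper half, made of arcs, singletons and labelled propagating lines ([half_inj], [half_surj]).
    Turning the lines with the last $l$ labels into singletons maps the Brauer diagrams of [Lb] onto
    the diagrams of [L] with exactly $l$ singletons, and the fibres are $S_l$-orbits
    ([forget_labels_surj], [forget_fiber]). These diagrams span the layer ([gen_layer]). Hence the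
    layer is the space of $S_l$-coinvariants of $B$, and tensoring it with $\mathcal{S}(\lambda)$
    over $S_k$ is tensoring $B$ with $\mathrm{Ind}$ over $S_{k+l}$.

    The identification respects the action of a Brauer diagram $b$ for the following reason. On the
    vertices of $b$, the graph $b|d$ is the union of two matchings, [mate b], which is perfect, and
    [upper_mate d]; its paths pair up the top vertices and the defects. Since [upper_mate] does not
    distinguish a singleton from a propagating line, it is unchanged by the cutting
    ([forget_upper_mate]), and so are the vanishing criterion [good], the loops [core_loops] and the
    pairing [core_other]. If two defects are joined, both actions give 0 ([bad_comp]).

    The second isomorphism is complete reducibility over a closed field of characteristic 0: Specht
    modules are irreducible and pairwise nonisomorphic ([specht_irr], [specht_rsim_eq]), a count of
    conjugacy classes shows that there are no others ([rep_contains_specht]), and the rank of a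
    Young symmetrizer computes multiplicities ([specht_multiplicity]). The third is additivity of
    the tensor product ([tensor_bigdsum]). *)

Lemma lin_lfunE (U V : vectType F) (f : U -> V) : linear f -> linfun f =1 f.
Proof.
move=> lin; pose H := GRing.isLinear.Build _ _ _ _ _ lin.
pose h : {linear U -> V} := HB.pack f H.
by move=> x; rewrite -[linfun f]/(linfun h) lfunE.
Qed.

Lemma ex_lfun (U V : vectType F) (f : U -> V) :
  linear f -> exists h : 'Hom(U, V), h =1 f.
Proof. by move=> lin; exists (linfun f); apply: lin_lfunE. Qed.

Lemma basis_vec_span (I : finType) (x : {ffun I -> F^o}) :
  x = \sum_i (x i : F) *: basis_vec F i.
Proof.
apply/ffunP=> j; rewrite sum_ffunE (bigD1 j) //= !ffunE eqxx big1 ?addr0.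
  by rewrite [_ *: _]mulr1.
by move=> i ij; rewrite !ffunE eq_sym (negPf ij) scaler0.
Qed.

Lemma ffun_hom_ext (I : finType) (V : vectType F)
    (f g : 'Hom({ffun I -> F^o}, V)) :
  (forall i, f (basis_vec F i) = g (basis_vec F i)) -> f = g.
Proof.
move=> fg; apply/lfunP=> x; rewrite [x]basis_vec_span !linear_sum /=.
by apply: eq_bigr => i _; rewrite !linearZ /= fg.
Qed.

Lemma subv_sum_seq (V : vectType F) (I : Type) (s : seq I)
    (G : I -> {vspace V}) (Z : {vspace V}) :
  (forall i, G i <= Z)%VS -> (\sum_(i <- s) G i <= Z)%VS.
Proof.
by move=> GZ; elim/big_rec: _ => [|i z _ zZ]; rewrite ?sub0v // subv_add GZ.
Qed.

(** * Subquotients and the operators induced on them *)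

Section Subquotients.

Variables (V : vectType F) (U W : {vspace V}).

Lemma subquot_proj_is_linear : linear (@subquot_proj F V U W).
Proof. by move=> a u v; rewrite /subquot_proj !linearP. Qed.

HB.instance Definition _ := GRing.isLinear.Build F V (subquot U W) _
  (@subquot_proj F V U W) subquot_proj_is_linear.

Hypothesis WU : (W <= U)%VS.

(** Passing to the representative in the complement changes a vector only by an element of [W], so a
    map that kills [W] may be evaluated on either. *)
Lemma subquot_valK u : u \in U -> u - vsval (subquot_proj U W u) \in W.
Proof.
move=> uU; have vU : vsval (subquot_proj U W u) \in U.
  by apply: (subvP (diffvSl U W)); apply: subvsP.
by rewrite -(subquot_proj_eq0 WU) ?rpredB // linearB /= subquot_proj_val subrr.
Qed.

Lemma subquot_val_hom (P : vectType F) (G : 'Hom(V, P)) u :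
  (W <= lker G)%VS -> u \in U -> G (vsval (subquot_proj U W u)) = G u.
Proof.
move=> /subvP GW /subquot_valK /GW; rewrite memv_ker linearB /= subr_eq0.
by move/eqP->.
Qed.

Lemma subquot_endE (f : 'End(V)) u :
  (f @: W <= W)%VS -> (f @: U <= U)%VS -> u \in U ->
  subquot_end U W f (subquot_proj U W u) = subquot_proj U W (f u).
Proof.
move=> fW fU uU; rewrite /subquot_end lin_lfunE; last first.
  by move=> a x y; rewrite !linearP.
have vU : vsval (subquot_proj U W u) \in U.
  by apply: (subvP (diffvSl U W)); apply: subvsP.
have fUP x : x \in U -> f x \in U by move=> xU; apply: (subvP fU);
  apply: memv_img.
apply/eqP; rewrite -subr_eq0 -linearB -linearB /= subquot_proj_eq0 //.
  by rewrite -opprB linearN rpredN; apply: (subvP fW);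
    rewrite memv_img ?subquot_valK.
by rewrite fUP // rpredB.
Qed.

End Subquotients.

(** * Tensor products of vector spaces *)

Section Tens.

Variables (V W : vectType F).

Lemma pure_tens_linl (w : W) : linear (fun v : V => pure_tens v w).
Proof. by move=> a u v; rewrite /pure_tens !linearP mulmxDl -scalemxAl. Qed.

Lemma pure_tens_linr (v : V) : linear (@pure_tens F V W v).
Proof. by move=> a u w; rewrite /pure_tens linearP mulmxDr -scalemxAr. Qed.

Lemma tens_ext (P : vectType F) (f g : 'Hom(tens V W, P)) :
  (forall v w, f (pure_tens v w) = g (pure_tens v w)) -> f = g.
Proof.
move=> fg; apply/lfunP=> A; rewrite [A]matrix_sum_delta !linear_sum /=.
apply: eq_bigr => i _; rewrite !linear_sum /=; apply: eq_bigr => j _.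
rewrite !linearZ /=; congr (_ *: _).
have -> : delta_mx i j = pure_tens (r2v (delta_mx 0 i)) (r2v (delta_mx 0 j)) :>
  tens V W.
  by rewrite /pure_tens !r2vK trmx_delta mul_delta_mx.
exact: fg.
Qed.

(** A bilinear map is encoded as a map into a space of homomorphisms; this is the linear map it
    induces, given by its values on the canonical bases. *)
Definition tens_lift (P : vectType F) (b : V -> 'Hom(W, P)) :
    'Hom(tens V W, P) :=
  linfun (fun A : tens V W => \sum_i \sum_j (A : 'M_(_, _)) i j
    *: b (r2v (delta_mx 0 i)) (r2v (delta_mx 0 j))).

Lemma tens_liftE (P : vectType F) (b : V -> 'Hom(W, P)) v w :
  linear b ->
  tens_lift b (pure_tens v w) = b v w.
Proof.
move=> lb; have lin : linear (fun A : tens V W => \sum_i \sum_j (A : 'M_(_,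
  _)) i j
    *: b (r2v (delta_mx 0 i)) (r2v (delta_mx 0 j))).
  move=> a A B; rewrite scaler_sumr -big_split; apply: eq_bigr => i _ /=.
  rewrite scaler_sumr -big_split; apply: eq_bigr => j _ /=.
  by rewrite !mxE scalerDl scalerA.
rewrite /tens_lift lin_lfunE //.
have lw : linear (fun u => b u w) by move=> a x y;
  rewrite lb add_lfunE scale_lfunE.
have -> : b v w = linfun (fun u => b u w) v by rewrite lin_lfunE.
rewrite -{2}[v]v2rK [v2r v]row_sum_delta !linear_sum /=.
apply: eq_bigr => i _; rewrite !linearZ /= lin_lfunE //.
rewrite -{2}[w]v2rK [v2r w]row_sum_delta !linear_sum /=.
apply: eq_bigr => j _; rewrite !linearZ /= scalerA /pure_tens !mxE big_ord1.
by rewrite !mxE mulrC.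
Qed.

End Tens.

(** * Balanced tensor products and their universal property *)

Section Tensor.

Variables (X : Type) (Y : finType).

Section Def.

Variables (M : bimod F X Y) (N : opmod F Y).

Definition tensp (m : M) (v : N) : tensor M N :=
  subquot_proj fullv (tensor_rel M N) (pure_tens m v).

Lemma tensp_linl v : linear (tensp^~ v).
Proof. by move=> a u w; rewrite /tensp pure_tens_linl linearP. Qed.

Lemma tensp_linr m : linear (tensp m).
Proof. by move=> a u w; rewrite /tensp pure_tens_linr linearP. Qed.

Definition tenspl (m : M) : 'Hom(N, tensor M N) := linfun (tensp m).

Lemma tensplE m v : tenspl m v = tensp m v.
Proof. by rewrite lin_lfunE //; apply: tensp_linr. Qed.

Lemma tenspl_linear : linear tenspl.
Proof.
move=> a u w; apply/lfunP=> v; rewrite add_lfunE scale_lfunE !tensplE.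
exact: tensp_linl.
Qed.

Lemma tensor_ext (P : vectType F) (f g : 'Hom(tensor M N, P)) :
  (forall m v, f (tensp m v) = g (tensp m v)) -> f = g.
Proof.
move=> fg; pose pr := linfun (@subquot_proj F _ fullv (tensor_rel M N)).
suff E : (f \o pr = g \o pr)%VF.
  apply/lfunP=> x; rewrite -(subquot_proj_val x).
  by move/lfunP/(_ (vsval x)): E; rewrite !comp_lfunE !lfunE.
by apply: tens_ext => v w; rewrite !comp_lfunE !lfunE; apply: fg.
Qed.

(** [tensor_rel] imposes this on basis vectors; both sides are bilinear, so it extends to all
    vectors. *)
Lemma tensp_balanced y m v : tensp (ract M y m) v = tensp m (act N y v).
Proof.
pose f := linfun (fun m => tenspl (ract M y m)).
pose g := linfun (fun m => (tenspl m \o act N y)%VF).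
have fE u w : f u w = tensp (ract M y u) w.
  rewrite lin_lfunE ?tensplE // => a u1 u2.
  by rewrite linearP tenspl_linear.
have gE u w : g u w = tensp u (act N y w).
  rewrite lin_lfunE ?comp_lfunE ?tensplE // => a u1 u2.
  by rewrite tenspl_linear comp_lfunDl comp_lfunZl.
have sp (Z : vectType F) : <<vbasis {:Z}>>%VS
  = fullv by apply/span_basis/vbasisP.
have E : f = g.
  apply/(fullv_lfunP _ _ (sp _)) => u uM.
  apply/(fullv_lfunP _ _ (sp _)) => w wN.
  rewrite fE gE /tensp; apply/eqP; rewrite -subr_eq0 -linearB /=.
  rewrite subquot_proj_eq0 ?subvf ?memvf // /tensor_rel.
  have sub1 (I : eqType) (s : seq I) (G : I -> {vspace tens M N}) i :
    i \in s -> (G i <= \sum_(i <- s) G i)%VS.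
    by move=> si; rewrite (big_rem i) //= addvSl.
  apply: (subvP (sub1 _ _ _ y _)); first by rewrite mem_index_enum.
  apply: (subvP (sub1 _ _ _ u _)) => //.
  by apply: (subvP (sub1 _ _ _ w _)) => //; apply: memv_line.
by rewrite -fE E gE.
Qed.

Definition tensor_lift (P : vectType F) (b : M -> 'Hom(N, P)) :
    'Hom(tensor M N, P) :=
  linfun (fun x : tensor M N => tens_lift b (vsval x)).

Lemma tensor_liftE (P : vectType F) (b : M -> 'Hom(N, P)) m v :
  linear b ->
  (forall y m v, b (ract M y m) v = b m (act N y v)) ->
  tensor_lift b (tensp m v) = b m v.
Proof.
move=> lb bal; rewrite /tensor_lift lin_lfunE; last first.
  by move=> a x z; rewrite !linearP.
rewrite subquot_val_hom ?memvf ?subvf ?tens_liftE //.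
apply/subv_sumP => y _.
apply: subv_sum_seq => u; apply: subv_sum_seq => w.
by rewrite -memvE memv_ker linearB /= !tens_liftE // bal subrr.
Qed.

(** An operator that commutes with the right action preserves [tensor_rel], so that [subquot_end] is
    the operator it induces on the quotient. *)
Lemma tensor_actE x m v :
  (forall y m, lact M x (ract M y m) = ract M y (lact M x m)) ->
  act (tensor M N) x (tensp m v) = tensp (lact M x m) v.
Proof.
move=> com; rewrite /=; set f := tens_end _ _;
  rewrite /tensp subquot_endE ?subvf ?memvf ?tens_endE ?id_lfunE //.
pose pr := linfun (@subquot_proj F _ fullv (tensor_rel M N)).
suff /subvP frel : (tensor_rel M N <= lker (pr \o f))%VS.
  apply/subvP=> _ /memv_imgP[z /frel + ->].
  by rewrite memv_ker comp_lfunE lfunE /= subquot_proj_eq0 ?subvf ?memvf.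
apply/subv_sumP => y _.
apply: subv_sum_seq => u; apply: subv_sum_seq => w.
rewrite -memvE memv_ker comp_lfunE !linearB /= !tens_endE !id_lfunE !lfunE /=.
by rewrite com -/(tensp _ _) tensp_balanced subrr.
Qed.

End Def.

End Tensor.


(** * Isomorphisms and direct sums of modules *)

Section Isomorphisms.

Variable X : Type.
Implicit Types M N P : opmod F X.

Definition equivariant M N (f : M -> N) :=
  forall x v, f (act M x v) = act N x (f v).

(** The same relation as [isomorphic], but with the inverse carried as a linear map, ready for
    composition. *)
Definition iso M N := exists (f : 'Hom(M, N)) (g : 'Hom(N, M)),
  [/\ cancel f g, cancel g f & equivariant f].

Lemma iso_isomorphic M N : iso M N -> isomorphic M N.
Proof. by case=> f [g [fK gK fE]]; exists f; split=> //; exists g. Qed.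

Lemma isomorphic_iso M N : isomorphic M N -> iso M N.
Proof.
case=> f [[g fK gK] fE]; have lg : linear g.
  by move=> a u v; apply: (can_inj fK); rewrite gK linearP /= !gK.
exists (linfun f), (linfun g); split=> [u|v|x u].
- by rewrite (lin_lfunE lg) lfunE /= fK.
- by rewrite (lin_lfunE lg) lfunE /= gK.
- by rewrite !lfunE /= fE.
Qed.

Lemma iso_refl M : iso M M.
Proof. by exists \1%VF, \1%VF; split=> [u|u|x u]; rewrite !id_lfunE. Qed.

Lemma iso_sym M N : iso M N -> iso N M.
Proof.
case=> f [g [fK gK fE]]; exists g, f; split=> // x v.
by apply: (can_inj fK); rewrite fE !gK.
Qed.

Lemma iso_trans N M P : iso M N -> iso N P -> iso M P.
Proof.
case=> f [f' [fK f'K fE]] [g [g' [gK g'K gE]]].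
exists (g \o f)%VF, (f' \o g')%VF; split=> [u|u|x u]; rewrite !comp_lfunE /=.
- by rewrite gK fK.
- by rewrite f'K g'K.
- by rewrite fE gE.
Qed.

Lemma dsum_actE M N x (u : M) (v : N) :
  act (dsum M N) x (u, v) = (act M x u, act N x v).
Proof.
have lin : linear (fun p : dsum M N => (act M x p.1, act N x p.2) : dsum M N).
  by move=> a [u1 v1] [u2 v2]; rewrite !linearP.
exact: (lin_lfunE lin (u, v)).
Qed.

Lemma pair_hom M N P (f : 'Hom(P, M)) (g : 'Hom(P, N)) :
  exists h : 'Hom(P, dsum M N), forall u, h u = (f u, g u).
Proof.
by apply: (@ex_lfun P (dsum M N)) => a u1 u2; rewrite !linearP.
Qed.

Lemma copair_hom M N P (f : 'Hom(M, P)) (g : 'Hom(N, P)) :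
  exists h : 'Hom(dsum M N, P), forall u v, h (u, v) = f u + g v.
Proof.
have [|h hE] := @ex_lfun (dsum M N) P (fun u => f u.1 + g u.2).
  by move=> a u1 u2; rewrite !linearP /= addrACA scalerDr.
by exists h => u v; rewrite hE.
Qed.

Lemma iso_dsum M N M' N' : iso M M' -> iso N N' -> iso (dsum M N) (dsum M' N').
Proof.
case=> f [f' [fK f'K fE]] [g [g' [gK g'K gE]]].
have [|h hE] := @ex_lfun (dsum M N) (dsum M' N') (fun u => (f u.1, g u.2)).
  by move=> a u1 u2; rewrite !linearP.
have [|h' h'E] := @ex_lfun (dsum M' N') (dsum M N) (fun u => (f' u.1, g' u.2)).
  by move=> a u1 u2; rewrite !linearP.
exists h, h'; split=> [[u v]|[u v]|x [u v]].
- by rewrite hE h'E /= fK gK.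
- by rewrite h'E hE /= f'K g'K.
- by rewrite dsum_actE !hE /= dsum_actE /= fE gE.
Qed.

Lemma iso_zero M : (forall u : M, u = 0) -> iso M (zero_mod F X).
Proof.
move=> M0; have Z0 (v : zero_mod F X) : v = 0 by apply: thinmx0.
exists 0, 0; split=> [u|v|x u].
- by rewrite [LHS]M0 [RHS]M0.
- by rewrite [LHS]Z0 [RHS]Z0.
- by rewrite [LHS]Z0 [RHS]Z0.
Qed.

Lemma dsum0l M : iso (dsum (zero_mod F X) M) M.
Proof.
have [h hE] := copair_hom (0 : 'Hom(zero_mod F X, M)) (\1%VF : 'Hom(M, M)).
have [h' h'E] := pair_hom (0 : 'Hom(M, zero_mod F X)) (\1%VF : 'Hom(M, M)).
have Z0 (v : zero_mod F X) : v = 0 by apply: thinmx0.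
exists h, h'; split=> [[u v]|v|x [u v]].
- by rewrite hE h'E !zero_lfunE !id_lfunE add0r [u]Z0.
- by rewrite h'E hE !zero_lfunE !id_lfunE add0r.
- by rewrite dsum_actE !hE !zero_lfunE !id_lfunE !add0r.
Qed.

Lemma dsumA M N P : iso (dsum M (dsum N P)) (dsum (dsum M N) P).
Proof.
have [//|h hE] := @ex_lfun (dsum M (dsum N P)) (dsum (dsum M N) P)
  (fun u => ((u.1, u.2.1), u.2.2)).
have [//|h' h'E] := @ex_lfun (dsum (dsum M N) P) (dsum M (dsum N P))
  (fun u => (u.1.1, (u.1.2, u.2))).
exists h, h'; split=> [[u [v w]]|[[u v] w]|x [u [v w]]].
- by rewrite hE h'E.
- by rewrite h'E hE.
- by rewrite !dsum_actE !hE !dsum_actE.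
Qed.

Lemma dsumC M N : iso (dsum M N) (dsum N M).
Proof.
have [//|h hE] := @ex_lfun (dsum M N) (dsum N M) (fun u => (u.2, u.1)).
have [//|h' h'E] := @ex_lfun (dsum N M) (dsum M N) (fun u => (u.2, u.1)).
exists h, h'; split=> [[u v]|[u v]|x [u v]].
- by rewrite hE h'E.
- by rewrite h'E hE.
- by rewrite !dsum_actE !hE !dsum_actE.
Qed.

End Isomorphisms.

(** * The tensor product as an additive functor *)

Section TensorFunctor.

Variables (X : Type) (Y : finType) (B : bimod F X Y).
Hypothesis B_com : forall x y m, lact B x (ract B y m) = ract B y (lact B x m).

Lemma tensor_map (N N' : opmod F Y) (f : 'Hom(N, N')) : equivariant f ->
  exists g : 'Hom(tensor B N, tensor B N'),
    (forall m v, g (tensp m v) = tensp m (f v)) /\ equivariant g.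
Proof.
move=> fE; pose b (m : B) := (tenspl N' m \o f)%VF.
have lb : linear b.
  by move=> a u v; rewrite /b tenspl_linear comp_lfunDl comp_lfunZl.
have bE m v : tensor_lift b (tensp m v) = tensp m (f v).
  rewrite tensor_liftE // ?comp_lfunE ?tensplE // => y u w.
  by rewrite !comp_lfunE !tensplE fE tensp_balanced.
exists (tensor_lift b); split=> // x u;
  have E : (tensor_lift b \o act (tensor B N) x
    = act (tensor B N') x \o tensor_lift b)%VF.
  by apply: tensor_ext => m v; rewrite !comp_lfunE bE !tensor_actE // bE.
by rewrite -!comp_lfunE E.
Qed.

Lemma iso_tensor (N N' : opmod F Y) : iso N N'
  -> iso (tensor B N) (tensor B N').
Proof.
case=> f [g [fK gK fE]]; have gE : equivariant g.
  by move=> x v; apply: (can_inj fK); rewrite fE !gK.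
have [f1 [f1E f1eq]] := tensor_map fE; have [g1 [g1E _]] := tensor_map gE.
have fgK : (g1 \o f1 = \1)%VF.
  by apply: tensor_ext => m v; rewrite comp_lfunE f1E g1E fK id_lfunE.
have gfK : (f1 \o g1 = \1)%VF.
  by apply: tensor_ext => m v; rewrite comp_lfunE g1E f1E gK id_lfunE.
exists f1, g1; split=> // u; rewrite -comp_lfunE ?fgK ?gfK id_lfunE //.
Qed.

Lemma tensor_zero : iso (tensor B (zero_mod F Y)) (zero_mod F X).
Proof.
apply: iso_zero => u; have E : (\1 = 0 :> 'End(tensor B (zero_mod F Y)))%VF.
  apply: tensor_ext => m v; rewrite id_lfunE zero_lfunE.
  have -> : v = 0 by apply: thinmx0.
  by rewrite -tensplE linear0.
by rewrite -[u]id_lfunE E zero_lfunE.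
Qed.

(** The functor carries the injections and projections of the direct sum to maps that satisfy the
    same identities. *)
Lemma tensor_dsum (N N' : opmod F Y) :
  iso (tensor B (dsum N N')) (dsum (tensor B N) (tensor B N')).
Proof.
have [p1 p1E] := @ex_lfun (dsum N N') N fst (fun _ _ _ => erefl).
have [p2 p2E] := @ex_lfun (dsum N N') N' snd (fun _ _ _ => erefl).
have [i1 i1E] := pair_hom (\1 : 'End(N))%VF (0 : 'Hom(N, N')).
have [i2 i2E] := pair_hom (0 : 'Hom(N', N)) (\1 : 'End(N'))%VF.
have [P1 [P1E P1q]] : exists g : 'Hom(tensor B (dsum N N'), tensor B N),
    (forall m v, g (tensp m v) = tensp m (p1 v)) /\ equivariant g.
  by apply: tensor_map => x [u v]; rewrite dsum_actE !p1E.
have [P2 [P2E P2q]] : exists g : 'Hom(tensor B (dsum N N'), tensor B N'),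
    (forall m v, g (tensp m v) = tensp m (p2 v)) /\ equivariant g.
  by apply: tensor_map => x [u v]; rewrite dsum_actE !p2E.
have [I1 [I1E _]] : exists g : 'Hom(tensor B N, tensor B (dsum N N')),
    (forall m v, g (tensp m v) = tensp m (i1 v)) /\ equivariant g.
  by apply: tensor_map => x u; rewrite !i1E dsum_actE !zero_lfunE linear0
    !id_lfunE.
have [I2 [I2E _]] : exists g : 'Hom(tensor B N', tensor B (dsum N N')),
    (forall m v, g (tensp m v) = tensp m (i2 v)) /\ equivariant g.
  by apply: tensor_map => x u; rewrite !i2E dsum_actE !zero_lfunE linear0
    !id_lfunE.
have [h hE] := pair_hom P1 P2; have [k kE] := copair_hom I1 I2.
have tE (Z : opmod F Y) m (v w : Z) : tensp m v + tensp m w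
  = tensp m (v + w) :> tensor B Z.
  by rewrite -!tensplE linearD.
have t0 (Z : opmod F Y) m : tensp m (0 : Z) = 0 :> tensor B Z.
  by rewrite -tensplE linear0.
have hkK : (k \o h = \1)%VF.
  apply: tensor_ext => m [u v]; rewrite comp_lfunE hE kE P1E P2E I1E I2E tE.
  by rewrite p1E p2E i1E i2E !id_lfunE !zero_lfunE /= -[_ + _]/(u + 0,
    0 + v) addr0 add0r.
have k1 : (P1 \o I1 = \1)%VF.
  by apply: tensor_ext => m u; rewrite comp_lfunE I1E P1E p1E i1E !id_lfunE.
have k2 : (P2 \o I2 = \1)%VF.
  by apply: tensor_ext => m u; rewrite comp_lfunE I2E P2E p2E i2E !id_lfunE.
have k3 : (P2 \o I1 = 0)%VF.
  by apply: tensor_ext => m u; rewrite comp_lfunE I1E P2E p2E i1E !zero_lfunE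
    t0.
have k4 : (P1 \o I2 = 0)%VF.
  by apply: tensor_ext => m u; rewrite comp_lfunE I2E P1E p1E i2E !zero_lfunE
    t0.
exists h, k; split=> [u|[u v]|x u].
- by rewrite -comp_lfunE hkK id_lfunE.
- rewrite kE hE !linearD /= -!(comp_lfunE P1) -!(comp_lfunE P2) k1 k2 k3 k4.
  by rewrite !id_lfunE !zero_lfunE addr0 add0r.
- by rewrite !hE dsum_actE P1q P2q.
Qed.

Lemma tensor_copies m (N : opmod F Y) :
  iso (tensor B (copies m N)) (copies m (tensor B N)).
Proof.
elim: m => [|m IH]; first exact: tensor_zero.
by apply: iso_trans (tensor_dsum _ _) _; apply: iso_dsum => //; apply: iso_refl.
Qed.

Lemma tensor_bigdsum (I : finType) (P : pred I) (m : I -> nat) (N : I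
  -> opmod F Y) :
  iso (tensor B (\big[@dsum F Y/zero_mod F Y]_(i | P i) copies (m i) (N i)))
    (\big[@dsum F X/zero_mod F X]_(i | P i) copies (m i) (tensor B (N i))).
Proof.
apply: (big_rec2 (fun U V => iso (tensor B U) V)); first exact: tensor_zero.
move=> i V U _ IH; apply: iso_trans (tensor_dsum _ _) _.
by apply: iso_dsum => //; apply: tensor_copies.
Qed.

End TensorFunctor.

End LinearAlgebra.

(** * Diagrams as involutions *)

Section Involutions.

Variable T : finType.
Implicit Types f g : T -> T.

(** An involution is viewed as a matching: its orbits of size 2 are the edges, its fixed points the
    unmatched vertices. *)
Definition adjf f : rel T := fun x y => (f x == y) && (x != y).

Definition orb2 f g : rel T := connect (relU (adjf f) (adjf g)).

Lemma adjf_sym f : involutive f -> symmetric (adjf f).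
Proof.
by move=> fK x y; rewrite /adjf (can2_eq fK fK) [x == f y]eq_sym [x == y]eq_sym.
Qed.

Lemma adjf_id f x : f x = x -> adjf f x =1 xpred0.
Proof. by move=> fx y; rewrite /adjf fx andbN. Qed.

Lemma invol_card_even f (K : {set T}) : involutive f ->
  {in K, forall x, f x != x} -> {in K, forall x, f x \in K} -> ~~ odd #|K|.
Proof.
move=> fK; elim: {K}_.+1 {-2}K (ltnSn #|K|) => // m IH K Km fx0 KP.
case: (set_0Vmem K) => [->|[x xK]]; first by rewrite cards0.
rewrite (cardsD1 x) xK (cardsD1 (f x)) !inE (fx0 _ xK) (KP _ xK) //= negbK;
  apply: IH.
- move: Km; rewrite (cardsD1 x) xK (cardsD1 (f x)) !inE (fx0 _ xK) (KP _ xK) //=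
  !add1n.
  by rewrite ltnS => /ltnW.
- by move=> y; rewrite !inE => /and3P[_ _ /fx0].
- move=> y; rewrite !inE => /and3P[yf yx yK].
  by rewrite (KP _ yK) andbT (can_eq fK) yx (can2_eq fK fK) yf.
Qed.

Section Orb.

Variables (f g : T -> T) (fK : involutive f) (gK : involutive g).

Lemma orb2_sym : symmetric (orb2 f g).
Proof.
by apply: sym_connect_sym => x y; rewrite /= (adjf_sym fK) (adjf_sym gK).
Qed.

Lemma orb2_refl x : orb2 f g x x. Proof. exact: connect0. Qed.

Lemma orb2_trans : transitive (orb2 f g). Proof. exact: connect_trans. Qed.

Lemma orb2_f x : orb2 f g x (f x).
Proof.
case: (eqVneq x (f x)) => [<-|xf]; first exact: orb2_refl.
by apply: connect1; rewrite /= /adjf eqxx xf.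
Qed.

Lemma orb2_g x : orb2 f g x (g x).
Proof.
case: (eqVneq x (g x)) => [<-|xf]; first exact: orb2_refl.
by apply: connect1; rewrite /= /adjf eqxx xf orbT.
Qed.

(** A fixed point of [g] is an end of its component, and [two_matchings] bounds the number of ends
    by two. *)
Lemma orb2_ends x y z : g x = x -> g y = y -> g z = z ->
  orb2 f g x y -> orb2 f g x z -> [\/ x = y, x = z | y = z].
Proof.
move=> gx gy gz; have adjf_fun h u v w : adjf h u v -> adjf h u w -> v = w.
  by move=> /andP[/eqP <- _] /andP[/eqP <- _].
apply: two_matchings; try exact: adjf_sym; try exact: adjf_fun.
- by right; apply: adjf_id.
- by right; apply: adjf_id.
- by right; apply: adjf_id.
Qed.

Hypothesis f_free : forall x, f x != x.

(** Parity: [f] has no fixed point, so the component has even size; were [x] the only fixed point of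
    [g] in it, its size would be odd. *)
Lemma orb2_other x : g x = x -> exists y, [/\ y != x, g y = y & orb2 f g x y].
Proof.
move=> gx; pose K := [set y | orb2 f g x y].
have evK : ~~ odd #|K|.
  apply: (invol_card_even fK) => [y _ //|y]; rewrite !inE => xy.
  by apply: orb2_trans xy (orb2_f y).
have [y /and3P[]|no] := pickP (fun y => [&& y != x, g y == y & orb2 f g x y]).
  by move=> yx /eqP gy xy; exists y.
have gfree y : y \in K :\ x -> g y != y.
  by rewrite !inE => /andP[yx xy]; have := no y; rewrite yx xy andbT /= => ->.
have: ~~ odd #|K :\ x|.
  apply: (invol_card_even gK) => // y.
  rewrite !inE => /andP[yx xy]; rewrite (orb2_trans xy (orb2_g y)) andbT.
  by apply: contra yx => /eqP gyx; rewrite -[y]gK gyx gx.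
by move: evK; rewrite (cardsD1 x) inE orb2_refl /= => /negPn ->.
Qed.

Definition other x := odflt x [pick y | [&& y != x, g y == y & orb2 f g x y]].

Lemma otherP x : g x = x ->
  [/\ other x != x, g (other x) = other x & orb2 f g x (other x)].
Proof.
move=> gx; rewrite /other; case: pickP => [y /and3P[yx /eqP gy xy] //|no].
by have [y [yx /eqP gy xy]] := orb2_other gx; have := no y; rewrite yx gy xy.
Qed.

Lemma other_uniq x y : g x = x -> g y = y -> orb2 f g x y -> y != x -> y
  = other x.
Proof.
move=> gx gy xy yx; have [ox go xo] := otherP gx.
have [E|E|//] := orb2_ends gx gy go xy xo; first by rewrite E eqxx in yx.
by rewrite -E eqxx in ox.
Qed.

Lemma otherK x : g x = x -> other (other x) = x.
Proof.
move=> gx; have [ox go xo] := otherP gx; apply/esym/other_uniq => //.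
  by rewrite orb2_sym.
by rewrite eq_sym.
Qed.

End Orb.

End Involutions.

(** * Diagrams as involutions of their vertices *)

Section Mates.

Variable n : nat.
Implicit Types (d : diagram n) (v w : vtx n).

Definition mate d v : vtx n := odflt v [pick w | (w != v) && (w \in pblock d
  v)].

Lemma diagram_trivIset d : trivIset (parts d).
Proof. by have /andP[/and3P[]] := valP d. Qed.

Lemma diagram_cover d v : v \in cover (parts d).
Proof. by have /andP[/and3P[/eqP-> _ _] _] := valP d; rewrite inE. Qed.

Lemma pblock_mate d v : pblock d v = [set v; mate d v].
Proof.
have vd := diagram_cover d v.
have vb : v \in pblock d v by rewrite mem_pblock.
have /andP[_ /forall_inP/(_ _ (pblock_mem vd)) d2] := valP d.
apply/eqP; rewrite eq_sym eqEcard cards2 /mate.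
case: pickP => [w /andP[wv wb]|no] /=.
  rewrite eq_sym wv d2 andbT; apply/subsetP=> u.
  by rewrite !inE => /orP[] /eqP->.
rewrite eqxx /= setUid sub1set vb /= (cardsD1 v) vb leq_eqVlt; apply/orP; left.
rewrite -[1%N]addn0 eqn_add2l cards_eq0; apply/eqP/setP => w.
by rewrite !inE no.
Qed.

Lemma parts_mate d v : [set v; mate d v] \in parts d.
Proof. by rewrite -pblock_mate pblock_mem ?diagram_cover. Qed.

Lemma partsP d B : reflect (exists v, B = [set v; mate d v]) (B \in parts d).
Proof.
apply: (iffP idP) => [Bd|[v ->]]; last exact: parts_mate.
have /andP[/and3P[_ _ d0] _] := valP d.
case: (set_0Vmem B) => [B0|[v vB]]; first by rewrite -B0 Bd in d0.
by exists v; rewrite -pblock_mate (def_pblock (diagram_trivIset d) Bd vB).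
Qed.

Lemma mate_part d v w : ([set v;
  w] \in parts d) = (w == mate d v) || (w == v) && (mate d v == v).
Proof.
apply/idP/idP => [vwd|].
  have E : [set v; w] = [set v; mate d v].
    by rewrite -pblock_mate (def_pblock (diagram_trivIset d) vwd (set21 _ _)).
  have : w \in [set v; mate d v] by rewrite -E !inE eqxx orbT.
  rewrite !inE => /orP[] /eqP wE; last by rewrite wE eqxx.
  have : mate d v \in [set v; w] by rewrite E !inE eqxx orbT.
  by rewrite !inE wE orbb => /eqP ->; rewrite eqxx.
case/orP=> [/eqP->|/andP[/eqP-> /eqP mv]]; first exact: parts_mate.
by rewrite -{2}mv parts_mate.
Qed.

Lemma mateP d v w : v != w -> ([set v; w] \in parts d) = (mate d v == w).
Proof. by move=> vw; rewrite mate_part [w == v]eq_sym (negPf vw) orbF eq_sym.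
  Qed.

Lemma mate1P d v : ([set v] \in parts d) = (mate d v == v).
Proof. by rewrite -[[set v]]setUid mate_part eqxx /= [v == _]eq_sym orbb. Qed.

Lemma mateK d : involutive (mate d).
Proof.
move=> v; case: (eqVneq (mate d v) v) => [E|E]; first by rewrite !E.
by apply/eqP; rewrite -mateP // setUC parts_mate.
Qed.

Lemma diagram_eq d d' : mate d =1 mate d' -> d = d'.
Proof.
move=> dd; apply/val_inj/setP=> B.
by apply/partsP/partsP=> -[v ->]; exists v; rewrite dd.
Qed.

Section Make.

Variables (f : vtx n -> vtx n) (fK : involutive f).

Definition mk_parts := [set [set v; f v] | v : vtx n].

Lemma mk_parts_diagram : is_diagram mk_parts.
Proof.
have blk v w : w \in [set v; f v] -> [set v; f v] = [set w; f w].
  by rewrite !inE => /orP[] /eqP-> //; rewrite fK setUC.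
apply/andP; split; last first.
  by apply/forall_inP=> _ /imsetP[v _ ->]; rewrite cards2; case: (_ != _).
apply/and3P; split.
- apply/eqP/setP=> v; rewrite inE; apply/bigcupP.
  by exists [set v; f v]; [apply: imset_f | apply: set21].
- apply/trivIsetP=> _ _ /imsetP[v _ ->] /imsetP[w _ ->].
  apply: contraR => /pred0Pn[u /andP[/= uv uw]].
  by rewrite (blk _ _ uv) (blk _ _ uw).
- apply/imsetP=> -[v _ E]; have : v \in (set0 :
  {set vtx n}) by rewrite E !inE eqxx.
  by rewrite inE.
Qed.

Definition mk_diagram := Diagram mk_parts_diagram.

Lemma mate_mk : mate mk_diagram =1 f.
Proof.
move=> v; have : [set v; f v] \in parts mk_diagram by apply: imset_f.
rewrite mate_part => /orP[/eqP-> //|/andP[/eqP-> /eqP ->] //].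
Qed.

End Make.

Lemma is_brauerP d : reflect (forall v, mate d v != v) (is_brauer d).
Proof.
apply: (iffP forall_inP) => [H v|H B /partsP[v ->]].
  by have := H _ (parts_mate d v); rewrite cards2 [v == _]eq_sym;
    case: (_ != _).
by rewrite cards2 [v == _]eq_sym H.
Qed.

Lemma upper_singletonE d i : (i \in upper_singletons d)
  = (mate d (inl i) == inl i).
Proof. by rewrite inE mate1P. Qed.

(** The lower half of [d]: [None] marks the right end of a propagating line, and [Some j] a
    singleton. It is a complete invariant of the left cell by [left_equivP]. *)
Definition low d (j : 'I_n) : option 'I_n :=
  if mate d (inr j) is inr j' then Some j' else None.

Lemma right_endE d j : (j \in right_ends d) = (low d j == None).
Proof.
rewrite /low; apply/imsetP/idP => [[[i j'] /= + ->]|].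
  by rewrite inE /= setUC mateP // => /eqP->.
case E: (mate d (inr j)) => [i|//] _; exists (i, j) => //.
by rewrite inE /= setUC mateP // E.
Qed.

Lemma low_mate d j j' : low d j = Some j' <-> mate d (inr j) = inr j'.
Proof. by rewrite /low; case: (mate d _) => [i|i]; split=> // -[->]. Qed.

Lemma lower_partsP d B : reflect (exists j j',
  low d j = Some j' /\ B = [set inr j; inr j'])
  (B \in lower_parts d).
Proof.
rewrite inE; apply: (iffP andP) =>
  [[/partsP[v ->] /subsetP s]|[j [j' [/low_mate E ->]]]].
  have /imsetP[j _ vE] := s v (set21 _ _).
  have /imsetP[j' _ wE] := s (mate d v) (set22 _ _).
  by exists j, j'; rewrite wE vE; split=> //; apply/low_mate; rewrite -vE.
rewrite -E; split; first exact: parts_mate.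
by apply/subsetP=> u; rewrite !inE E => /orP[] /eqP->; rewrite imset_f.
Qed.

Lemma left_equivP d d' : reflect (low d =1 low d') (left_equiv d d').
Proof.
apply: (iffP eqP) => [E|E]; last first.
  apply/setP=> B; apply/lower_partsP/lower_partsP => -[j [j' [Ej ->]]];
    exists j, j'.
    by rewrite -E.
  by rewrite E.
suff sub e e' j j' : lower_parts e = lower_parts e' -> low e j = Some j'
  -> low e' j = Some j'.
  move=> j; case D: (low d j) => [j'|]; first by rewrite (sub _ _ _ _ E D).
  by case D': (low d' j) => [j'|//]; rewrite (sub _ _ _ _ (esym E) D') in D.
move=> ee ej; have : [set inr j; inr j'] \in lower_parts e'.
  by rewrite -ee; apply/lower_partsP; exists j, j'.
rewrite inE => /andP[+ _]; rewrite mate_part =>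
  /orP[/eqP E'|/andP[/eqP[->] /eqP E']].
  by apply/low_mate.
by apply/low_mate.
Qed.

Lemma left_cellP (L : {set diagram n}) : is_left_cell L ->
  exists2 d0, d0 \in L & forall d, (d \in L) = (left_equiv d0 d).
Proof.
case/imsetP=> d0 _ ->; exists d0; first by rewrite !inE; exact: eqxx.
by move=> d; rewrite !inE.
Qed.

Lemma mate_relabel p d v :
  mate (relabel p d) (relabel_vtx p v) = relabel_vtx p (mate d v).
Proof.
have p_inj : injective (relabel_vtx p) by move=>
  [x|x] [y|y] //= [] // /perm_inj->.
have : relabel_vtx p @: [set v; mate d v] \in parts (relabel p d).
  by apply/imset_f/parts_mate.
rewrite imsetU1 imset_set1 mate_part (inj_eq p_inj).
by case/orP=> [/eqP-> //|/andP[/eqP -> /eqP ->]].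
Qed.

End Mates.

Lemma orb2_ind (T : finType) (f g : T -> T) (P : T -> Prop) x y :
  (forall y, P y -> P (f y)) -> (forall y, P y -> P (g y)) ->
  orb2 f g x y -> P x -> P y.
Proof.
move=> Pf Pg /connectP[p + ->]; elim: p x => //= z p IH x /andP[xz zp] Px.
apply: IH zp _; case/orP: xz => /andP[/eqP <- _]; [exact: Pf | exact: Pg].
Qed.

(** * The graph of a product with a Brauer diagram *)

Section ProductGraph.

Variable n : nat.
Notation gvtx := ('I_n + 'I_n + 'I_n)%type.

Section Edges.

Variables (g : vtx n -> gvtx) (g_inj : injective g) (d : diagram n).

Lemma edgesP x y :
  reflect (exists u, [/\ x = g u, y = g (mate d u) & x != y])
    ([set x; y] \in edges g d).
Proof.
apply: (iffP imsetP) => [[B + xyE]|[u [xu yu xy]]]; last first.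
  exists [set u; mate d u]; last by rewrite imsetU1 imset_set1 xu yu.
  rewrite inE parts_mate cards2; case: (eqVneq u (mate d u)) => // um.
  by rewrite xu yu -um eqxx in xy.
rewrite inE => /andP[/partsP[u BE]] B2; have xy : x != y.
  by move: B2; rewrite -(card_imset _ g_inj) -xyE cards2; case: (x != y).
rewrite BE imsetU1 imset_set1 in xyE.
have: x \in [set g u; g (mate d u)] by rewrite -xyE set21.
have: y \in [set g u; g (mate d u)] by rewrite -xyE set22.
rewrite !inE => /orP[] /eqP yE /orP[] /eqP xE; rewrite ?xE ?yE ?eqxx // in xy *.
  by exists (mate d u); rewrite mateK.
by exists u.
Qed.

Lemma degree_edges u : #|[set E in edges g d | g u \in E]| = (mate d u != u).
Proof.
have: [set E in edges g d | g u \in E]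
    = if mate d u != u then [set [set g u; g (mate d u)]] else set0.
  apply/setP=> E; rewrite inE; apply/andP/idP => [[/imsetP[B + ->]]|].
    rewrite inE => /andP[/partsP[w ->]] B2 /imsetP[v vw /g_inj uv].
    have -> : [set w; mate d w] = [set u; mate d u].
      by move: vw; rewrite -uv !inE => /orP[] /eqP-> //; rewrite mateK setUC.
    have uw : mate d u != u.
      move: vw B2; rewrite -uv !inE cards2 => /orP[] /eqP->; rewrite ?mateK.
        by rewrite [w == _]eq_sym; case: (_ != _).
      by case: (_ != _).
    by rewrite uw imsetU1 imset_set1 set11.
  case: ifP => [um|_]; last by rewrite inE.
  rewrite inE => /eqP->; rewrite set21; split=> //; apply/edgesP.
  by exists u; split=> //; rewrite (inj_eq g_inj) eq_sym.
by move=> ->; case: (_ != _); rewrite ?cards1 ?cards0.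
Qed.

End Edges.

Variables b d : diagram n.

(** The edges of $b|d$ that come from [b], as an involution which is the identity away from [b];
    [gsnd_mate] does the same for [d]. *)
Definition gfst_mate (x : gvtx) : gvtx :=
  match x with inl v => inl (mate b v) | inr j => inr j end.

Definition gsnd_mate (x : gvtx) : gvtx :=
  match x with
  | inl (inl i) => inl (inl i)
  | inl (inr i) => gsnd (mate d (inl i))
  | inr j => gsnd (mate d (inr j))
  end.

Lemma gfst_mateK : involutive gfst_mate.
Proof. by case=> //= v; rewrite mateK. Qed.

Lemma gsnd_mate_gsnd v : gsnd_mate (gsnd v) = gsnd (mate d v).
Proof. by case: v. Qed.

Lemma gsnd_mateK : involutive gsnd_mate.
Proof.
by case=> [[i|i]|i] //=; rewrite gsnd_mate_gsnd mateK.
Qed.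

Lemma adjacentE : adjacent b d =2 relU (adjf gfst_mate) (adjf gsnd_mate).
Proof.
move=> x y; congr (_ || _).
  apply/(edgesP (@gfst_inj n))/andP => [[u [-> -> uv]]|[/eqP <-]] //.
  by case: x => [v|j]; rewrite ?eqxx // => vv; exists v.
apply/(edgesP (@gsnd_inj n))/andP => [[u [-> -> uv]]|[/eqP <-]].
  by rewrite gsnd_mate_gsnd.
case: x => [[i|i]|j] /= ne; first by rewrite eqxx in ne.
  by exists (inl i).
by exists (inr j).
Qed.

Definition gconn := orb2 gfst_mate gsnd_mate.

Lemma connect_adjacent : connect (adjacent b d) =2 gconn.
Proof. exact/eq_connect/adjacentE. Qed.

Lemma gconn_sym : symmetric gconn.
Proof. by apply: orb2_sym; [apply: gfst_mateK | apply: gsnd_mateK]. Qed.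

Lemma mate_compP u w : u != w ->
  (mate (comp_diagram b d) u == w) = gconn (gout u) (gout w).
Proof.
move=> uw; pose K := [set y in [set: gvtx] | connect (adjacent b d) (gout u) y].
have KE y : (y \in K) = gconn (gout u) y by rewrite !inE connect_adjacent.
have BE : @gout n @^-1: K \in parts (comp_diagram b d).
  rewrite /= !inE; apply/andP; split.
    by apply/set0Pn; exists u; rewrite inE KE; apply: orb2_refl.
  by apply: imset_f; apply: imset_f.
have uK : u \in @gout n @^-1: K by rewrite inE KE; apply: orb2_refl.
have := def_pblock (diagram_trivIset _) BE uK.
rewrite pblock_mate => /setP/(_ w);
  rewrite !inE eq_sym (negPf uw) /= eq_sym => ->.
by rewrite connect_adjacent.
Qed.

Lemma gconn_mate_comp u : gconn (gout u) (gout (mate (comp_diagram b d) u)).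
Proof.
case: (eqVneq u (mate (comp_diagram b d) u)) => [<-|ne]; first exact: orb2_refl.
by rewrite -mate_compP.
Qed.

(* The part of $b|d$ on the unprimed vertices of $b$ and the equator, without *)
(* the propagating lines of [d]; its vertices are those of [b].               *)
Definition upper_mate (v : vtx n) : vtx n :=
  match v with
  | inl i => inl i
  | inr x => if mate d (inl x) is inl j then inr j else inr x
  end.

Lemma upper_mateK : involutive upper_mate.
Proof.
case=> [i|x] //=; case E: (mate d (inl x)) => [j|j] /=; last by rewrite E.
by rewrite -E mateK.
Qed.

(** The fixed points of [upper_mate] are the unprimed vertices of [b] and the equator vertices at
    which [d] has a defect. For a Brauer diagram [b] they are the ends of the paths of this
    graph. *)
Definition core := orb2 (mate b) upper_mate.

(** A lower vertex of [d] is reached from above only through its own propagating line, which leads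
    nowhere but back. So components through vertices of [b] are those of [core], prolonged by
    propagating lines of [d]. *)
Lemma gconn_core v (y : gvtx) : reflect
  match y with
  | inl w => core v w
  | inr j => exists2 x, mate d (inr j) = inl x & core v (inr x)
  end (gconn (inl v) y).
Proof.
apply: (iffP idP) => [|H].
  pose P (y : gvtx) := match y with
    | inl w => core v w : Prop
    | inr j => exists2 x, mate d (inr j) = inl x & core v (inr x)
    end.
  move=> /(@orb2_ind _ _ _ P); apply=> [[w|j]|[[i|x]|j]|] //=.
  - by move=> vw; apply: orb2_trans vw (orb2_f _ _ w).
  - move=> vx; case E: (mate d (inl x)) => [j|j] /=.
      by have := orb2_g (mate b) upper_mate (inr x); rewrite /= E;
        apply: orb2_trans.
    by exists x; rewrite -?E ?mateK.
  - by case=> x -> vx.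
  - exact: orb2_refl.
have sub w : core v w -> gconn (inl v) (inl w).
  move=> /(@orb2_ind _ _ _ (fun w => gconn (inl v) (inl w))); apply.
  - by move=> {}w vw; apply: orb2_trans vw (orb2_f _ _ (inl w)).
  - move=> [i|x] //=; case E: (mate d (inl x)) => [j|j] //= vx.
    apply: orb2_trans vx _; have := orb2_g gfst_mate gsnd_mate (inl (inr x)).
    by rewrite /= E.
  - exact: orb2_refl.
case: y H => [w /sub //|j [x jx /sub vx]]; apply: orb2_trans vx _.
have := orb2_g gfst_mate gsnd_mate (inl (inr x)); rewrite /= -jx mateK.
exact.
Qed.

Lemma gconn_low j j' y : mate d (inr j) = inr j' ->
  gconn (inr j) y -> y = inr j \/ y = inr j'.
Proof.
move=> E /(@orb2_ind _ _ _ (fun y => y = inr j \/ y = inr j')); apply;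
  last by left.
  by move=> z [] ->; [left | right].
have E' : mate d (inr j') = inr j by rewrite -E mateK.
by move=> z [] -> /=; rewrite ?E ?E'; [right | left].
Qed.

Hypothesis b_brauer : is_brauer b.

Let b_free : forall v, mate b v != v. Proof. exact/is_brauerP. Qed.

Definition core_other := other (mate b) upper_mate.

Let coP v : upper_mate v = v ->
  [/\ core_other v != v, upper_mate (core_other v) = core_other v
    & core v (core_other v)].
Proof.
by apply: otherP; [apply: mateK | apply: upper_mateK | apply: b_free].
Qed.

Let co_uniq v w : upper_mate v = v -> upper_mate w = w -> core v w -> w != v ->
  w = core_other v.
Proof.
by apply: other_uniq; [apply: mateK | apply: upper_mateK | apply: b_free].
Qed.

Lemma prop_defect x j : mate d (inl x) = inr j -> upper_mate (inr x) = inr x.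
Proof. by move=> /= ->. Qed.

Lemma single_defect x : mate d (inl x) = inl x -> upper_mate (inr x) = inr x.
Proof. by move=> /= ->. Qed.

Lemma defectP x : upper_mate (inr x) = inr x ->
  mate d (inl x) = inl x \/ exists j, mate d (inl x) = inr j.
Proof.
by rewrite /=; case E: (mate d (inl x)) => [y|j]; [case=> ->; left | right;
  exists j].
Qed.

(** Follow the path of [core] from the top vertex to its other end: a top vertex closes an arc, a
    propagating line of [d] is followed downwards, and a singleton of [d] is a dead end that leaves
    the top vertex alone. *)
Lemma mate_comp_top i : mate (comp_diagram b d) (inl i) =
  match core_other (inl i) with
  | inl j => inl j
  | inr x => if mate d (inl x) is inr j then inr j else inl i
  end.
Proof.
have [] := @coP (inl i) erefl; case: (core_other _) (@co_uniq (inl i)) =>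
  [j|x] uniq ij ue co.
  by apply/eqP; rewrite mate_compP /=; [apply/gconn_core | rewrite eq_sym].
have [xs|[j xj]] := defectP ue; last first.
  rewrite xj; apply/eqP; rewrite mate_compP //=; apply/gconn_core.
  by exists x; rewrite // -xj mateK.
(* A partner of [i] in the product would give a second end of the path besides the singleton at
   [x]. *)
rewrite xs; apply/eqP/contraT => ne;
  have /gconn_core := gconn_mate_comp (inl i).
case: (mate _ _) ne => [i'|j] /= ne.
  by move=> c; have := uniq (inl i') erefl erefl c ne.
case=> y jy c; have yj : mate d (inl y) = inr j by rewrite -jy mateK.
have := uniq (inr y) erefl (prop_defect yj) c isT.
by case=> yx; rewrite yx xs in yj.
Qed.

Lemma low_comp j j' : low d j = Some j' -> low (comp_diagram b d) j = Some j'.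
Proof.
move=> /low_mate jj; apply/low_mate; case: (eqVneq j j') => [E|ne].
  apply/eqP/contraT => ne; rewrite -E in ne jj.
  have /(gconn_low jj) := gconn_mate_comp (inr j).
  by case: (mate _ _) ne => [i|i] ne [] //= [ij]; rewrite ij eqxx in ne.
apply/eqP; rewrite mate_compP //=.
by have := orb2_g gfst_mate gsnd_mate (inr j); rewrite /= jj.
Qed.

Lemma mate_comp_prop j x i : mate d (inr j) = inl x -> core (inr x) (inl i) ->
  mate (comp_diagram b d) (inr j) = inl i.
Proof.
move=> jx c; apply/eqP; rewrite mate_compP //=.
rewrite gconn_sym; apply/gconn_core; exists x => //.
by rewrite /core orb2_sym //; [apply: mateK | apply: upper_mateK].
Qed.

(** No path joins two distinct defects of [d]; equivalently, by parity, every defect is carried to a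
    top vertex. *)
Definition good := [forall x, forall y,
  [&& upper_mate (inr x) == inr x, upper_mate (inr y) == inr y
    & core (inr x) (inr y)] ==> (x == y)].

Lemma goodP : reflect (forall x y, upper_mate (inr x) = inr x ->
  upper_mate (inr y) = inr y -> core (inr x) (inr y) -> x = y) good.
Proof.
apply: (iffP forallP) => [H x y /eqP ux /eqP uy c|H x].
  by have /forallP/(_ y)/implyP := H x; rewrite ux uy c => /(_ isT)/eqP.
by apply/forallP=> y; apply/implyP=> /and3P[/eqP ux /eqP uy c]; apply/eqP/H.
Qed.

Lemma good_top : good -> forall x, upper_mate (inr x) = inr x ->
  exists i, core_other (inr x) = inl i.
Proof.
move=> /goodP g x ux; have [] := coP ux; case: (core_other _) => [i|y] ne uy c.
  by exists i.
by rewrite (g x y ux uy c) eqxx in ne.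
Qed.

Lemma good_low : good -> low (comp_diagram b d) =1 low d.
Proof.
move=> g j; case E: (low d j) => [j'|]; first exact: low_comp.
case F: (mate d (inr j)) => [x|j']; last by move: E; rewrite /low F.
have xj : mate d (inl x) = inr j by rewrite -F mateK.
have ux := prop_defect xj; have [i ix] := good_top g ux.
have [_ _] := coP ux; rewrite ix => c.
by rewrite /low (mate_comp_prop F c).
Qed.

Lemma degree_equator x :
  degree b d (inl (inr x)) = (1 + (mate d (inl x) != inl x))%N.
Proof.
rewrite /degree -[inl (inr x)]/(gfst (inr x)) degree_edges ?b_free; last first.
  exact: gfst_inj.
by rewrite -[gfst (inr x)]/(gsnd (inl x)) degree_edges //; apply: gsnd_inj.
Qed.

(** In the good case the components without top vertices are the closed loops ([good_loops]). This
    description uses [d] only through [upper_mate]. *)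
Definition core_comp x : {set gvtx} := [set inl w | w : vtx n & core (inr x) w].
Definition core_loops : {set {set gvtx}} :=
  [set core_comp x | x : 'I_n & [forall i, ~~ core (inr x) (inl i)]].

Lemma equator_componentP K : reflect
  (exists2 x, K = [set y | gconn (inl (inr x)) y] & K \subset equator n)
  (K \in equator_components b d).
Proof.
rewrite inE; apply: (iffP andP) => [[/imsetP[y _ KE] Ke]|[x -> Ke]]; last first.
  split=> //; apply/imsetP; exists (inl (inr x)) => //; apply/setP=> z.
  by rewrite !inE connect_adjacent.
have : y \in K by rewrite KE !inE connect0.
move=> /(subsetP Ke)/imsetP[x _ yE]; exists x => //; rewrite KE yE.
by apply/setP=> z; rewrite !inE connect_adjacent.
Qed.

(** As [b] has no singletons, an open string in the equator contains a singleton of [d]; in the good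
    case its path leaves the equator for a top vertex. *)
Lemma good_open : good -> open_strings b d = set0.
Proof.
move=> g; apply/eqP; rewrite setD_eq0; apply/subsetP=> K Kc.
rewrite inE Kc; have /equator_componentP[x KE Ke] := Kc.
apply/forall_inP=> y yK; have /imsetP[z _ yz] := subsetP Ke _ yK.
rewrite yz degree_equator; case: (eqVneq (mate d (inl z)) (inl z)) => // zs.
have uz := single_defect zs; have [i iz] := good_top g uz.
have [_ _] := coP uz; rewrite iz => c.
suff /(subsetP Ke)/imsetP[] : inl (inl i) \in K by [].
rewrite KE inE; apply: (@orb2_trans _ _ _ (inl (inr z))).
  by move: yK; rewrite KE inE yz.
exact/gconn_core.
Qed.

Lemma good_loops : good -> closed_loops b d = core_loops.
Proof.
move=> g; have -> : closed_loops b d = equator_components b d.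
  have := good_open g; rewrite /open_strings => /eqP; rewrite setD_eq0 => s.
  by apply/eqP; rewrite eqEsubset s andbT; apply/subsetP=> K;
    rewrite inE => /andP[].
(* A component that meets a propagating line of [d] also reaches the top, because the defect is
   carried there. *)
have noprop x j : (forall i, ~~ core (inr x) (inl i))
  -> ~~ gconn (inl (inr x)) (inr j).
  move=> H; apply/negP=> /gconn_core[z jz c].
  have zj : mate d (inl z) = inr j by rewrite -jz mateK.
  have [i iz] := good_top g (prop_defect zj).
  have [_ _] := coP (prop_defect zj); rewrite iz => c'.
  by have /negP[] := H i; apply: orb2_trans c c'.
have compE x : (forall i, ~~ core (inr x) (inl i)) ->
    core_comp x = [set y | gconn (inl (inr x)) y].
  move=> H; apply/setP=> y; rewrite inE; apply/imsetP/idP => [[w]|].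
    by rewrite inE => c ->; apply/gconn_core.
  case: y => [w|j]; last by rewrite (negPf (noprop x j H)).
  by move=> /gconn_core c; exists w; rewrite ?inE.
apply/setP=> K; apply/equator_componentP/imsetP => [[x KE Ke]|[x]].
  have H i : ~~ core (inr x) (inl i).
    apply/negP=> c; suff /(subsetP Ke)/imsetP[] : inl (inl i) \in K by [].
    by rewrite KE inE; apply/gconn_core.
  by exists x; [rewrite inE; apply/forallP | rewrite compE].
rewrite inE => /forallP H ->; exists x; first exact: compE.
apply/subsetP=> _ /imsetP[[i|y] + ->]; last by move=> _; apply: imset_f.
by rewrite inE (negPf (H i)).
Qed.

(** Suppose one of the two joined defects is a propagating line of [d]. Its lower end still
    propagates in the product, since the lower half is unchanged, so its path also reaches a top
    vertex and has three ends. Hence both defects are singletons, and the path between them is an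
    open string. *)
Lemma bad_comp : ~~ good -> low (comp_diagram b d) =1 low d ->
  open_strings b d != set0.
Proof.
move=> /forallPn[x /forallPn[y]];
  rewrite negb_imply => /andP[/and3P[/eqP ux /eqP uy c] ne] lowE.
have core_sym : symmetric core.
  by apply: orb2_sym; [apply: mateK | apply: upper_mateK].
have noprop u v j : upper_mate (inr u) = inr u -> upper_mate (inr v) = inr v ->
    core (inr u) (inr v) -> u != v -> mate d (inl u) <> inr j.
  move=> uu uv uvc nuv uj; have ju : mate d (inr j)
    = inl u by rewrite -uj mateK.
  have := lowE j; rewrite {2}/low ju /low; case E: (mate _ _) => [i|//] _.
  have := gconn_mate_comp (inr j); rewrite E /= gconn_sym => /gconn_core[z].
  rewrite ju => -[<-]; rewrite core_sym => ui.
  have E1 := co_uniq uu uv uvc; have E2 := co_uniq uu (erefl :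
    upper_mate (inl i) = inl i) ui isT.
  by move: E1; rewrite -E2 (inj_eq inr_inj) eq_sym => /(_ nuv).
have [xs|[j xj]] := defectP ux; last by case: (noprop x y j ux uy c ne xj).
have [ys|[j yj]] := defectP uy; last first.
  by rewrite core_sym in c; rewrite eq_sym in ne;
    case: (noprop y x j uy ux c ne yj).
have ends w : upper_mate w = w -> core (inr x) w -> w = inr x \/ w = inr y.
  move=> uw cw; case: (eqVneq w (inr x)) => [->|wx]; first by left.
  right; rewrite (co_uniq ux uw cw wx); apply/esym/co_uniq => //.
  by rewrite (inj_eq inr_inj) eq_sym.
pose K := [set z | gconn (inl (inr x)) z].
apply/set0Pn; exists K; have Ke : K \subset equator n.
  apply/subsetP=> -[[i|z]|j]; rewrite inE => /gconn_core.
  - by case/(ends _ erefl).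
  - by move=> _; apply: imset_f.
  - case=> z jz cz; have zj : mate d (inl z) = inr j by rewrite -jz mateK.
    by have [[zE]|[zE]] := ends _ (prop_defect zj) cz; rewrite zE ?xs ?ys in zj.
have Kc : K \in equator_components b d by apply/equator_componentP; exists x.
rewrite inE Kc andbT inE Kc /=; apply/negP=> /forall_inP/(_ (inl (inr x))).
by rewrite degree_equator xs eqxx inE /gconn orb2_refl => /(_ isT).
Qed.

End ProductGraph.

(** * Left cells as half diagrams *)

Section Frames.

Variables n k : nat.

Definition label_vtx (t : 'I_k -> 'I_n) (x : 'I_n + 'I_k) : vtx n :=
  match x with inl j => inl j | inr m => inr (t m) end.

Definition relab (t : 'I_k -> 'I_n) (s : 'S_k) (v : vtx n) : vtx n :=
  match v with inl i => inl i | inr j => inr (extend_fun t s^-1 j) end.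

Definition act_label (s : 'S_k) (x : 'I_n + 'I_k) : 'I_n + 'I_k :=
  match x with inl j => inl j | inr m => inr (s^-1%g m) end.

(* [t] enumerates the right ends of the propagating lines of the diagrams of  *)
(* the left cell [L] of [d0].                                                 *)
Record is_frame (L : {set diagram n}) (d0 : diagram n) (t : 'I_k -> 'I_n) :
  Prop :=
  IsFrame {
    frame_cell : forall d, (d \in L) <-> low d =1 low d0;
    frame_inj : injective t;
    frame_end : forall j, (exists m, t m = j) <-> low d0 j = None;
    frame_act : forall d s v, d \in L ->
      mate (right_act s d) (relab t s v) = relab t s (mate d v)
  }.

Lemma frame_exists (L : {set diagram n}) : is_left_cell L ->
  (forall d, d \in L -> prop_number d = k) -> exists d0 t, is_frame L d0 t.
Proof.
move=> /left_cellP[d0 d0L LE] Lk.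
have e0 : #|right_ends d0| = k by rewrite card_right_ends Lk.
have cell d : (d \in L) <-> low d =1 low d0.
  rewrite LE; split=> [/left_equivP E j|E]; first by rewrite E.
  by apply/left_equivP=> j; rewrite E.
exists d0, (right_end e0); split=> //; first exact: right_end_inj.
  move=> j; split=> [[m <-]|j0].
    by apply/eqP; rewrite -right_endE; apply: enum_valP.
  have jr : j \in right_ends d0 by rewrite right_endE j0.
  exists (cast_ord e0 (enum_rank_in jr j)).
  by rewrite /right_end cast_ordK enum_rankK_in.
move=> d s v dL; rewrite /right_act; case: eqP => [e|]; last first.
  by rewrite card_right_ends Lk.
(* The right ends are an invariant of the left cell, so [right_act] uses the enumeration of [d0] for
   every [d] in [L]. *)
have RE : right_ends d = right_ends d0.
  by apply/setP=> j; rewrite !right_endE (cell d).1.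
have tE i : right_end e i = right_end e0 i.
  by rewrite /right_end; move: e; rewrite RE => e;
    rewrite (eq_irrelevance e e0).
have vE w : relab (right_end e0) s w
  = relabel_vtx (extend_perm (@right_end_inj n d k e) s^-1) w.
  case: w => //= j; congr inr; rewrite permE /extend_fun.
  by rewrite (eq_pick (fun i => congr1 (fun x => x == j) (tE i))); case: pickP.
by rewrite !vE mate_relabel.
Qed.

(* The upper half of [d]: [i] goes to [inl j] if its part is $\{i, j\}$ (with   *)
(* $j = i$ for a singleton), and to [inr m] if it is joined to $t_m'$.        *)
Definition half (t : 'I_k -> 'I_n) (d : diagram n) (i : 'I_n) : 'I_n + 'I_k :=
  match mate d (inl i) with
  | inl j => inl j
  | inr j => if [pick m | t m == j] is Some m then inr m else inl i
  end.

(** These conditions characterize the upper halves of the diagrams of a left cell ([half_valid],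
    [half_surj]): arcs are symmetric and each label occurs exactly once. *)
Record valid_half (h : 'I_n -> 'I_n + 'I_k) : Prop := ValidHalf {
  valid_pair : forall i j, h i = inl j -> h j = inl i;
  valid_label : forall m, exists i, h i = inr m;
  valid_inj : forall i i' m, h i = inr m -> h i' = inr m -> i = i'
}.

Section Frame.

Variables (L : {set diagram n}) (d0 : diagram n) (t : 'I_k -> 'I_n).
Hypothesis fr : is_frame L d0 t.

Let t_inj : injective t. Proof. by case: fr. Qed.

Lemma label_vtx_inj : injective (label_vtx t).
Proof. by move=> [i|i] [j|j] //= [] => [->|/t_inj ->]. Qed.

Lemma frame_low d j : d \in L -> low d j = low d0 j.
Proof. by move/(frame_cell fr). Qed.

Lemma halfE d i : d \in L -> label_vtx t (half t d i) = mate d (inl i).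
Proof.
move=> dL; rewrite /half; case E: (mate d (inl i)) => [j|j] //.
have [m tm] : exists m, t m = j.
  apply/(frame_end fr); rewrite -(frame_low _ dL) /low.
  by rewrite -E mateK.
case: pickP => [m' /eqP <- //|/(_ m)]; by rewrite tm eqxx.
Qed.

Lemma half_inj d d' : d \in L -> d' \in L -> half t d =1 half t d' -> d = d'.
Proof.
move=> dL d'L hh; have top i : mate d (inl i) = mate d' (inl i).
  by rewrite -!halfE // hh.
apply: diagram_eq => -[i|j] //; case E: (low d j) => [j'|].
  have E' := E; rewrite frame_low // -(frame_low _ d'L) in E'.
  by move/low_mate: E => ->; move/low_mate: E' => ->.
move: E; rewrite /low; case E: (mate d (inr j)) => [i|//] _.
by apply: (can_inj (mateK d')); rewrite mateK -top -E mateK.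
Qed.

Lemma half_valid d : d \in L -> valid_half (half t d).
Proof.
move=> dL; split=> [i j hi|m|i i' m hi hi'].
- have E : mate d (inl i) = inl j by rewrite -halfE // hi.
  by apply: label_vtx_inj; rewrite halfE //= -E mateK.
- have E : low d (t m) = None.
    by rewrite frame_low //; apply/(frame_end fr); exists m.
  move: E; rewrite /low; case E: (mate d _) => [i|//] _; exists i.
  by apply: label_vtx_inj; rewrite halfE //= -E mateK.
- have : mate d (inl i) = mate d (inl i') by rewrite -!halfE // hi hi'.
  by move/(can_inj (mateK d)) => [].
Qed.

(** Glue [h] to the lower half of [d0]: the vertex with label [m] is joined to [t m], and the
    remaining lower vertices keep their mates. *)
Lemma half_surj h : valid_half h -> exists2 d, d \in L & half t d =1 h.
Proof.
case=> hp hl hi.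
pose f v := match v with
  | inl i => label_vtx t (h i)
  | inr j => if [pick i | label_vtx t (h i) == inr j] is Some i then inl i
             else mate d0 (inr j)
  end.
have labE i m : label_vtx t (h i) = inr (t m) -> h i = inr m.
  by move=> E; apply: label_vtx_inj; rewrite E.
have fr_m i m : h i = inr m -> f (inr (t m)) = inl i.
  move=> him; rewrite /f; case: pickP => [i' /eqP/labE hi'|/(_ i)].
    by rewrite (hi _ _ _ hi' him).
  by rewrite him eqxx.
have f_low j j' : low d0 j = Some j' -> f (inr j) = inr j'.
  move=> E; rewrite /f; case: pickP => [i|_]; last by apply/low_mate.
  case him: (h i) => [//|m] /eqP[tm].
  by have /(frame_end fr) := ex_intro (fun m => t m = j) m tm; rewrite E.
have f_none j : low d0 j = None -> exists i m, [/\ h i = inr m,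
  t m = j & f (inr j) = inl i].
  move=> /(frame_end fr)[m <-]; have [i him] := hl m.
  by exists i, m; rewrite (fr_m i m).
have fK : involutive f.
  case=> [i|j].
    rewrite {2}/f; case E: (h i) => [j|m] /=; last exact: fr_m.
    by rewrite (hp _ _ E).
  case E: (low d0 j) => [j'|]; last first.
    by have [i [m [him <- ->]]] := f_none _ E; rewrite /= him.
  rewrite (f_low _ _ E) (f_low j' j) //; apply/low_mate.
  by move/low_mate: E => <-; rewrite mateK.
have mE := mate_mk fK.
have mL : mk_diagram fK \in L.
  apply/(frame_cell fr) => j; case E: (low d0 j) => [j'|].
    by apply/low_mate; rewrite mE; apply: f_low.
  by have [i [m [_ _ fj]]] := f_none _ E; rewrite /low mE fj.
exists (mk_diagram fK) => // i.
by apply: label_vtx_inj; rewrite halfE // mE.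
Qed.

Lemma relab_label s x : relab t s (label_vtx t x) = label_vtx t (act_label s x).
Proof.
case: x => //= m; rewrite /extend_fun;
  case: pickP => [m' /eqP/t_inj -> //|/(_ m)].
by rewrite eqxx.
Qed.

Lemma relab_low s j : low d0 j <> None -> relab t s (inr j) = inr j.
Proof.
move=> jl; rewrite /= /extend_fun; case: pickP => // m /eqP tm; case: jl.
by apply/(frame_end fr); exists m.
Qed.

Lemma right_act_cell (s : 'S_k) d : d \in L -> right_act s d \in L.
Proof.
move=> dL; apply/(frame_cell fr) => j; case E: (low d0 j) => [j'|].
  have E' : low d0 j' = Some j by apply/low_mate; move/low_mate: E => <-;
    rewrite mateK.
  have := frame_act fr s (inr j) dL; rewrite relab_low ?E //.
  have /low_mate -> : low d j = Some j' by rewrite frame_low.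
  by rewrite relab_low ?E' // => ?; apply/low_mate.
have /(frame_end fr)[m mj] := E; pose m' := s m.
have : low d (t m') = None by rewrite frame_low //; apply/(frame_end fr);
  exists m'.
rewrite /low; case F: (mate d _) => [i|//] _.
have := frame_act fr s (inr (t m')) dL; rewrite F /=.
have -> : extend_fun t s^-1 (t m') = j.
  by have := relab_label s (inr m'); rewrite /= permK mj => -[].
by move=> ->.
Qed.

Lemma half_act s d i : d \in L -> half t (right_act s d) i
  = act_label s (half t d i).
Proof.
move=> dL; apply: label_vtx_inj; rewrite halfE ?right_act_cell //.
by rewrite -relab_label halfE //; apply: (frame_act fr s (inl i) dL).
Qed.

Lemma right_act_pcomp (s s' : 'S_k) d : d \in L ->
  right_act (pcomp s s') d = right_act s' (right_act s d).
Proof.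
move=> dL; apply: half_inj; rewrite ?right_act_cell ?right_act_cell // => i.
rewrite !half_act ?right_act_cell //; case: (half t d i) => //= m.
by rewrite /pcomp invMg permM.
Qed.

Lemma right_act1 d : d \in L -> right_act (1%g : 'S_k) d = d.
Proof.
move=> dL; apply: half_inj; rewrite ?right_act_cell // => i.
by rewrite half_act //; case: (half t d i) => //= m; rewrite invg1 perm1.
Qed.

Lemma half_upper_mate d x : d \in L ->
  upper_mate d (inr x) = if half t d x is inl j then inr j else inr x.
Proof. by move=> dL; rewrite /= -halfE //; case: (half t d x). Qed.

(** [upper_mate] records where the defects are but not their labels; so [good], [core_loops] and
    [core_other] are invariant under the right action. *)
Lemma upper_mate_act (s : 'S_k) d : d \in L -> upper_mate (right_act s d)
  = upper_mate d.
Proof.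
move=> dL; apply/funext=> -[i|x] //;
  rewrite !half_upper_mate ?right_act_cell //.
by rewrite half_act //; case: (half t d x).
Qed.

Section Action.

Variables (b d : diagram n).
Hypotheses (b_brauer : is_brauer b) (dL : d \in L).

Lemma good_cell : good b d -> comp_diagram b d \in L.
Proof.
by move=> g; apply/(frame_cell fr) => j; rewrite good_low // frame_low.
Qed.

Lemma good_coef (C : pzRingType) (delta : C) : good b d ->
  comp_coef b d delta 0 = delta ^+ #|core_loops b d|.
Proof. by move=> g; rewrite /comp_coef good_open // good_loops // cards0 expr0
  mulr1. Qed.

Lemma bad_cell (C : pzRingType) (delta : C) : ~~ good b d ->
  comp_diagram b d \notin L \/ comp_coef b d delta 0 = 0.
Proof.
move=> ng; have [cL|cL] := boolP (comp_diagram b d \in L); [right | by left].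
have : open_strings b d != set0.
  by apply: bad_comp => // j; rewrite !frame_low.
by rewrite -card_gt0 /comp_coef; case: #|_| => // m _; rewrite expr0n mulr0.
Qed.

Lemma half_comp i : good b d -> half t (comp_diagram b d) i =
  match core_other b d (inl i) with
  | inl j => inl j
  | inr x => if half t d x is inr m then inr m else inl i
  end.
Proof.
move=> g; apply: label_vtx_inj; rewrite halfE ?good_cell // mate_comp_top //.
case: (core_other _ _ _) => [j|x] //; rewrite -halfE //.
by case: (half t d x).
Qed.

End Action.

Lemma right_act_comp b (s : 'S_k) d : is_brauer b -> d \in L -> good b d ->
  comp_diagram b (right_act s d) = right_act s (comp_diagram b d).
Proof.
move=> bb dL g; have uE := upper_mate_act s dL.
have g' : good b (right_act s d) by move: g; rewrite /good /core uE.
have rL := right_act_cell s dL; have cL := good_cell bb dL g.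
apply: half_inj => [||i]; rewrite ?good_cell ?right_act_cell //.
rewrite half_act // !half_comp // /core_other uE.
case: (other _ _ _) => [j|x] //; rewrite half_act //.
by case: (half t d x).
Qed.

Lemma upper_single_half d i : d \in L ->
  (i \in upper_singletons d) = (half t d i == inl i).
Proof.
by move=> dL; rewrite upper_singletonE -halfE // -(inj_eq label_vtx_inj).
Qed.

(** Each singleton of [d] travels along its path to a top vertex, which becomes a singleton of the
    product; distinct singletons have distinct paths. This makes the singleton filtration stable
    under Brauer diagrams. *)
Lemma comp_singletons b d : is_brauer b -> d \in L -> good b d ->
  (#|upper_singletons d| <= #|upper_singletons (comp_diagram b d)|)%N.
Proof.
move=> bb dL g.
pose f x := if core_other b d (inr x) is inl i then i else x.
have fP x : x \in upper_singletons d ->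
    core_other b d (inr x) = inl (f x) /\ core_other b d (inl (f x)) = inr x.
  rewrite upper_singletonE => /eqP/single_defect ux.
  have [i iE] := good_top bb g ux; rewrite /f iE; split=> //.
  rewrite -iE; apply: otherK => //; [exact: mateK | exact: upper_mateK |].
  exact/is_brauerP.
rewrite -(card_in_imset (f := f)); last first.
  move=> x y /fP[_ xE] /fP[_ yE] xy; move: xE; rewrite xy yE.
  by case.
apply/subset_leq_card/subsetP=> _ /imsetP[x xs ->].
rewrite upper_single_half ?good_cell // half_comp //.
have [_ ->] := fP x xs; move: xs; rewrite upper_single_half // => /eqP ->.
by [].
Qed.

End Frame.

End Frames.

Lemma inr_rshift (A : Type) k l (c c' : 'I_l) :
  inr (rshift k c) = inr (rshift k c') :> A + 'I_(k + l) -> c = c'.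
Proof. by move=> E; apply: (@rshift_inj k l); case: E => E; apply: val_inj. Qed.

Lemma inr_lshift (A : Type) k l (a a' : 'I_k) :
  inr (lshift l a) = inr (lshift l a') :> A + 'I_(k + l) -> a = a'.
Proof. by case=> E; apply: val_inj. Qed.

Lemma inr_lrshift (A : Type) k l (a : 'I_k) (c : 'I_l) :
  inr (lshift l a) <> inr (rshift k c) :> A + 'I_(k + l).
Proof.
by case=> E; have := ltn_ord a; rewrite E ltnNge leq_addr.
Qed.

Lemma extend_permE n k (t : 'I_k -> 'I_n) (t_inj : injective t) s i :
  extend_perm t_inj s (t i) = t (s i).
Proof.
rewrite permE /extend_fun; case: pickP => [j /eqP/t_inj -> //|/(_ i)].
by rewrite eqxx.
Qed.

Lemma extend_perm_id n k (t : 'I_k -> 'I_n) (t_inj : injective t) s x :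
  (forall i, t i != x) -> extend_perm t_inj s x = x.
Proof. by move=> tx; rewrite permE /extend_fun; case: pickP => // i;
  rewrite (negPf (tx i)). Qed.

Lemma young_embl k l (p : 'S_k * 'S_l) a : young_emb p (lshift l a)
  = lshift l (p.1 a).
Proof.
rewrite /young_emb /pcomp permM [X in extend_perm _ _ X]extend_perm_id.
  exact: extend_permE.
by move=> c; rewrite eq_sym eq_lrshift.
Qed.

Lemma young_embr k l (p : 'S_k * 'S_l) c : young_emb p (rshift k c)
  = rshift k (p.2 c).
Proof.
rewrite /young_emb /pcomp permM extend_permE extend_perm_id // => a.
by rewrite eq_lrshift.
Qed.

Lemma perm_shift_eq k l (s t : 'S_(k + l)) :
  (forall a, s (lshift l a) = t (lshift l a)) ->
  (forall c, s (rshift k c) = t (rshift k c)) -> s = t.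
Proof. by move=> H1 H2; apply/permP=> m; case: (split_ordP m) => i ->. Qed.

Lemma young_embV k l (p : 'S_k * 'S_l) : ((young_emb p)^-1 = young_emb (p.1^-1,
  p.2^-1))%g.
Proof.
apply/eqP; rewrite eq_invg_mul; apply/eqP/perm_shift_eq => i.
  by rewrite permM !young_embl permK perm1.
by rewrite permM !young_embr permK perm1.
Qed.

(** * Cutting the last [l] propagating lines into singletons *)

Section Forget.

Variables n k l : nat.

(** [x] is the image of [i] in an upper half. The value [inl i] at [i] itself encodes a
    singleton. *)
Definition forget (i : 'I_n) (x : 'I_n + 'I_(k + l)) : 'I_n + 'I_k :=
  match x with
  | inl j => inl j
  | inr m => match split m with inl a => inr a | inr _ => inl i end
  end.

Variables (L Lb : {set diagram n}) (d0 e0 : diagram n).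
Variables (t : 'I_k -> 'I_n) (q : 'I_(k + l) -> 'I_n).
Hypotheses (frL : is_frame L d0 t) (frLb : is_frame Lb e0 q).

Notation BE := (Lb :&: brauer_set n).
Hypothesis BE0 : BE != set0.

(** For Brauer diagrams of [Lb] the search succeeds, by [forget_labelsP], and the default is not
    reached. *)
Definition forget_labels (e : diagram n) : diagram n :=
  odflt d0 [pick d in L | [forall i, half t d i == forget i (half q e i)]].

Let D := forget_labels.

Let BEb e : e \in BE -> (e \in Lb) /\ is_brauer e.
Proof. by rewrite !inE => /andP[]. Qed.

Lemma forget_l i a : forget i (inr (lshift l a)) = inr a.
Proof. by rewrite /forget (unsplitK (inl a)). Qed.

Lemma forget_r i c : forget i (inr (rshift k c)) = inl i.
Proof. by rewrite /forget (unsplitK (inr c)). Qed.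

Lemma brauer_half e i : e \in BE -> half q e i <> inl i.
Proof.
move=> /BEb[eL /is_brauerP/(_ (inl i)) + E]; rewrite -(halfE frLb) // E.
by rewrite eqxx.
Qed.

Lemma forget_valid e : e \in BE -> valid_half (fun i => forget i (half q e i)).
Proof.
move=> eB; have [eL _] := BEb eB; have [hp hl hi] := half_valid frLb eL.
split=> [i j|m|i i' m].
- case E: (half q e i) => [j'|m].
    by move=> /= [<-]; rewrite (hp _ _ E).
  by case: (split_ordP m) => a mE; rewrite mE ?forget_l ?forget_r // => -[<-];
    rewrite E mE forget_r.
- by have [i im] := hl (lshift l m); exists i; rewrite im forget_l.
- have lab j : forget j (half q e j) = inr m -> half q e j = inr (lshift l m).
    case: (half q e j) => [//|m']; case: (split_ordP m') => a ->.
      by rewrite forget_l => -[->].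
    by rewrite forget_r.
  by move=> /lab E /lab E'; apply: hi E E'.
Qed.

Lemma forget_labelsP e : e \in BE ->
  D e \in L /\ half t (D e) =1 (fun i => forget i (half q e i)).
Proof.
move=> eB; rewrite /D /forget_labels;
  case: pickP => [d /andP[dL /forallP H]|no] /=.
  by split=> // i; apply/eqP.
have [d dL dE] := half_surj frL (forget_valid eB).
have /negP[] := no d; rewrite dL /=.
by apply/forallP=> i; rewrite dE.
Qed.

Lemma forget_labels_cell e : e \in BE -> D e \in L.
Proof. by case/forget_labelsP. Qed.

Lemma half_forget_labels e : e \in BE ->
  half t (D e) =1 (fun i => forget i (half q e i)).
Proof. by case/forget_labelsP. Qed.

Lemma forget_singletons e : e \in BE -> #|upper_singletons (D e)| = l.
Proof.
move=> eB; have [eL _] := BEb eB; have [hp hl hi] := half_valid frLb eL.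
have hb m : exists i, half q e i == inr m by have [i <-] := hl m; exists i.
pose f c := xchoose (hb (rshift k c)).
have fP c : half q e (f c) = inr (rshift k c).
  exact: (eqP (xchooseP (hb (rshift k c)))).
have f_inj : injective f.
  by move=> c c' E; have := fP c; rewrite E fP => cc;
    exact: esym (inr_rshift cc).
rewrite -[RHS]card_ord -(card_codom f_inj); apply: eq_card => i.
rewrite (upper_single_half frL) ?forget_labels_cell // half_forget_labels //.
apply/eqP/codomP => [|[c ->]]; last by rewrite fP forget_r.
case E: (half q e i) => [j|m]; first by case=> ji;
  case: (brauer_half eB (i := i)); rewrite E /= ji.
case: (split_ordP m) E => c -> E; rewrite ?forget_l ?forget_r // => _; exists c.
exact: hi E (fP c).
Qed.

(** Number the [l] singletons of [d] and turn them into propagating lines that carry the last [l]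
    labels. *)
Lemma forget_labels_surj d : d \in L -> #|upper_singletons d| = l ->
  exists2 e, e \in BE & D e = d.
Proof.
move=> dL dl; have [hp hl hi] := half_valid frL dL.
pose g (c : 'I_l) : 'I_n := enum_val (cast_ord (esym dl) c).
have g_inj : injective g by move=> c c' /enum_val_inj/cast_ord_inj.
have gP i : half t d i = inl i <-> exists c, g c = i.
  rewrite (rwP eqP) -(upper_single_half frL) //; split=> [id|[c <-]].
    exists (cast_ord dl (enum_rank_in id i)).
    by rewrite /g cast_ordK enum_rankK_in.
  exact: enum_valP.
pose h i : 'I_n + 'I_(k + l) := match half t d i with
  | inr a => inr (lshift l a)
  | inl j => if [pick c | g c == i] is Some c then inr (rshift k c) else inl j
  end.
have hg c : h (g c) = inr (rshift k c).
  rewrite /h (gP (g c)).2; last by exists c.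
  by case: pickP => [c' /eqP/g_inj -> //|/(_ c)]; rewrite eqxx.
have hr i c : h i = inr (rshift k c) -> i = g c.
  rewrite /h; case: (half t d i) => [j|a]; last first.
    by move=> cc; case: (inr_lrshift cc).
  by case: pickP => // c' /eqP <- cc; rewrite (inr_rshift cc).
have ha i a : h i = inr (lshift l a) <-> half t d i = inr a.
  rewrite /h; case: (half t d i) => [j|a'].
    by case: pickP => // c _; split=> // cc; case: (inr_lrshift (esym cc)).
  by split=> [cc|[->] //]; rewrite (inr_lshift cc).
have hj i j : h i = inl j -> half t d i = inl j /\ j <> i.
  rewrite /h; case E: (half t d i) => [j'|//]; case: pickP => // no [jj].
  rewrite -jj; split=> // ji; rewrite ji in E.
  by have [c ci] := (gP i).1 E; have := no c; rewrite ci eqxx.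
have h_valid : valid_half h.
  split=> [i j|m|i i' m].
  - move=> /hj[hij ji]; have hji := hp _ _ hij; rewrite /h hji.
    by case: pickP => // c /eqP gc; have := (gP j).2 (ex_intro _ c gc);
      rewrite hji => -[ij]; case: ji.
  - case: (split_ordP m) => [a ->|c ->]; last by exists (g c).
    by have [i ia] := hl a; exists i; apply/ha.
  - case: (split_ordP m) => [a ->|c ->]; last by move=> /hr-> /hr->.
    by move=> /ha E /ha E'; apply: hi E E'.
have [e eL eh] := half_surj frLb h_valid.
have eB : e \in BE.
  rewrite inE eL inE; apply/is_brauerP=> -[i|j].
    apply/eqP; rewrite -(halfE frLb) // eh; case E: (h i) => [j|//] /= [ji].
    by have [_] := hj _ _ E; rewrite ji.
  (* The lower half is common to the left cell, and some Brauer diagram lies in it, so it has no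
     singletons. *)
  apply/eqP=> /low_mate; have [e1 /BEb[e1L /is_brauerP e1B]] := set0Pn _ BE0.
  rewrite (frame_low frLb) // -(frame_low frLb _ e1L) => /low_mate e1j.
  by have := e1B (inr j); rewrite e1j eqxx.
exists e => //; apply: (half_inj frL) => // [|i];
  first exact: forget_labels_cell.
rewrite half_forget_labels // eh /h; case E: (half t d i) => [j|a].
  case: pickP => [c /eqP gc|//]; rewrite forget_r.
  by rewrite -E; apply/esym/gP; exists c.
by rewrite forget_l.
Qed.

Lemma brauer_right_act (s : 'S_(k + l)) e : e \in BE -> right_act s e \in BE.
Proof.
move=> eB; have [eL eb] := BEb eB; have sL := right_act_cell frLb s eL.
rewrite inE sL inE; apply/is_brauerP=> -[i|j].
  rewrite -(halfE frLb) // (half_act frLb) //; have := brauer_half eB (i := i).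
  by case: (half q e i) => //= j ij; rewrite (inj_eq inl_inj); apply/eqP => E;
    case: ij; rewrite E.
apply/eqP=> /low_mate; rewrite (frame_low frLb) // -(frame_low frLb _ eL).
by move=> /low_mate ej; have /is_brauerP/(_ (inr j)) := eb; rewrite ej eqxx.
Qed.

Lemma forget_act (p : 'S_k * 'S_l) e : e \in BE ->
  D (right_act (young_emb p) e) = right_act p.1 (D e).
Proof.
move=> eB; have [eL eb] := BEb eB; have DL := forget_labels_cell eB.
have pB := brauer_right_act (young_emb p) eB.
apply: (half_inj frL) => [||i]; first exact: forget_labels_cell.
  exact: (right_act_cell frL).
rewrite half_forget_labels // (half_act frL) // half_forget_labels //.
rewrite (half_act frLb) //; case: (half q e i) => [//|m].
rewrite [act_label _ _]/= young_embV; case: (split_ordP m) => a ->.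
  by rewrite young_embl !forget_l.
by rewrite young_embr !forget_r.
Qed.

(** Both diagrams label the same vertices by the last [l] labels, and two such labellings differ by
    a permutation. *)
Lemma forget_fiber e e' : e \in BE -> e' \in BE -> D e = D e' ->
  exists c : 'S_l, e' = right_act (young_emb (1%g : 'S_k, c)) e.
Proof.
move=> eB e'B DD; have [eL _] := BEb eB; have [e'L _] := BEb e'B.
have [hp hl hi] := half_valid frLb eL;
  have [hp' hl' hi'] := half_valid frLb e'L.
have ff i : forget i (half q e i) = forget i (half q e' i).
  by have := half_forget_labels eB i; rewrite DD (half_forget_labels e'B i).
have fr_c i c : half q e i = inr (rshift k c) -> exists c',
  half q e' i = inr (rshift k c').
  have := ff i => /[swap] ->; rewrite forget_r.
  case E: (half q e' i) => [j|m]; first by move=> /= [ij];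
    case: (brauer_half e'B (i := i)); rewrite E ij.
  by case: (split_ordP m) E => a -> E; rewrite ?forget_l // => _; exists a.
have fex c : exists c', [exists i,
  (half q e i == inr (rshift k c)) && (half q e' i == inr (rshift k c'))].
  have [i ic] := hl (rshift k c); have [c' ic'] := fr_c _ _ ic.
  by exists c'; apply/existsP; exists i; rewrite ic ic' !eqxx.
pose f c := xchoose (fex c).
have fP i c : half q e i = inr (rshift k c) -> half q e' i
  = inr (rshift k (f c)).
  move=> ic; have /existsP[i' /andP[/eqP ic' /eqP fc]] := xchooseP (fex c).
  by rewrite (hi _ _ _ ic ic').
have f_inj : injective f.
  move=> c1 c2 E; have [i1 ic1] := hl (rshift k c1);
    have [i2 ic2] := hl (rshift k c2).
  have := fP _ _ ic1; rewrite E => /hi'/(_ (fP _ _ ic2)) i12.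
  by move: ic1; rewrite i12 ic2 => cc; exact: esym (inr_rshift cc).
(* [f] sends labels of [e] to labels of [e']; the inverse is taken because [act_label] applies the
   inverse permutation. *)
exists (perm f_inj)^-1%g; apply: (half_inj frLb) => // [|i];
  first exact: (right_act_cell frLb).
rewrite (half_act frLb) //; have := ff i.
case E: (half q e i) => [j|m].
  case E': (half q e' i) => [j'|m'] /=; first by move=> [->].
  case: (split_ordP m') E' => a -> E';
    rewrite -/(forget i (inr _)) ?forget_l ?forget_r //.
  by move=> [ij]; case: (brauer_half eB (i := i)); rewrite E ij.
case: (split_ordP m) E => [a ->|c ->] E; last first.
  by rewrite (fP _ _ E) /= young_embV young_embr /= invgK permE.
rewrite forget_l /= young_embV young_embl /= invg1 perm1.
case E': (half q e' i) => [//|m']; case: (split_ordP m') => [a' ->|c ->].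
  by rewrite -[forget _ _]/(forget i (inr (lshift l a'))) forget_l => -[->].
by rewrite forget_r.
Qed.

(** Propagating lines and singletons are both fixed by [upper_mate]. This is why Brauer diagrams act
    alike before and after the cutting. *)
Lemma forget_upper_mate e : e \in BE -> upper_mate (D e) = upper_mate e.
Proof.
move=> eB; have [eL _] := BEb eB; apply/funext=> -[i|x] //.
rewrite (half_upper_mate frL) ?forget_labels_cell // (half_upper_mate frLb) //.
rewrite half_forget_labels //; case: (half q e x) => //= m.
by case: (split m).
Qed.

Lemma brauer_comp b e : is_brauer b -> e \in BE -> good b e ->
  comp_diagram b e \in BE.
Proof.
move=> bb eB g; have [eL eb] := BEb eB; have cL := good_cell frLb bb eL g.
rewrite inE cL inE; apply/is_brauerP=> -[i|j].
  rewrite -(halfE frLb) // (half_comp frLb) //.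
  have [] := @otherP _ (mate b) (upper_mate e) (mateK b) (@upper_mateK _ e) _
    (inl i) erefl.
    exact/is_brauerP.
  rewrite -/(core_other b e (inl i));
    case: (core_other _ _ _) => [j //|x] _ ux _.
  case E: (half q e x) => [j|m] //; case: (brauer_half eB (i := x)).
  by move: ux; rewrite (half_upper_mate frLb) // E => -[->].
apply/eqP=> /low_mate; rewrite (frame_low frLb) // -(frame_low frLb _ eL).
by move=> /low_mate ej; have /is_brauerP/(_ (inr j)) := eb; rewrite ej eqxx.
Qed.

Lemma forget_comp b e : is_brauer b -> e \in BE -> good b e ->
  D (comp_diagram b e) = comp_diagram b (D e).
Proof.
move=> bb eB g; have [eL eb] := BEb eB; have cB := brauer_comp bb eB g.
have uE := forget_upper_mate eB; have DL := forget_labels_cell eB.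
have g' : good b (D e) by move: g; rewrite /good /core uE.
apply: (half_inj frL) => [||i]; first exact: forget_labels_cell.
  exact: (good_cell frL).
rewrite half_forget_labels // (half_comp frL) // (half_comp frLb) //.
rewrite /core_other uE; case: (other _ _ _) => [//|x].
rewrite half_forget_labels //; case: (half q e x) => [//|m] /=.
by case: (split m).
Qed.

End Forget.

(** * Tableaux and Specht modules *)

Section Tableaux.

Local Open Scope nat_scope.

Variable r : nat.
Implicit Types (sh mu nu : seq nat) (x y : 'S_r) (a b : 'I_r).

Definition is_shape sh := [&& sorted geq sh, 0 \notin sh & sumn sh == r].

Lemma sumn_takeS (s : seq nat) i : sumn (take i.+1 s)
  = sumn (take i s) + nth 0 s i.
Proof.
by elim: s i => [|m s IH] [|i] //=; rewrite ?take0 ?addn0 // IH addnA.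
Qed.

Lemma sumn_take_leq (s : seq nat) i j : i <= j
  -> sumn (take i s) <= sumn (take j s).
Proof.
move=> /subnKC <-; elim: (j - i) => [|m IH]; first by rewrite addn0.
by rewrite addnS sumn_takeS; apply: leq_trans IH (leq_addr _ _).
Qed.

Section Shape.

Variable sh : seq nat.
Hypothesis shP : is_shape sh.

Let sh_sum : sumn sh = r. Proof. by case/and3P: shP => _ _ /eqP. Qed.

Lemma shape_nth_leq i j : i <= j -> nth 0 sh j <= nth 0 sh i.
Proof.
move=> ij; case: (ltnP j (size sh)) => [js|sj]; last by rewrite nth_default.
have /and3P[srt _ _] := shP.
apply: (sorted_leq_nth (leT := geq)) => //=.
- by move=> m p q /= pm mq; apply: leq_trans mq pm.
- by move=> m /=.
- exact: leq_ltn_trans ij js.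
Qed.

Lemma row_col_inj x a b :
  row_of sh x a = row_of sh x b -> col_of sh x a = col_of sh x b -> a = b.
Proof.
rewrite /row_of /col_of => ra ca; apply: (@perm_inj _ x^-1%g); apply: val_inj.
by rewrite -[LHS](reshape_indexK sh) ra ca reshape_indexK.
Qed.

Lemma box_exists x i c : c < nth 0 sh i ->
  exists a, row_of sh x a = i /\ col_of sh x a = c.
Proof.
move=> ci; have lt : flatten_index sh i c < r by have := flatten_indexP ci;
  rewrite sh_sum.
exists (x (Ordinal lt)); rewrite /row_of /col_of permK /=.
by rewrite flatten_indexKl // flatten_indexKr.
Qed.

Lemma col_of_lt x a : col_of sh x a < nth 0 sh (row_of sh x a).
Proof. by apply: reshape_offsetP; rewrite sh_sum. Qed.

Lemma col_of_leq x a : col_of sh x a < r.+1.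
Proof.
rewrite /col_of /reshape_offset; apply: leq_ltn_trans (leq_subr _ _) _.
by rewrite ltnS ltnW.
Qed.

Lemma reshape_index_lt i m : (reshape_index sh m < i)
  = (m < sumn (take i sh)) || (m >= r) && (reshape_index sh m < i).
Proof.
case: (ltnP m r) => mr /=; last first.
  have -> : (m < sumn (take i sh)) = false.
    apply/negbTE; rewrite -leqNgt (leq_trans _ mr) // -sh_sum.
    by rewrite -{2}(cat_take_drop i sh) sumn_cat leq_addr.
  by [].
rewrite orbF; set j := reshape_index sh m.
have mE : m = sumn (take j sh) + reshape_offset sh m by rewrite
  -[LHS](reshape_indexK sh).
have oj : reshape_offset sh m < nth 0 sh j by apply: reshape_offsetP;
  rewrite sh_sum.
apply/idP/idP => [ji|]; last first.
  move=> lt; rewrite ltnNge; apply: contraL lt => ij; rewrite -leqNgt mE.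
  by apply: leq_trans (sumn_take_leq _ ij) (leq_addr _ _).
apply: leq_trans (sumn_take_leq _ ji); rewrite sumn_takeS mE.
by rewrite -addnS leq_add2l.
Qed.

Lemma card_rows x i : #|[set a | row_of sh x a < i]| = sumn (take i sh).
Proof.
have le : sumn (take i sh) <= r.
  by rewrite -sh_sum -{2}(cat_take_drop i sh) sumn_cat leq_addr.
have -> : [set a | row_of sh x a < i] = [set x (widen_ord le b) | b :
  'I_(sumn (take i sh))].
  apply/setP=> a; rewrite inE /row_of reshape_index_lt [r <= _]leqNgt ltn_ord
    orbF.
  apply/idP/imsetP => [lt|[b _ ->]]; last by rewrite permK /=.
  exists (Ordinal lt) => //; rewrite -[LHS](permKV x); congr (x _).
  exact: val_inj.
rewrite card_imset ?card_ord // => b b' /perm_inj /(congr1 val) /= E.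
exact: val_inj.
Qed.

End Shape.

Lemma shape_eq mu nu : is_shape mu -> is_shape nu ->
  (forall i, sumn (take i mu) = sumn (take i nu)) -> mu = nu.
Proof.
move=> muP nuP E; have nE i : nth 0 mu i = nth 0 nu i.
  by have := E i.+1; rewrite !sumn_takeS E => /addnI.
have sz s s' : is_shape s' -> (forall i,
  nth 0 s i = nth 0 s' i) -> size s' <= size s.
  move=> /and3P[_ s0 _] ss; rewrite leqNgt; apply: contra s0 => lt.
  by rewrite -(nth_default 0 (leqnn (size s))) ss mem_nth.
apply: (@eq_from_nth _ 0) => //; apply/eqP.
by rewrite eqn_leq !sz.
Qed.

Lemma card_fibers (T C : finType) (f : T -> C) (A : {set T}) :
  #|A| = \sum_c #|[set a in A | f a == c]|.
Proof.
rewrite -sum1_card (partition_big f xpredT) //=; apply: eq_bigr => c _.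
by rewrite -sum1_card; apply: eq_bigl => a; rewrite !inE.
Qed.

(** The hypothesis of the dominance lemma: no transposition preserves both the rows of [y] and the
    columns of [x]. *)
Definition transverse nu y mu x := forall a b,
  row_of nu y a = row_of nu y b -> col_of mu x a = col_of mu x b -> a = b.

Section Dominance.

Variables (mu nu : seq nat) (x y : 'S_r).
Hypotheses (muP : is_shape mu) (nuP : is_shape nu) (tr : transverse nu y mu x).

Let f a : 'I_r.+1 := inord (col_of mu x a).

Let fE a b : f a = f b -> col_of mu x a = col_of mu x b.
Proof. by move=> /(congr1 val) /=; rewrite !inordK ?col_of_leq. Qed.

(** Rows are counted from 0. If column [c] of [x] reaches row [i], it has an entry in each of the
    [i] rows above, while each of the first [i] rows of [y] contains at most one entry of this
    column. Otherwise the whole column lies in the first [i] rows of [x]. *)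
Let fiber_leq i c : #|[set a in [set a | row_of nu y a < i] | f a == c]|
  <= #|[set a in [set a | row_of mu x a < i] | f a == c]|.
Proof.
case: (pickP (fun a => (f a == c) && (i <= row_of mu x a))) =>
  [a0 /andP[/eqP a0c ia0]|no].
  apply: (@leq_trans i).
    rewrite cardE -(size_map (row_of nu y)) -{2}(size_iota 0 i).
    apply: uniq_leq_size => [|j /mapP[a]]; last first.
      by rewrite mem_enum !inE => /andP[ai _] ->; rewrite mem_iota.
    rewrite map_inj_in_uniq ?enum_uniq // => a b.
    rewrite !mem_enum !inE => /andP[_ /eqP ac] /andP[_ /eqP bc] ab.
    by apply: tr => //; apply: fE; rewrite ac bc.
  rewrite cardE -(size_map (row_of mu x)) -{1}(size_iota 0 i).
  apply: uniq_leq_size => [|j]; first exact: iota_uniq.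
  rewrite mem_iota add0n => /andP[_ ji].
  have /(box_exists muP x)[a [aj ac]] : col_of mu x a0 < nth 0 mu j.
    apply: leq_trans (col_of_lt muP x a0) _; apply: shape_nth_leq => //.
    exact: leq_trans (ltnW ji) ia0.
  apply/mapP; exists a => //; rewrite mem_enum !inE aj ji /=.
  by rewrite -a0c /f ac.
apply/subset_leq_card/subsetP=> a; rewrite !inE => /andP[_ ac].
by rewrite ac andbT; have := no a; rewrite ac /= leqNgt => /negbFE.
Qed.

Lemma dominance i : sumn (take i nu) <= sumn (take i mu).
Proof.
rewrite -(card_rows nuP y) -(card_rows muP x) !(card_fibers f).
by apply: leq_sum => c _; apply: fiber_leq.
Qed.

(** For equal shapes the columnwise inequalities have equal sums, so each of them is an equality. *)
Lemma transverse_fiber i c : mu = nu ->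
  #|[set a in [set a | row_of nu y a < i] | f a == c]|
  = #|[set a in [set a | row_of mu x a < i] | f a == c]|.
Proof.
move=> mn; pose E1 c := #|[set a in [set a | row_of nu y a < i] | f a == c]|.
pose E2 c := #|[set a in [set a | row_of mu x a < i] | f a == c]|.
have /leqif_sum[_] : forall c, true -> E1 c <= E2 c ?= iff (E1 c == E2 c).
  by move=> c' _; split=> //; apply: fiber_leq.
rewrite -!card_fibers (card_rows nuP) (card_rows muP) mn eqxx.
by move=> /esym/forall_inP/(_ c isT)/eqP; rewrite /E2 mn.
Qed.

(* The column permutation of [x] is found one row at a time, since the rows   *)
(* of [y] cut each column of [x] in as many entries as those of [x].          *)
Lemma transverse_perm : mu = nu -> exists2 u : 'S_r,
  forall a, col_of mu x (u a) = col_of mu x a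
  & forall a, row_of mu x (u a) = row_of nu y a.
Proof.
move=> mn; have ex a : exists b,
    (f b == f a) && (row_of mu x b == row_of nu y a).
  pose i := row_of nu y a.
  have split_lt (g : 'I_r -> nat) :
    #|[set b in [set b | g b < i.+1] | f b == f a]|
      = #|[set b in [set b | g b < i] | f b == f a]| + #|[set b | (f b == f a)
        && (g b == i)]|.
    rewrite -(cardsID [set b | g b == i]) addnC; congr (_ + _);
      apply: eq_card => b.
      rewrite !inE; case: (f b == f a); rewrite ?andbF //= !andbT.
      by rewrite ltnS ltn_neqAle.
    rewrite !inE; case: (f b == f a); rewrite ?andbF //= andbT.
    by case: eqP => [->|]; rewrite ?andbF ?ltnSn.
  have := transverse_fiber i.+1 (f a) mn; rewrite !split_lt transverse_fiber //.
  move/addnI => E; have : 0 < #|[set b | (f b == f a) && (row_of mu x b == i)]|.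
    by rewrite -E card_gt0; apply/set0Pn; exists a; rewrite inE !eqxx.
  by rewrite card_gt0 => /set0Pn[b]; rewrite inE => ?; exists b.
pose u a := xchoose (ex a); have uP a : f (u a) = f a /\ row_of mu x (u a)
  = row_of nu y a.
  by have /andP[/eqP-> /eqP->] := xchooseP (ex a).
have u_inj : injective u.
  move=> a b E; apply: tr; first by rewrite -(uP a).2 -(uP b).2 E.
  by apply: fE; rewrite -(uP a).1 -(uP b).1 E.
exists (perm u_inj) => a; rewrite permE; last exact: (uP a).2.
exact/fE/(uP a).1.
Qed.

End Dominance.

End Tableaux.

(** * Young symmetrizers, tabloids and polytabloids *)

Section YoungOperators.

Variables (F : fieldType) (r : nat).
Implicit Types (mu nu : seq nat) (x y : 'S_r) (V W : opmod F 'S_r).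

(** An [opmod] is a mere family of operators; these are the laws of a group action. *)
Record is_rep V : Prop := IsRep {
  rep1 : forall v, act V 1%g v = v;
  repM : forall s t v, act V (pcomp s t) v = act V s (act V t v)
}.

Definition sg (s : 'S_r) : F := (-1) ^+ odd_perm s.

Lemma sgM s t : sg (s * t)%g = sg s * sg t.
Proof. by rewrite /sg odd_permM signr_addb. Qed.

Lemma sgV s : sg s^-1%g = sg s.
Proof. by rewrite /sg odd_permV. Qed.

Lemma sgK s : sg s * sg s = 1.
Proof. by rewrite /sg -signr_addb addbb. Qed.

Definition row_stab mu x : {set 'S_r} :=
  [set q : 'S_r | [forall a, row_of mu x (q a) == row_of mu x a]].

Lemma col_stabP mu x (p : 'S_r) :
  reflect (forall a, col_of mu x (p a) = col_of mu x a) (p \in col_stab mu x).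
Proof.
by rewrite inE; apply: (iffP forallP) => H a; [apply/eqP | rewrite H].
Qed.

Lemma row_stabP mu x (p : 'S_r) :
  reflect (forall a, row_of mu x (p a) = row_of mu x a) (p \in row_stab mu x).
Proof.
by rewrite inE; apply: (iffP forallP) => H a; [apply/eqP | rewrite H].
Qed.

Lemma col_stabM mu x p q : q \in col_stab mu x ->
  ((q * p)%g \in col_stab mu x) = (p \in col_stab mu x).
Proof.
move=> /col_stabP qC; apply/col_stabP/col_stabP => H a; last by rewrite permM H.
by rewrite -(permKV q a) -permM H qC.
Qed.

Lemma col_stabMr mu x p q : q \in col_stab mu x ->
  ((p * q)%g \in col_stab mu x) = (p \in col_stab mu x).
Proof.
move=> /col_stabP qC; apply/col_stabP/col_stabP => H a;
  last by rewrite permM qC.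
by rewrite -qC -permM H.
Qed.

Lemma row_stabM mu x p q : q \in row_stab mu x ->
  ((q * p)%g \in row_stab mu x) = (p \in row_stab mu x).
Proof.
move=> /row_stabP qC; apply/row_stabP/row_stabP => H a; last by rewrite permM H.
by rewrite -(permKV q a) -permM H qC.
Qed.

Lemma col_stab1 mu x : 1%g \in col_stab mu x.
Proof. by apply/col_stabP => a; rewrite perm1. Qed.

Lemma row_stab1 mu x : 1%g \in row_stab mu x.
Proof. by apply/row_stabP => a; rewrite perm1. Qed.

Lemma col_stab_tperm mu x a b : col_of mu x a = col_of mu x b ->
  tperm a b \in col_stab mu x.
Proof. by move=> ab; apply/col_stabP => c; case: tpermP => // ->. Qed.

Lemma row_stab_tperm mu x a b : row_of mu x a = row_of mu x b ->
  tperm a b \in row_stab mu x.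
Proof. by move=> ab; apply/row_stabP => c; case: tpermP => // ->. Qed.

Definition col_anti mu x V : 'End(V) :=
  \sum_(p in col_stab mu x) sg p *: act V p.

Definition row_sym mu x V : 'End(V) := \sum_(q in row_stab mu x) act V q.

(** The Young symmetrizer of the tableau filled in reading order, defined on every module so that it
    can be compared along equivariant maps. *)
Definition young_op mu V : 'End(V) :=
  (row_sym mu 1%g V \o col_anti mu 1%g V)%VF.

Lemma col_antiE mu x V v :
  col_anti mu x V v = \sum_(p in col_stab mu x) sg p *: act V p v.
Proof. by rewrite sum_lfunE; apply: eq_bigr => p _; rewrite scale_lfunE. Qed.

Lemma row_symE mu x V v : row_sym mu x V v
  = \sum_(q in row_stab mu x) act V q v.
Proof. by rewrite sum_lfunE. Qed.

Lemma young_opE mu V v :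
  young_op mu V v = row_sym mu 1%g V (col_anti mu 1%g V v).
Proof. exact: comp_lfunE. Qed.

Section Natural.

Variables (V W : opmod F 'S_r) (f : 'Hom(V, W)) (fE : equivariant f).

Lemma col_anti_nat mu x v : f (col_anti mu x V v) = col_anti mu x W (f v).
Proof.
rewrite !col_antiE linear_sum; apply: eq_bigr => p _.
by rewrite linearZ /= fE.
Qed.

Lemma row_sym_nat mu x v : f (row_sym mu x V v) = row_sym mu x W (f v).
Proof. by rewrite !row_symE linear_sum; apply: eq_bigr => p _ /=;
  rewrite fE. Qed.

Lemma young_op_nat mu v : f (young_op mu V v) = young_op mu W (f v).
Proof. by rewrite !young_opE row_sym_nat col_anti_nat. Qed.

End Natural.

Section Rep.

Variables (V : opmod F 'S_r) (Vrep : is_rep V).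

Lemma col_antir mu x c v : c \in col_stab mu x ->
  col_anti mu x V (act V c v) = sg c *: col_anti mu x V v.
Proof.
move=> cC; rewrite !col_antiE scaler_sumr (reindex_inj (mulgI c^-1%g)) /=.
have cC' : c^-1%g \in col_stab mu x by rewrite -(col_stabM _ cC) mulgV
  col_stab1.
apply: eq_big => p; first by rewrite col_stabM.
by move=> _; rewrite -(repM Vrep) /pcomp mulKVg sgM sgV scalerA.
Qed.

Lemma col_antil mu x c v : c \in col_stab mu x ->
  act V c (col_anti mu x V v) = sg c *: col_anti mu x V v.
Proof.
move=> cC; rewrite !col_antiE scaler_sumr linear_sum (reindex_inj (mulIg
  c^-1%g)) /=.
have cC' : c^-1%g \in col_stab mu x by rewrite -(col_stabM _ cC) mulgV
  col_stab1.
apply: eq_big => p; first by rewrite col_stabMr.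
move=> _; rewrite linearZ /= -(repM Vrep) /pcomp mulgKV sgM sgV scalerA.
by rewrite mulrC.
Qed.

Lemma row_symr mu x q v : q \in row_stab mu x ->
  row_sym mu x V (act V q v) = row_sym mu x V v.
Proof.
move=> qR; rewrite !row_symE (reindex_inj (mulgI q^-1%g)) /=.
have qR' : q^-1%g \in row_stab mu x by rewrite -(row_stabM _ qR) mulgV
  row_stab1.
apply: eq_big => p; first by rewrite row_stabM.
by move=> _; rewrite -(repM Vrep) /pcomp mulKVg.
Qed.

End Rep.

(** The basis consists of all sets of permutations, so that a single module contains the tabloids of
    every shape. *)
Definition tabloid_mod : opmod F 'S_r :=
  @Opmod F 'S_r {ffun {set 'S_r} -> F^o} (@tabloid_act F r).

Lemma tabloid_act_basis s (A : {set 'S_r}) :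
  act tabloid_mod s (basis_vec F A) = basis_vec F [set pcomp s t | t in A].
Proof. exact: lin_ext_basis. Qed.

Lemma tabloid_mod_rep : is_rep tabloid_mod.
Proof.
split=> [v|s t v].
  rewrite -[RHS]id_lfunE; congr (fun_of_lfun _ v); apply: ffun_hom_ext => A.
  rewrite tabloid_act_basis id_lfunE; congr (basis_vec F _).
  by rewrite -[RHS]imset_id; apply: eq_imset => p; rewrite /pcomp mulg1.
rewrite -comp_lfunE; congr (fun_of_lfun _ v); apply: ffun_hom_ext => A.
rewrite comp_lfunE !tabloid_act_basis; congr (basis_vec F _).
by rewrite -imset_comp; apply: eq_imset => p; rewrite /pcomp /= mulgA.
Qed.

Lemma row_of_pcomp nu s y a : row_of nu (pcomp s y) a = row_of nu y (s^-1%g a).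
Proof. by rewrite /row_of /pcomp invMg permM. Qed.

Lemma col_of_pcomp nu s y a : col_of nu (pcomp s y) a = col_of nu y (s^-1%g a).
Proof. by rewrite /col_of /pcomp invMg permM. Qed.

Lemma tabloidP nu y t :
  reflect (row_of nu t =1 row_of nu y) (t \in tabloid nu y).
Proof.
by rewrite inE; apply: (iffP forallP) => H a; [apply/eqP | rewrite H].
Qed.

Lemma tabloid_eq nu y t : tabloid nu y
  = tabloid nu t <-> row_of nu y =1 row_of nu t.
Proof.
split=> [E|E]; first by apply/tabloidP; rewrite -E; apply/tabloidP.
by apply/setP=> z; apply/tabloidP/tabloidP => H a; rewrite H E.
Qed.

Lemma tabloid_shift nu s y :
  [set pcomp s t | t in tabloid nu y] = tabloid nu (pcomp s y).
Proof.
apply/setP=> z; apply/imsetP/tabloidP => [[t /tabloidP H ->] a|H].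
  by rewrite !row_of_pcomp H.
exists (pcomp s^-1%g z); last by rewrite /pcomp mulgKV.
apply/tabloidP=> a; rewrite row_of_pcomp invgK H row_of_pcomp permK.
by [].
Qed.

Definition tab nu y : tabloid_mod := basis_vec F (tabloid nu y).

Lemma tab_act nu s y : act tabloid_mod s (tab nu y) = tab nu (pcomp s y).
Proof. by rewrite /tab tabloid_act_basis tabloid_shift. Qed.

Lemma polytabloidE nu y : polytabloid F nu y
  = col_anti nu y tabloid_mod (tab nu y).
Proof.
by rewrite col_antiE; apply: eq_bigr => p _; rewrite tab_act.
Qed.

Lemma col_stab_conj nu s y p :
  ((p ^ s)%g \in col_stab nu (pcomp s y)) = (p \in col_stab nu y).
Proof.
apply/col_stabP/col_stabP => H a.
  by have := H (s a); rewrite !col_of_pcomp permJ !permK.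
by rewrite -(permKV s a) permJ !col_of_pcomp !permK.
Qed.

Lemma polytabloid_act nu s y :
  act tabloid_mod s (polytabloid F nu y) = polytabloid F nu (pcomp s y).
Proof.
rewrite !polytabloidE !col_antiE linear_sum [RHS](reindex_inj (conjg_inj s)) /=.
apply: eq_big => p; first by rewrite col_stab_conj.
move=> _; rewrite linearZ /= !tab_act /sg odd_permJ; congr (_ *: tab nu _).
by rewrite /pcomp conjgE -!mulgA mulKVg.
Qed.

Hypothesis F0 : forall m, m.+1%:R != 0 :> F.

Let addvv0 V (v : V) : v = - v -> v = 0.
Proof.
move=> vv; have : 2%:R *: v = 0 by rewrite scaler_nat mulr2n {1}vv addNr.
by move/eqP; rewrite scaler_eq0 (negPf (F0 1)) => /eqP.
Qed.

(** A transposition of two entries in a common row of [y] and a common column of [x] fixes the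
    tabloid and negates its antisymmetrization, which then vanishes because 2 is invertible. *)
Lemma col_anti_tab mu nu x y : col_anti mu x tabloid_mod (tab nu y) != 0 ->
  is_shape r mu -> transverse nu y mu x.
Proof.
move=> ne muP a b rab cab; apply/eqP; apply: contraNT ne => ab;
  apply/eqP/addvv0.
have := col_antir tabloid_mod_rep (tab nu y) (col_stab_tperm cab).
rewrite tab_act /sg odd_tperm ab expr1 scaleN1r => <-; congr (_ _).
rewrite /tab; congr (basis_vec F _); apply/tabloid_eq => c.
by rewrite row_of_pcomp tpermV; case: tpermP => // ->.
Qed.

Lemma row_sym_poly mu nu x y :
  row_sym mu x tabloid_mod (polytabloid F nu y) != 0 -> transverse mu x nu y.
Proof.
move=> ne a b rab cab; apply/eqP; apply: contraNT ne => ab; apply/eqP/addvv0.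
have := row_symr tabloid_mod_rep (polytabloid F nu y) (row_stab_tperm rab).
rewrite {1}polytabloidE (col_antil tabloid_mod_rep) ?col_stab_tperm //.
by rewrite -polytabloidE /sg odd_tperm ab expr1 scaleN1r linearN => ->.
Qed.

(** If the value is nonzero, the two tableaux are transverse, and [transverse_perm] gives a column
    permutation relating their tabloids; the value is then the polytabloid up to sign. *)
Lemma col_anti_line mu x y : is_shape r mu ->
  exists c, col_anti mu x tabloid_mod (tab mu y) = c *: polytabloid F mu x.
Proof.
move=> muP; have [E|ne] := eqVneq (col_anti mu x tabloid_mod (tab mu y)) 0.
  by exists 0; rewrite scale0r.
have tr := col_anti_tab ne muP.
have [u uC uR] := transverse_perm muP muP tr erefl.
exists (sg u^-1%g); rewrite polytabloidE -(col_antir tabloid_mod_rep);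
  last first.
  by apply/col_stabP => a; rewrite -[in RHS](permKV u a) uC.
rewrite tab_act; congr (col_anti _ _ _ _); congr (basis_vec F _).
by apply/tabloid_eq => a; rewrite row_of_pcomp invgK uR.
Qed.

Lemma col_anti_poly mu x : col_anti mu x tabloid_mod (polytabloid F mu x)
  = #|col_stab mu x|%:R *: polytabloid F mu x.
Proof.
rewrite {1}polytabloidE [X in col_anti _ _ _ X]col_antiE linear_sum /=.
rewrite (eq_bigr (fun=> polytabloid F mu x)); last first.
  move=> p pC; rewrite linearZ /= (col_antir tabloid_mod_rep) // scalerA sgK.
  by rewrite scale1r -polytabloidE.
by rewrite sumr_const scaler_nat.
Qed.

(** A row permutation times a column permutation fixes the tabloid of [x] only if the column
    permutation is trivial, so each row permutation contributes 1. The coefficient is nonzero in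
    characteristic 0. *)
Lemma row_sym_poly_coef mu x : is_shape r mu ->
  (row_sym mu x tabloid_mod (polytabloid F mu x) : {ffun {set 'S_r} -> F^o})
    (tabloid mu x) = #|row_stab mu x|%:R.
Proof.
move=> muP; rewrite row_symE sum_ffunE (eq_bigr (fun=> 1)) ?sumr_const //.
move=> q /row_stabP qR; rewrite polytabloidE col_antiE linear_sum sum_ffunE /=.
rewrite (bigD1 1%g) ?col_stab1 //= big1 => [|p /andP[/col_stabP pC p1]].
  rewrite addr0 linearZ /= !tab_act !ffunE /sg odd_perm1 expr0 scale1r.
  suff -> : tabloid mu (pcomp q (pcomp 1%g x)) = tabloid mu x by rewrite eqxx.
  apply/tabloid_eq => a; rewrite !row_of_pcomp invg1 perm1.
  by rewrite -[in RHS](permKV q a) qR.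
rewrite linearZ /= !tab_act !ffunE; case: eqP => [/tabloid_eq E|];
  last by rewrite scaler0.
case/eqP: p1; apply/permP=> a; rewrite perm1;
  apply: (@row_col_inj _ mu x) => //.
by have := E (q (p a)); rewrite !row_of_pcomp !permK qR.
Qed.

Notation Specht := (specht F r).

Lemma specht_proj_val nu (u : tabloid_mod) : u \in specht_space F r nu ->
  vsval (subquot_proj (specht_space F r nu) 0 u) = u.
Proof.
move=> uS; have := subquot_valK (sub0v _) uS; rewrite memv0 subr_eq0.
by move/eqP.
Qed.

Definition specht_val nu : 'Hom(Specht nu, tabloid_mod) :=
  linfun (fun v : Specht nu => vsval v : tabloid_mod).

Lemma specht_valE nu (v : Specht nu) : specht_val nu v = vsval v.
Proof. by rewrite lin_lfunE. Qed.

Lemma specht_val_inj nu : injective (specht_val nu).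
Proof. by move=> u v; rewrite !specht_valE => /subvs_inj. Qed.

Lemma specht_val_mem nu (v : Specht nu) :
  specht_val nu v \in specht_space F r nu.
Proof.
rewrite specht_valE; apply: (subvP (diffvSl _ 0)); exact: subvsP.
Qed.

Lemma specht_space_act nu s :
  (act tabloid_mod s @: specht_space F r nu <= specht_space F r nu)%VS.
Proof.
rewrite limg_span; apply/span_subvP => _ /mapP[_ /imageP[y _ ->] ->].
by rewrite polytabloid_act; apply/memv_span/image_f.
Qed.

Lemma specht_val_act nu : equivariant (specht_val nu).
Proof.
move=> s v; rewrite -{1}(subquot_proj_val v).
rewrite [act _ _ _](subquot_endE (sub0v _)) ?limg0 ?subvv //; last first.
- by rewrite -specht_valE specht_val_mem.
- exact: specht_space_act.
rewrite specht_valE specht_proj_val -?specht_valE //.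
by apply: (subvP (specht_space_act nu s)); rewrite memv_img ?specht_val_mem.
Qed.

Lemma specht_rep nu : is_rep (Specht nu).
Proof.
have [r1 rM] := tabloid_mod_rep.
split=> [v|s t v]; apply: specht_val_inj.
  by rewrite (specht_val_act 1%g v); apply: r1.
rewrite (specht_val_act (pcomp s t) v) (specht_val_act s) (specht_val_act t).
exact: rM.
Qed.

Definition poly_vec nu y : Specht nu :=
  subquot_proj (specht_space F r nu) 0 (polytabloid F nu y).

Lemma specht_val_poly nu y : specht_val nu (poly_vec nu y) = polytabloid F nu y.
Proof. by rewrite specht_valE specht_proj_val //; apply/memv_span/image_f. Qed.

Lemma poly_vec_gen nu (U : {vspace Specht nu}) :
  (forall s v, v \in U -> act (Specht nu) s v \in U) -> poly_vec nu 1%g \in U ->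
  U = fullv.
Proof.
move=> UA Ue; apply/vspaceP=> v; rewrite memvf.
have sub : (<<[seq poly_vec nu y | y : 'S_r]>> <= U)%VS.
  apply/span_subvP=> _ /imageP[y _ ->].
  have -> : poly_vec nu y = act (Specht nu) y (poly_vec nu 1%g); last exact: UA.
  apply: specht_val_inj; rewrite specht_val_act !specht_val_poly
    polytabloid_act.
  by rewrite /pcomp mul1g.
have : specht_val nu v \in (specht_val nu @: <<[seq poly_vec nu y | y :
  'S_r]>>)%VS.
  have := specht_val_mem v; rewrite limg_span -map_comp.
  by rewrite (eq_map (specht_val_poly nu)).
by case/memv_imgP=> w wS /specht_val_inj ->; apply: (subvP sub).
Qed.

Lemma specht_space_hom nu (f g : 'Hom(tabloid_mod, tabloid_mod)) :
  (forall y, f (polytabloid F nu y) = g (polytabloid F nu y)) ->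
  forall v : Specht nu, f (specht_val nu v) = g (specht_val nu v).
Proof.
move=> fg v; have /subvP : (specht_space F r nu <= lker (f - g))%VS.
  by apply/span_subvP=> _ /imageP[y _ ->]; apply/eqlfunP; apply: fg.
by move/(_ _ (specht_val_mem v))/eqlfunP.
Qed.

(** Polytabloids are combinations of tabloids of shape [mu], and [col_anti_line] sends all of these
    into one line. *)
Lemma col_anti_specht_line mu (v : Specht mu) : is_shape r mu ->
  col_anti mu 1%g (Specht mu) v \in <[poly_vec mu 1%g]>%VS.
Proof.
move=> muP; have line y : col_anti mu 1%g tabloid_mod (polytabloid F mu y)
    \in <[polytabloid F mu 1%g : tabloid_mod]>%VS.
  rewrite polytabloidE [X in col_anti _ _ _ X]col_antiE linear_sum memv_suml //.
  move=> p _; rewrite linearZ memvZ //= tab_act.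
  by have [c ->] := col_anti_line 1%g (pcomp p y) muP; rewrite memvZ ?memv_line.
have /subvP sub : (specht_space F r mu
    <= col_anti mu 1%g tabloid_mod @^-1: <[polytabloid F mu 1%g :
      tabloid_mod]>)%VS.
  by apply/span_subvP=> _ /imageP[y _ ->]; rewrite -memv_preim; apply: line.
have := sub _ (specht_val_mem v); rewrite -memv_preim => /vlineP[c E].
apply/vlineP; exists c; apply: specht_val_inj.
by rewrite (col_anti_nat (@specht_val_act mu)) E linearZ /= specht_val_poly.
Qed.

Lemma col_anti_poly_vec mu : col_anti mu 1%g (Specht mu) (poly_vec mu 1%g)
  = #|col_stab mu (1%g : 'S_r)|%:R *: poly_vec mu 1%g.
Proof.
apply: specht_val_inj; rewrite (col_anti_nat (@specht_val_act mu)).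
by rewrite linearZ /= specht_val_poly col_anti_poly.
Qed.

Lemma natr_card_neq0 (A : {set 'S_r}) a : a \in A -> #|A|%:R != 0 :> F.
Proof. by rewrite (cardsD1 a) => ->. Qed.

Lemma row_sym_poly_vec mu : is_shape r mu ->
  row_sym mu 1%g (Specht mu) (poly_vec mu 1%g) != 0.
Proof.
move=> muP; apply: contraNneq (natr_card_neq0 (row_stab1 mu 1%g)) => E.
rewrite -row_sym_poly_coef // -specht_val_poly -(row_sym_nat (@specht_val_act
  mu)).
by rewrite E linear0 ffunE.
Qed.

Lemma young_op_poly_vec mu : is_shape r mu ->
  young_op mu (Specht mu) (poly_vec mu 1%g) != 0.
Proof.
move=> muP; rewrite young_opE col_anti_poly_vec linearZ scaler_eq0 negb_or.
by rewrite (natr_card_neq0 (col_stab1 _ _)) row_sym_poly_vec.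
Qed.

Lemma young_op_rank mu : is_shape r mu -> \dim (limg (young_op mu (Specht mu)))
  = 1%N.
Proof.
move=> muP; pose w := row_sym mu 1%g (Specht mu) (poly_vec mu 1%g).
suff -> : limg (young_op mu (Specht mu)) = <[w]>%VS.
  by rewrite dim_vline row_sym_poly_vec.
apply/eqP; rewrite eqEsubv; apply/andP; split.
  apply/subvP=> _ /memv_imgP[v _ ->]; rewrite young_opE.
  have /vlineP[c ->] := col_anti_specht_line v muP.
  by rewrite linearZ memvZ ?memv_line.
rewrite -memvE; have := memv_img (young_op mu (Specht mu)) (memvf (poly_vec mu
  1%g)).
rewrite young_opE col_anti_poly_vec linearZ /= => H.
by rewrite -[w]scale1r -(mulVf (natr_card_neq0 (col_stab1 mu 1%g))) -scalerA
  memvZ.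
Qed.

(** A nonzero row symmetrization and a nonzero column antisymmetrization give transverse tableaux in
    both directions, hence dominance in both directions. *)
Lemma young_op_eq0 mu nu (v : Specht nu) : is_shape r mu -> is_shape r nu ->
  young_op mu (Specht nu) v != 0 -> mu = nu.
Proof.
move=> muP nuP; rewrite young_opE => ne.
have sub0 (f : 'End(tabloid_mod)) (u : Specht nu) : f (specht_val nu u) != 0 ->
    exists y, f (polytabloid F nu y) != 0.
  move=> fu; apply: contrapT => no; case/eqP: fu.
  rewrite -[RHS](zero_lfunE _ (specht_val nu u)); apply: specht_space_hom => y.
  by rewrite zero_lfunE; apply/eqP/negPn/negP => ?; apply: no; exists y.
have [y] : exists y, row_sym mu 1%g tabloid_mod (polytabloid F nu y) != 0.
  apply: (sub0 _ (col_anti mu 1%g (Specht nu) v)).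
  rewrite -(row_sym_nat (@specht_val_act nu)).
  by rewrite -(inj_eq (@specht_val_inj nu)) linear0 in ne.
move=> /row_sym_poly tr1.
have [z] : exists z, col_anti mu 1%g tabloid_mod (polytabloid F nu z) != 0.
  apply: (sub0 _ v); rewrite -(col_anti_nat (@specht_val_act nu)).
  rewrite -(inj_eq (@specht_val_inj nu)) linear0 in ne.
  by apply: contraNneq ne => E; rewrite row_sym_nat ?E ?linear0 //;
    apply: specht_val_act.
rewrite polytabloidE [X in col_anti _ _ _ X]col_antiE linear_sum => ne2.
have [p tr2] : exists p, transverse nu (pcomp p z) mu 1%g.
  apply: contrapT => no; case/eqP: ne2; apply: big1 => p _.
  rewrite linearZ /= tab_act; apply/eqP; rewrite scaler_eq0; apply/orP; right.
  by apply/negPn/negP => /col_anti_tab/(_ muP) tr; apply: no; exists p.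
apply: (shape_eq muP nuP) => i; apply/eqP; rewrite eqn_leq.
by rewrite (dominance nuP muP tr1) (dominance muP nuP tr2).
Qed.

End YoungOperators.

(** * Conjugacy classes of symmetric groups *)

Section CycleTypes.

Local Open Scope nat_scope.

Lemma intpartn_exists r (s : seq nat) : is_intpartn r s ->
  exists mu : intpartn r, mu = s :> seq nat.
Proof.
move=> /[dup] sP /and3P[_ s0 /eqP sr].
have sz : size (map (@inord r) s) <= r.
  rewrite size_map -[X in _ <= X]sr; elim: s s0 {sP sr} => //= m s IH.
  rewrite inE negb_or eq_sym -lt0n => /andP[m0 /IH].
  by move=> H; rewrite -add1n leq_add.
have sE : map val (map (@inord r) s) = s.
  rewrite -map_comp -[RHS]map_id; apply/eq_in_map => m ms /=.
  rewrite inordK // ltnS -sr; elim: s ms {sP s0 sr sz} => //= p s IH.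
  rewrite inE => /orP[/eqP->|/IH]; first exact: leq_addr.
  by move=> H; apply: leq_trans H (leq_addl _ _).
have muP : is_intpartn r (map val (Bseq sz)) by rewrite /= sE.
by exists (Intpartn muP); rewrite /intpartn_seq /= sE.
Qed.

Section Powers.

Variables (T : finType) (s : {perm T}) (a : T).

Lemma perm_pow_mod m : (s ^+ m)%g a = (s ^+ (m %% #|porbit s a|))%g a.
Proof.
have cyc j : (s ^+ (j * #|porbit s a|))%g a = a.
  elim: j => [|j IH]; first by rewrite mul0n expg0 perm1.
  by rewrite mulSn expgD permM !permX iter_porbit -permX.
by rewrite {1}(divn_eq m #|porbit s a|) expgD permM cyc.
Qed.

Lemma perm_pow_eq m m' :
  ((s ^+ m)%g a == (s ^+ m')%g a) = (m == m' %[mod #|porbit s a|]).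
Proof.
have pos : 0 < #|porbit s a| by rewrite lt0n card_porbit_neq0.
rewrite perm_pow_mod [(s ^+ m')%g a]perm_pow_mod.
have nE j : j < #|porbit s a| -> (s ^+ j)%g a
  = nth a (traject s a #|porbit s a|) j.
  by move=> jN; rewrite nth_traject // permX.
rewrite !nE ?ltn_mod // nth_uniq ?size_traject ?ltn_mod //.
exact: uniq_traject_porbit.
Qed.

End Powers.

Section CycleType.

Variable r : nat.
Implicit Types s t : 'S_r.

Definition cycle_type s : seq nat := sort geq [seq #|(X :
  {set 'I_r})| | X <- enum (porbits s)].

Lemma cycle_type_intpartn s : is_intpartn r (cycle_type s).
Proof.
apply/and3P; split.
- by apply: sort_sorted => m p; apply: leq_total.
- rewrite mem_sort; apply/mapP=> -[X]; rewrite mem_enum => /imsetP[x _ ->].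
  by move/esym/eqP; rewrite (negPf (card_porbit_neq0 s x)).
rewrite (perm_sumn (permEl (perm_sort _ _))) sumnE big_map big_enum /=.
rewrite -(card_partition (D := [set: 'I_r])) ?cardsT ?card_ord //.
apply/and3P; split.
- apply/eqP/setP=> x; rewrite inE; apply/bigcupP; exists (porbit s x).
    exact: imset_f.
  exact: porbit_id.
- apply/trivIsetP=> _ _ /imsetP[x _ ->] /imsetP[y _ ->].
  apply: contraR => /pred0Pn[z /andP[/= zx zy]].
  by move: zx zy; rewrite -!eq_porbit_mem => /eqP<- /eqP<-.
- apply/imsetP=> -[x _ E]; have := porbit_id s x.
  by rewrite -E inE.
Qed.

(** List the cycles of each permutation by decreasing length and match them by position. Choosing a
    base point in each cycle, send [s ^ m] of a base point to [t ^ m] of the matching one. *)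
Lemma cycle_type_conj s t : cycle_type s = cycle_type t -> exists c,
  t = (s ^ c)%g.
Proof.
pose ord u := sort (relpre (fun X : {set 'I_r} => #|X|) geq) (enum (porbits u)).
have ordE u : cycle_type u = [seq #|(X : {set 'I_r})| | X <- ord u].
  by rewrite /cycle_type sort_map.
have mem_ord u X : (X \in ord u)
  = (X \in porbits u) by rewrite mem_sort mem_enum.
have uniq_ord u : uniq (ord u) by rewrite sort_uniq enum_uniq.
rewrite !ordE => st; have sz : size (ord s) = size (ord t).
  by have := congr1 size st; rewrite !size_map.
pose i x := index (porbit s x) (ord s).
have xs x : porbit s x \in ord s by rewrite mem_ord imset_f.
have it x : i x < size (ord t) by rewrite -sz index_mem.
pose B x := nth set0 (ord t) (i x).
have Bt x : B x \in porbits t by rewrite -mem_ord mem_nth.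
have cB x : #|B x| = #|porbit s x|.
  have := congr1 (nth 0 ^~ (i x)) st; rewrite !(nth_map set0) ?sz //.
  by rewrite nth_index.
(* For nonempty [X] the choice does not depend on the default [x], so all elements of a cycle share
   its base point. *)
pose base (X : {set 'I_r}) x := odflt x [pick y in X].
have baseP (X : {set 'I_r}) x y : y \in X -> base X x \in X /\ base X x
  = base X y.
  by rewrite /base; case: pickP => [z zX|no] // yX; rewrite no in yX.
pose bs x := base (porbit s x) x; pose bt x := base (B x) x.
have bsP x : bs x \in porbit s x by apply: (baseP _ _ x (porbit_id s x)).1.
have [bB Bb] : (forall x, bt x \in B x) /\ (forall x, B x = porbit t (bt x)).
  have bB x : bt x \in B x.
    have /imsetP[y _ E] := Bt x; apply: (baseP (B x) x y _).1.
    by rewrite E porbit_id.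
  split=> // x; have /imsetP[y _ E] := Bt x; have := bB x.
  by rewrite {1}E -eq_porbit_mem => /eqP ->.
have ex x : exists m, (s ^+ m)%g (bs x) == x.
  have : x \in porbit s (bs x) by rewrite porbit_sym.
  by case/porbitP=> m xE; exists m; rewrite -xE.
have [mm mmP] : exists mm, forall x, (s ^+ mm x)%g (bs x) = x.
  by exists (fun x => xchoose (ex x)) => x; apply/eqP/(xchooseP (ex x)).
pose c x := (t ^+ mm x)%g (bt x).
have cbs x : #|porbit s (bs x)| = #|porbit t (bt x)|.
  rewrite -Bb cB; have := bsP x; rewrite -eq_porbit_mem => /eqP ->.
  by [].
have cE x m : (s ^+ m)%g (bs x) = x -> c x = (t ^+ m)%g (bt x).
  move=> mx; apply/eqP; rewrite perm_pow_eq -cbs -perm_pow_eq mx.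
  exact/eqP/mmP.
have same x y : porbit s x = porbit s y -> bs x = bs y /\ bt x = bt y.
  move=> xy; have ixy : B x = B y by rewrite /B /i xy.
  rewrite /bs /bt ixy xy; split.
    exact: (baseP _ _ y (porbit_id s y)).2.
  have /imsetP[z _ E] := Bt y; have zB : z \in B y by rewrite E porbit_id.
  by rewrite (baseP _ x z zB).2 (baseP _ y z zB).2.
have sc x : c (s x) = t (c x).
  have E : porbit s (s x) = porbit s x by have := porbit_perm s 1 x;
    rewrite expg1.
  have [bsE btE] := same _ _ E.
  rewrite (cE (s x) (mm x).+1); last by rewrite bsE expgSr permM mmP.
  by rewrite btE expgSr permM.
have c_inj : injective c.
  move=> x y E; have pc z : porbit t (c z) = B z by rewrite porbit_perm -Bb.
  have : B x = B y by rewrite -!pc E.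
  move/eqP; rewrite nth_uniq // => /eqP ii.
  have xy : porbit s x = porbit s y.
    by rewrite -(nth_index set0 (xs x)) -/(i x) ii nth_index.
  have [bsE btE] := same _ _ xy; rewrite -(mmP x) -(mmP y) bsE; apply/eqP.
  by rewrite perm_pow_eq cbs -perm_pow_eq -{1}btE; apply/eqP.
exists (perm c_inj); apply/permP=> x; rewrite -(permKV (perm c_inj) x).
by rewrite permJ !permE sc.
Qed.

Lemma card_classes_leq : #|classes [set: 'S_r]| <= #|{: intpartn r}|.
Proof.
have ex s : exists mu : intpartn r, (mu : seq nat) == cycle_type s.
  by have [mu <-] := intpartn_exists (cycle_type_intpartn s); exists mu.
pose g s := xchoose (ex s); have gE s : g s = cycle_type s :> seq nat.
  exact/eqP/(xchooseP (ex s)).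
pose h mu := if [pick x | g x == mu] is Some x then (x ^: [set: 'S_r])%g else
  set0.
rewrite -[X in _ <= X]cardsT; apply: leq_trans (leq_imset_card h _).
apply/subset_leq_card/subsetP=> _ /imsetP[x _ ->].
apply/imsetP; exists (g x) => //; rewrite /h;
  case: pickP => [y /eqP gyx|/(_ x)].
  have [c ->] : exists c, x = (y ^ c)%g by apply: cycle_type_conj;
    rewrite -!gE gyx.
  by apply/class_eqP; rewrite memJ_class ?inE.
by rewrite eqxx.
Qed.

End CycleType.

End CycleTypes.

(** * Modules over symmetric groups *)

Lemma hom_mxE (F : fieldType) (U V : vectType F) (f : 'Hom(U, V)) u :
  f u = r2v (v2r u *m f2mx f).
Proof. by rewrite unlock. Qed.

Section MatrixReps.

Variables (F : fieldType) (r : nat).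
Hypothesis F0 : forall m, m.+1%:R != 0 :> F.

Notation G := [set: 'S_r]%G.

Lemma pchar_group : ([pchar F]^'.-group [set: 'S_r])%g.
Proof.
rewrite /pgroup pcharf'_nat; have := cardG_gt0 [set: 'S_r]%G.
by case: #|_| => // m _; apply: F0.
Qed.

Section OfModule.

Variables (V : opmod F 'S_r) (Vrep : is_rep V).

Definition rep_mx (s : 'S_r) : 'M[F]_(dim V) := f2mx (act V s).

Lemma mul_rep_mx (u : 'rV_(dim V)) s : u *m rep_mx s = v2r (act V s (r2v u)).
Proof. by rewrite hom_mxE !r2vK. Qed.

Lemma rep_mx_repr : mx_repr [set: 'S_r] rep_mx.
Proof.
have eqmx (A B : 'M[F]_(dim V)) : (forall u : 'rV_(dim V),
  u *m A = u *m B) -> A = B.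
  by move=> AB; apply/row_matrixP=> i; rewrite !rowE.
split=> [|s t _ _]; apply: eqmx => u.
  by rewrite mul_rep_mx (rep1 Vrep) r2vK mulmx1.
by rewrite mulmxA !mul_rep_mx v2rK -(repM Vrep).
Qed.

Definition mx_rep : mx_representation F G (dim V) :=
  MxRepresentation rep_mx_repr.

End OfModule.

Lemma rsim_hom (V W : opmod F 'S_r) (f : 'M_(dim V, dim W)) :
  (forall s, rep_mx V s *m f = f *m rep_mx W s) ->
  equivariant (Hom f : 'Hom(V, W)).
Proof.
move=> fE s v; rewrite !hom_mxE !r2vK -!mulmxA; congr r2v.
by rewrite -[f2mx (act V s)]/(rep_mx V s) fE.
Qed.

Lemma hom_injective (V W : vectType F) (f : 'M_(dim V, dim W)) :
  row_free f -> injective (Hom f : 'Hom(V, W)).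
Proof.
move=> fr u v; rewrite !hom_mxE => /(can_inj r2vK) /(row_free_inj fr).
exact: v2r_inj.
Qed.

(** The antisymmetrizer [K] maps everything into the line of the generator [e] and does not kill
    [e]. Given a submodule and a Maschke complement, one of them is therefore not killed by [K], so
    it contains [e] and is the whole module. *)
Lemma specht_irr mu : is_shape r mu
  -> mx_irreducible (mx_rep (specht_rep F r mu)).
Proof.
move=> muP; pose V := specht F r mu; pose e : V := poly_vec F mu (1%g : 'S_r).
have e_neq0 : e != 0.
  by apply: contraNneq (young_op_poly_vec F0 muP) => E; rewrite -/e E linear0.
pose K := f2mx (col_anti mu 1%g V).
have Kv u : u *m K = v2r (col_anti mu 1%g V (r2v u)) by rewrite hom_mxE !r2vK.
have full (U : 'M_(dim V)) : mxmodule (mx_rep (specht_rep F r mu)) U ->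
    (v2r e <= U)%MS -> row_full U.
  move=> /mxmoduleP modU eU; pose U' : {vspace V} := mx2vs U.
  have memU v : (v \in U') = (v2r v <= U)%MS.
    by transitivity (v2r v <= vs2mx U')%MS; [rewrite -genmxE | rewrite mx2vsK].
  have : U' = fullv.
    apply: poly_vec_gen; last by rewrite memU.
    move=> s v; rewrite !memU => vU; apply: submx_trans (modU s (in_setT s)).
    by rewrite hom_mxE r2vK; apply: submxMr.
  move/vspaceP=> UE; rewrite -sub1mx; apply/row_subP => i.
  by rewrite -[row _ _]r2vK -memU UE memvf.
have KU (U : 'M_(dim V)) (u : 'rV_(dim V)) :
  mxmodule (mx_rep (specht_rep F r mu)) U ->
    (u <= U)%MS -> (u *m K <= U)%MS.
  move=> /mxmoduleP modU uU; rewrite Kv col_antiE linear_sum summx_sub // =>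
    p _.
  rewrite linearZ scalemx_sub //=; have /= <- := mul_rep_mx (V := V) u p.
  by apply: submx_trans (modU p (in_setT p)); apply: submxMr.
have Ke (U : 'M_(dim V)) (u : 'rV_(dim V)) :
  mxmodule (mx_rep (specht_rep F r mu)) U ->
    (u <= U)%MS -> u *m K != 0 -> row_full U.
  move=> modU uU uK; apply: full => //; have := KU U u modU uU.
  move: uK; rewrite Kv; have /vlineP[c ->] :=
    col_anti_specht_line F0 (r2v u) muP.
  rewrite linearZ /= => c0 cU; have cn : c != 0.
    by apply: contraNneq c0 => ->; rewrite scale0r.
  by rewrite -[v2r e]scale1r -(mulVf cn) -scalerA scalemx_sub.
apply/mx_irrP; split=> [|U modU U0].
  rewrite lt0n; apply: contraNneq e_neq0 => d0; apply/eqP/v2r_inj.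
  by apply/rowP=> i; have := ltn_ord i; rewrite {2}d0.
have [W modW UW dxUW] := mx_Maschke_pchar (mx_rep (specht_rep F r mu))
  pchar_group modU (submx1 U).
have /sub_addsmxP[[u w] /= ueq] : (v2r e <= U + W)%MS by rewrite UW submx1.
have : v2r e *m K != 0.
  have c_neq0 := natr_card_neq0 F0 (col_stab1 mu (1%g : 'S_r)).
  apply: contraNneq e_neq0; rewrite Kv v2rK col_anti_poly_vec => /(congr1 r2v).
  by rewrite v2rK linear0 => /eqP; rewrite scaler_eq0 (negPf c_neq0).
rewrite ueq mulmxDl; have [uK0|uK0 _] := eqVneq (u *m U *m K) 0; last first.
  exact: Ke modU (submxMl _ _) uK0.
rewrite uK0 add0r => /(Ke _ _ modW (submxMl _ _)) Wfull.
case/eqP: U0; apply/eqP; rewrite -submx0 -(mxdirect_addsP dxUW) sub_capmx.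
by rewrite submx_refl submx_full.
Qed.

Lemma specht_rsim_eq mu nu : is_shape r mu -> is_shape r nu ->
  mx_rsim (mx_rep (specht_rep F r mu)) (mx_rep (specht_rep F r nu)) -> mu = nu.
Proof.
move=> muP nuP [f _ ffree fE]; pose g := Hom f : 'Hom(specht F r mu,
  specht F r nu).
have gE : equivariant g by apply: rsim_hom => s; apply: fE; rewrite inE.
have g_inj : injective g by apply: hom_injective.
apply: (young_op_eq0 F0 (v := g (poly_vec F mu (1%g : 'S_r))) muP nuP).
by rewrite -(young_op_nat gE) -[0](linear0 g) (inj_eq g_inj) young_op_poly_vec.
Qed.

End MatrixReps.

(** * Every irreducible module is a Specht module *)

Section ClosedField.

Variables (F : closedFieldType) (r : nat).
Hypothesis F0 : forall m, m.+1%:R != 0 :> F.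

Lemma intpartn_shape (mu : intpartn r) : is_shape r mu.
Proof. exact: (valP mu). Qed.

(** There are as many irreducibles as conjugacy classes, hence at most as many as partitions. The
    injection from partitions to irreducibles given by Specht modules is then onto, and it reaches
    any simple submodule of [V]. *)
Lemma rep_contains_specht (V : opmod F 'S_r) (v : V) : is_rep V -> v != 0 ->
  exists (mu : intpartn r) (f : 'Hom(specht F r mu, V)),
    injective f /\ equivariant f.
Proof.
move=> Vrep v0; pose G := [set: 'S_r]%G; pose rV := mx_rep Vrep.
have one_neq0 : 1%:M != 0 :> 'M[F]_(dim V).
  apply: contraNneq v0 => E; apply/eqP/v2r_inj.
  by rewrite -[v2r v]mulmx1 E mulmx0 linear0.
have [U simU _] := dec_mxsimple_exists (mxmodule1 rV) one_neq0.
have modU := mxsimple_module simU.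
have irrU : mx_irreducible (submod_repr modU) by apply/submod_mx_irr.
pose sG : irrType F G := DecSocleType (regular_repr F G).
pose rS mu := mx_rep (specht_rep F r mu).
have irrS (mu : intpartn r) : mx_irreducible (rS mu).
  by apply: specht_irr => //; apply: intpartn_shape.
have chG := pchar_group r F0.
pose idx (mu : intpartn r) := irr_comp sG (rS mu).
have idx_rsim (mu : intpartn r) := rsim_irr_comp_pchar sG chG (irrS mu).
have idx_inj : injective idx.
  move=> mu nu E; have rs : mx_rsim (rS mu) (rS nu).
    apply: mx_rsim_trans (idx_rsim mu) _; rewrite -/(idx mu) E.
    exact/mx_rsim_sym/idx_rsim.
  apply/val_inj/val_inj/(inj_map val_inj).
  exact: (specht_rsim_eq F0 (intpartn_shape mu) (intpartn_shape nu) rs).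
have card_le : (#|{: sG}| <= #|{: intpartn r}|)%N.
  rewrite (card_irr_pchar sG chG); last exact: group_closure_closed_field.
  exact: card_classes_leq.
have /codomP[mu muE] := inj_card_onto idx_inj card_le (irr_comp sG (submod_repr
  modU)).
have rs : mx_rsim (rS mu) (submod_repr modU).
  apply: mx_rsim_trans (idx_rsim mu) _; rewrite -/(idx mu) -muE.
  by apply/mx_rsim_sym/rsim_irr_comp_pchar.
case: rs => B _ Bfree BE; pose f := val_submod B.
exists mu, (Hom f); split.
  by apply: hom_injective; rewrite /row_free mxrankMfree ?row_base_free.
apply: rsim_hom => s; rewrite -[rep_mx V s]/(rV s) -val_submodJ ?inE //.
by rewrite -BE ?inE // val_submodE mulmxA -val_submodE.
Qed.

End ClosedField.

(** * Direct sums with multiplicities *)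

Section BigSums.

Variables (F : fieldType) (X : Type).
Implicit Types M N : opmod F X.

Lemma dsumCA M N P : iso (dsum M (dsum N P)) (dsum N (dsum M P)).
Proof.
apply: iso_trans (dsumA M N P) _; apply: iso_trans _ (iso_sym (dsumA N M P)).
by apply: iso_dsum; [apply: dsumC | apply: iso_refl].
Qed.

Lemma copiesD m p M : iso (copies (m + p) M) (dsum (copies m M) (copies p M)).
Proof.
elim: m => [|m IH]; first by apply: iso_sym; apply: dsum0l.
apply: iso_trans (dsumA M (copies m M) (copies p M)).
by apply: iso_dsum => //; apply: iso_refl.
Qed.

Notation bigsum s P m N :=
  (\big[@dsum F X/zero_mod F X]_(i <- s | P i) copies (m i) (N i)).

(** Used with [p = 1] to add one Specht module to a decomposition, and backwards to split off all
    copies of one. *)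
Lemma bigsum_add (I : eqType) (s : seq I) (m : I -> nat) (N : I
  -> opmod F X) j p :
  uniq s -> j \in s ->
  iso (dsum (copies p (N j)) (bigsum s xpredT m N))
      (bigsum s xpredT (fun i => (p * (i == j)) + m i)%N N).
Proof.
elim: s => //= i s IH /andP[si us]; rewrite inE !big_cons.
have [<-{IH}|ij] := eqVneq i j.
  move=> _; rewrite muln1; apply: iso_trans (dsumA _ _ _) _.
  apply: iso_dsum; first exact/iso_sym/copiesD.
  rewrite [X in iso _ X](eq_big_seq (fun i => copies (m i) (N i))).
    exact: iso_refl.
  move=> i' i's; case: eqP => [E|_]; last by rewrite muln0.
  by rewrite -E i's in si.
rewrite muln0 add0n /= => js.
apply: iso_trans (dsumCA _ _ _) _.
by apply: iso_dsum; [apply: iso_refl | apply: IH].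
Qed.

Lemma bigsum_pred (I : Type) (s : seq I) (P : pred I) (m : I -> nat) (N : I
  -> opmod F X) :
  (forall i, ~~ P i -> m i = 0%N) ->
  iso (bigsum s xpredT m N) (bigsum s P m N).
Proof.
move=> P0; elim: s => [|i s IH]; first by rewrite !big_nil; apply: iso_refl.
rewrite !big_cons; case: ifP => [_|/negbT/P0 ->].
  by apply: iso_dsum => //; apply: iso_refl.
exact: iso_trans (dsum0l _) IH.
Qed.

End BigSums.

Lemma dimv_img_inj (F : fieldType) (U V : vectType F) (f : 'Hom(U,
  V)) (W : {vspace U}) :
  injective f -> \dim (f @: W) = \dim W.
Proof. by move=> /lker0P/eqP f0; apply: limg_dim_eq; rewrite f0 capv0. Qed.

(** * The rank of a Young symmetrizer as a multiplicity *)

Section Rank.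

Variables (F : fieldType) (r : nat).
Implicit Types V W : opmod F 'S_r.

(** An isomorphism invariant, additive on direct sums and 1 or 0 on Specht modules; it makes the
    multiplicities of a decomposition unique. *)
Definition young_rank mu V := \dim (limg (young_op mu V)).

Lemma young_rank_iso mu V W : iso V W -> young_rank mu V = young_rank mu W.
Proof.
case=> f [g [fK gK fE]]; rewrite /young_rank.
have -> : limg (young_op mu W) = (f @: limg (young_op mu V))%VS.
  apply/eqP; rewrite eqEsubv; apply/andP; split; apply/subvP.
    move=> _ /memv_imgP[w _ ->]; rewrite -(gK w) -(young_op_nat fE).
    by rewrite !memv_img ?memvf.
  move=> _ /memv_imgP[_ /memv_imgP[v _ ->] ->]; rewrite (young_op_nat fE).
  by rewrite memv_img ?memvf.
by rewrite (dimv_img_inj _ (can_inj fK)).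
Qed.

Lemma young_rank_dsum mu V W :
  young_rank mu (dsum V W) = (young_rank mu V + young_rank mu W)%N.
Proof.
have [i1 i1E] := pair_hom (\1 : 'End(V))%VF (0 : 'Hom(V, W)).
have [i2 i2E] := pair_hom (0 : 'Hom(W, V)) (\1 : 'End(W))%VF.
have i1q : equivariant i1.
  by move=> x u; rewrite !i1E dsum_actE !zero_lfunE linear0 !id_lfunE.
have i2q : equivariant i2.
  by move=> x u; rewrite !i2E dsum_actE !zero_lfunE linear0 !id_lfunE.
have i1_inj : injective i1 by move=> u v; rewrite !i1E !id_lfunE => -[].
have i2_inj : injective i2 by move=> u v; rewrite !i2E !id_lfunE => -[].
have i12 u v : (u, v) = i1 u + i2 v.
  by rewrite i1E i2E !id_lfunE !zero_lfunE -[_ + _]/(u + 0, 0 + v) addr0 add0r.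
rewrite /young_rank -(dimv_img_inj _ i1_inj) -(dimv_img_inj _ i2_inj).
rewrite -dimv_disjoint_sum.
  congr (\dim _); apply/eqP; rewrite eqEsubv subv_add; apply/and3P; split.
  - apply/subvP=> _ /memv_imgP[[u v] _ ->];
    have -> : young_op mu (dsum V W) (u, v)
        = i1 (young_op mu V u) + i2 (young_op mu W v).
      by rewrite (young_op_nat i1q) (young_op_nat i2q) -linearD -i12.
    by rewrite memv_add ?memv_img ?memvf.
  - apply/subvP=> _ /memv_imgP[_ /memv_imgP[v _ ->] ->].
    by rewrite (young_op_nat i1q) memv_img ?memvf.
  - apply/subvP=> _ /memv_imgP[_ /memv_imgP[v _ ->] ->].
    by rewrite (young_op_nat i2q) memv_img ?memvf.
apply/eqP; rewrite -subv0; apply/subvP=> w; rewrite memv_cap => /andP[].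
move=> /memv_imgP[u _ ->] /memv_imgP[v _];
  rewrite i1E i2E !id_lfunE !zero_lfunE.
by case=> -> _; rewrite memv0.
Qed.

Lemma young_rank_zero mu : young_rank mu (zero_mod F 'S_r) = 0%N.
Proof.
apply/eqP; rewrite dimv_eq0 -subv0; apply/subvP=> v _; rewrite memv0.
by apply/eqP; apply: thinmx0.
Qed.

Lemma young_rank_copies mu m V : young_rank mu (copies m V)
  = (m * young_rank mu V)%N.
Proof.
elim: m => [|m IH]; first exact: young_rank_zero.
by rewrite mulSn -IH; apply: young_rank_dsum.
Qed.

Lemma young_rank_bigsum mu (I : Type) (s : seq I) (m : I -> nat) (N : I
  -> opmod F 'S_r) :
  young_rank mu (\big[@dsum F 'S_r/zero_mod F 'S_r]_(i <- s) copies (m i) (N i))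
    = (\sum_(i <- s) m i * young_rank mu (N i))%N.
Proof.
elim: s => [|i s IH]; first by rewrite !big_nil young_rank_zero.
by rewrite !big_cons young_rank_dsum young_rank_copies IH.
Qed.

Lemma young_rank_leq mu V : (young_rank mu V <= dim V)%N.
Proof. by rewrite -dimvf; apply/dimvS/subvf. Qed.

Hypothesis F0 : forall m, m.+1%:R != 0 :> F.

Lemma young_rank_specht (mu nu : intpartn r) :
  young_rank mu (specht F r nu) = (mu == nu).
Proof.
case: eqVneq => [<-|ne]; first exact: (young_op_rank F0 (intpartn_shape mu)).
apply/eqP; rewrite dimv_eq0 -subv0; apply/subvP=> _ /memv_imgP[v _ ->].
rewrite memv0; apply: contraR ne => yv; apply/eqP.
apply/val_inj/val_inj/(inj_map val_inj).
exact: (young_op_eq0 F0 (intpartn_shape mu) (intpartn_shape nu) yv).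
Qed.

End Rank.

(** * Maschke's theorem for modules given by operators *)

Section Averaging.

Variables (F : fieldType) (r : nat).
Hypothesis F0 : forall m, m.+1%:R != 0 :> F.
Variables (V W : opmod F 'S_r) (Vrep : is_rep V) (Wrep : is_rep W).

(** A linear retraction is averaged over the group. *)
Lemma equivariant_retraction (f : 'Hom(W, V)) : injective f -> equivariant f ->
  exists2 g : 'Hom(V, W), cancel f g & equivariant g.
Proof.
move=> f_inj fE; have /lker0_lfunK fK : lker f == 0%VS by apply/lker0P.
pose c : F := #|[set: 'S_r]|%:R.
have c0 : c != 0 by have := natr_card_neq0 F0 (in_setT (1%g : 'S_r)).
pose gs := \sum_(s : 'S_r) (act W s^-1%g \o f^-1 \o act V s)%VF.
have gsE v : gs v = \sum_(s : 'S_r) act W s^-1%g (f^-1%VF (act V s v)).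
  by rewrite sum_lfunE; apply: eq_bigr => s _; rewrite !comp_lfunE.
pose g := c^-1 *: gs; have gE v : g v = c^-1 *: gs v by rewrite scale_lfunE.
exists g => [w|t v].
  rewrite gE gsE (eq_bigr (fun=> w)) => [|s _].
    by rewrite sumr_const -cardsT -scaler_nat scalerA mulVf ?scale1r.
  by rewrite -fE fK -(repM Wrep) /pcomp mulgV (rep1 Wrep).
suff E : gs (act V t v) = act W t (gs v) by rewrite !gE E linearZ.
rewrite !gsE linear_sum (reindex_inj (mulgI t^-1%g)) /=; apply: eq_bigr => u _.
by rewrite -(repM Wrep) -(repM Vrep) /pcomp mulKVg invMg invgK.
Qed.

(** The complement is the kernel of [g], through $v=f(g(v))+(v-f(g(v)))$. *)
Lemma split_off (f : 'Hom(W, V)) (g : 'Hom(V, W)) : cancel f g ->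
  equivariant f -> equivariant g ->
  exists K : opmod F 'S_r, [/\ is_rep K,
    iso V (dsum W K) & dim V = (dim W + dim K)%N].
Proof.
move=> fK fE gE; pose U := lker g.
have actU s (k : subvs_of U) : act V s (vsval k) \in U.
  have := subvsP k; rewrite !memv_ker gE => /eqP ->.
  by rewrite linear0.
pose K := @Opmod F 'S_r (subvs_of U)
  (fun s => linfun (fun k : subvs_of U => vsproj U (act V s (vsval k)))).
have KE s (k : K) : vsval (act K s k) = act V s (vsval k).
  rewrite lin_lfunE ?vsprojK ?actU // => a k1 k2.
  by rewrite !linearP.
pose q := (\1 - (f \o g))%VF.
have qE v : q v = v - f (g v) by rewrite add_lfunE opp_lfunE comp_lfunE
  id_lfunE.
have [|h hE0] := @ex_lfun F V (dsum W K) (fun v => (g v, vsproj U (q v))).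
  by move=> a u v; rewrite !linearP.
have hE v : h v = (g v, vsproj U (v - f (g v))) by rewrite hE0 qE.
have [|h' h'E] := @ex_lfun F (dsum W K) V (fun u => f u.1 + vsval u.2).
  by move=> a u v; rewrite !linearP /= addrACA scalerDr.
have gU v : v - f (g v) \in U by rewrite memv_ker linearB /= fK subrr.
have hK : cancel h h' by move=> v; rewrite h'E hE /= vsprojK ?gU // addrC subrK.
have h'K : cancel h' h.
  move=> [w k]; rewrite hE h'E /=.
  have /eqP gk : g (vsval k) == 0 by rewrite -memv_ker; apply: subvsP.
  have -> : g (f w + vsval k) = w by rewrite linearD /= fK gk addr0.
  by rewrite [f w + _]addrC addrK vsvalK.
exists K; split.
- split=> [k|s t k]; apply: val_inj; rewrite /= ?KE.
    by rewrite (rep1 Vrep).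
  by rewrite (repM Vrep).
- exists h, h'; split=> // s v; rewrite !hE dsum_actE gE; congr (_, _).
  apply: val_inj; rewrite /= KE !vsprojK ?gU ?linearB /= ?fE //.
  by rewrite -fE -gE gU.
- have dK : dim K = \dim U by [].
  rewrite dK; have := limg_ker_dim g fullv; rewrite capfv dimvf addnC => <-.
  congr addn; rewrite -[RHS]dimvf; congr (\dim _); apply/vspaceP=> w.
  by rewrite memvf -[w]fK memv_img ?memvf.
Qed.

End Averaging.

(** * Decomposition into Specht modules *)

Section Decomposition.

Variables (F : closedFieldType) (r : nat).
Hypothesis F0 : forall m, m.+1%:R != 0 :> F.

Notation bigsum P m :=
  (\big[@dsum F 'S_r/zero_mod F 'S_r]_(mu : intpartn r | P mu)
     copies (m mu) (specht F r mu)).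

Lemma specht_decomposition (V : opmod F 'S_r) : is_rep V ->
  exists a : intpartn r -> nat, iso V (bigsum xpredT a).
Proof.
have [m] := ubnP (dim V); elim: m V => // m IH V Vm Vrep.
have [[v v0]|no] := pselect (exists v : V, v != 0); last first.
  exists (fun=> 0%N); apply: iso_trans (iso_zero _) _.
    by move=> u; apply/eqP/negPn/negP => u0; apply: no; exists u.
  elim/big_ind: _ => //; first exact: iso_refl.
    move=> M N M0 N0; apply: iso_trans (iso_sym (dsum0l _)) _.
    by apply: iso_dsum.
  by move=> mu _; apply: iso_refl.
have [mu [f [f_inj fE]]] := rep_contains_specht F0 Vrep v0.
have [g fK gE] := equivariant_retraction F0 Vrep (specht_rep F r mu) f_inj fE.
have [K [Krep VK dK]] := split_off Vrep fK fE gE.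
have S_gt0 : (0 < dim (specht F r mu))%N.
  by have := young_rank_leq mu (specht F r mu);
    rewrite young_rank_specht // eqxx.
have [|a aP] := IH K _ Krep.
  move: Vm; rewrite dK ltnS; apply: leq_trans.
  by rewrite -[X in (X < _)%N]add0n ltn_add2r.
exists (fun nu => (1 * (nu == mu)) + a nu)%N; apply: iso_trans VK _.
apply: iso_trans (bigsum_add a (fun nu : intpartn r => specht F r nu) 1
  (index_enum_uniq _) (mem_index_enum mu)).
apply: iso_dsum aP; apply: iso_trans (iso_sym (dsum0l _)) (dsumC _ _).
Qed.

Lemma bigsum_split (V : opmod F 'S_r) a (mu : intpartn r) :
  iso V (bigsum xpredT a) ->
  exists V', iso V (dsum (copies (a mu) (specht F r mu)) V').
Proof.
move=> Va; exists (bigsum xpredT (fun nu => if nu == mu then 0%N else a nu)).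
apply: iso_trans Va _.
apply: iso_trans (iso_sym (bigsum_add _ (fun nu : intpartn r => specht F r nu) _
  (index_enum_uniq _) (mem_index_enum mu))).
rewrite [X in iso _ X](eq_bigr (fun nu => copies (a nu) (specht F r nu))).
  exact: iso_refl.
by move=> nu _; case: eqP => [->|_]; rewrite ?muln1 ?addn0 // muln0.
Qed.

Lemma young_rank_mult (V : opmod F 'S_r) a (mu : intpartn r) :
  iso V (bigsum xpredT a) ->
  young_rank mu V = a mu.
Proof.
move=> Va; rewrite (young_rank_iso _ Va) young_rank_bigsum (bigD1 mu) //= big1.
  by rewrite addn0 young_rank_specht // eqxx muln1.
by move=> i ne; rewrite young_rank_specht // eq_sym (negPf ne) muln0.
Qed.

(** The rank bounds every candidate [m] by [a mu], and splitting the decomposition attains this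
    value, which is within the range of the maximum because a rank is at most [dim V]. *)
Lemma specht_multiplicity (V : opmod F 'S_r) a (mu : intpartn r) :
  iso V (bigsum xpredT a) ->
  multiplicity (specht F r mu) V = a mu.
Proof.
move=> Va; have rk := young_rank_mult mu Va; apply/eqP; rewrite eqn_leq;
  apply/andP; split.
  apply/bigmax_leqP => m /asboolP[V' /isomorphic_iso /(young_rank_iso mu)].
  rewrite rk young_rank_dsum young_rank_copies young_rank_specht // eqxx muln1
    => ->.
  exact: leq_addr.
have lt : (a mu < (dim V).+1)%N by rewrite ltnS -rk young_rank_leq.
have [V' VV'] := bigsum_split mu Va.
apply: (@leq_bigmax_cond _ _ (fun m : 'I_(dim V).+1 => m : nat) (Ordinal lt)).
by apply/asboolP; exists V'; apply: iso_isomorphic.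
Qed.

Lemma specht_occurs (V : opmod F 'S_r) a (mu : intpartn r) :
  iso V (bigsum xpredT a) ->
  ~ occurs (specht F r mu) V -> a mu = 0%N.
Proof.
move=> /(bigsum_split mu)[V']; case: (a mu) => // m VV' [].
exists (dsum (copies m (specht F r mu)) V'); apply: iso_isomorphic.
exact: iso_trans VV' (iso_sym (dsumA _ _ _)).
Qed.

Lemma specht_isotypic (V : opmod F 'S_r) : is_rep V ->
  iso V (bigsum (fun mu => `[< occurs (specht F r mu) V >])
    (fun mu => multiplicity (specht F r mu) V)).
Proof.
move=> Vrep; have [a Va] := specht_decomposition Vrep; apply: iso_trans (Va) _.
rewrite (eq_bigr (fun mu : intpartn r =>
  copies (multiplicity (specht F r mu) V) (specht F r mu))).
  apply: bigsum_pred => mu /asboolP occ.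
  by rewrite (specht_multiplicity mu Va) (specht_occurs Va occ).
by move=> mu _; rewrite (specht_multiplicity mu Va).
Qed.

End Decomposition.

(** * Layers of cell modules *)

Section Generators.

Variable F : fieldType.

(** Spanning, in the form in which it is applied. The index type may be infinite, such as all
    vectors of a space in [gen_id]. *)
Definition generates (V : vectType F) (I : Type) (f : I -> V) :=
  forall (P : vectType F) (h h' : 'Hom(V, P)),
    (forall i, h (f i) = h' (f i)) -> h = h'.

Lemma gen_basis (I : finType) : generates (@basis_vec F I).
Proof. by move=> P h h'; apply: ffun_hom_ext. Qed.

Lemma gen_id (V : vectType F) : generates (fun v : V => v).
Proof. by move=> P h h' E; apply/lfunP. Qed.

Lemma gen_bilinear (V W P : vectType F) (I J : Type) (f : I -> V) (g : J -> W)
    (b b' : V -> 'Hom(W, P)) : generates f -> generates g ->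
  linear b -> linear b' -> (forall i j, b (f i) (g j) = b' (f i) (g j)) ->
  forall v w, b v w = b' v w.
Proof.
move=> gf gg lb lb' E v w.
have [B BE] := ex_lfun lb; have [B' B'E] := ex_lfun lb'.
suff BB : B = B' by rewrite -BE BB B'E.
by apply: gf => i; rewrite BE B'E; apply: gg.
Qed.

Section TensorGen.

Variables (X : Type) (Y : finType) (M : bimod F X Y) (N : opmod F Y).
Variables (I J : Type) (f : I -> M) (g : J -> N).
Hypotheses (gf : generates f) (gg : generates g).

Lemma gen_tensp : generates (fun ij : I * J => tensp (f ij.1) (g ij.2)).
Proof.
move=> P h h' E; apply: tensor_ext => m v.
pose b (k : 'Hom(tensor M N, P)) (m : M) := (k \o tenspl N m)%VF.
have lb k : linear (b k).
  move=> a u w; apply/lfunP=> z; rewrite add_lfunE scale_lfunE !comp_lfunE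
    !tensplE.
  by rewrite tensp_linl linearP.
have bE k u z : b k u z = k (tensp u z) by rewrite comp_lfunE tensplE.
rewrite -!bE; apply: (gen_bilinear gf gg (lb h) (lb h')) => i j.
by rewrite !bE; apply: (E (i, j)).
Qed.

Lemma gen_balanced (P : vectType F) (b : M -> 'Hom(N, P)) : linear b ->
  (forall y i j, b (ract M y (f i)) (g j) = b (f i) (act N y (g j))) ->
  forall y m v, b (ract M y m) v = b m (act N y v).
Proof.
move=> lb E y m v; pose b' (m : M) := (b m \o act N y)%VF.
have -> : b m (act N y v) = b' m v by rewrite comp_lfunE.
apply: (gen_bilinear (b := fun m => b (ract M y m)) gf gg) => [a u w|a u w|i j].
- by rewrite linearP lb.
- by rewrite /b' lb comp_lfunDl comp_lfunZl.
- by rewrite E comp_lfunE.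
Qed.

End TensorGen.

End Generators.

(** * The Specht module of one row is trivial *)

Section TrivialSpecht.

Variables (F : fieldType) (l : nat).

Let sh := [:: l].

Lemma row_of_trivial (t : 'S_l) a : row_of sh t a = 0%N.
Proof.
have lt : (t^-1%g a < sumn sh)%N by rewrite /= addn0 ltn_ord.
by have := reshape_indexP lt; rewrite /row_of; case: (reshape_index _ _).
Qed.

Lemma col_of_trivial (t : 'S_l) a : col_of sh t a = t^-1%g a.
Proof.
have := row_of_trivial t a; rewrite /row_of /col_of /reshape_offset => ->.
by rewrite take0 subn0.
Qed.

(** The columns of a one-row tableau are single boxes, so its column group is trivial; all its
    fillings have the same tabloid. *)
Lemma polytabloid_trivial (t : 'S_l) : polytabloid F sh t
  = basis_vec F [set: 'S_l].
Proof.
have -> : polytabloid F sh t = basis_vec F (tabloid sh t).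
  rewrite /polytabloid (bigD1 1%g) ?col_stab1 //= big1 => [|p /andP[pC p1]].
    by rewrite odd_perm1 expr0 scale1r addr0 /pcomp mulg1.
  case/eqP: p1; apply/permP=> a; rewrite perm1.
  move/col_stabP/(_ a): pC; rewrite !col_of_trivial => /val_inj.
  exact: perm_inj.
congr (basis_vec F _); apply/setP=> s; rewrite [RHS]inE; apply/tabloidP => a.
by rewrite !row_of_trivial.
Qed.

Lemma specht_trivial : exists (w0 : specht F l sh) (tau : 'Hom(specht F l sh,
  F^o)),
  [/\ tau w0 = 1, forall w, w = (tau w : F) *: w0
    & forall s w, act (specht F l sh) s w = w].
Proof.
pose w0 := poly_vec F sh (1%g : 'S_l).
have w0E : specht_val F l sh w0 = basis_vec F [set: 'S_l].
  by rewrite specht_val_poly polytabloid_trivial.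
have [|tau tauE] := @ex_lfun F (specht F l sh) F^o
    (fun w => (specht_val F l sh w : {ffun {set 'S_l} -> F^o}) [set: 'S_l]).
  by move=> a u v; rewrite linearP !ffunE.
have wE w : w = (tau w : F) *: w0.
  have : specht_val F l sh w \in <[basis_vec F [set: 'S_l] :
    tabloid_mod F l]>%VS.
    apply: (subvP _ _ (specht_val_mem w)); apply/span_subvP=> _ /imageP[t _ ->].
    by rewrite polytabloid_trivial memv_line.
  case/vlineP=> c wc; apply: (@specht_val_inj F l sh).
  rewrite linearZ /= tauE w0E wc; congr (_ *: _).
  by rewrite !ffunE eqxx [RHS]mulr1.
exists w0, tau; split=> //.
  by rewrite tauE w0E ffunE eqxx.
move=> s w; rewrite (wE w) linearZ /=; congr (_ *: _).
apply: (@specht_val_inj F l sh).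
rewrite (specht_val_act s w0) specht_val_poly polytabloid_act
  !polytabloid_trivial.
by [].
Qed.

End TrivialSpecht.

(** * Modules induced from a Young subgroup *)

Section Induced.

Variables (F : fieldType) (k l : nat).

Notation GB := (group_bimod F k l).

Definition group_vec (t : 'S_(k + l)) : GB := basis_vec F t.

Lemma gen_group : generates group_vec.
Proof. exact: gen_basis. Qed.

Lemma group_lact s t : lact GB s (group_vec t) = group_vec (pcomp s t).
Proof. exact: lin_ext_basis. Qed.

Lemma group_ract p t : ract GB p (group_vec t)
  = group_vec (pcomp t (young_emb p)).
Proof. exact: lin_ext_basis. Qed.

Lemma group_com s p (m : GB) : lact GB s (ract GB p m)
  = ract GB p (lact GB s m).
Proof.
suff E : (lact GB s \o ract GB p = ract GB p \o lact GB s)%VF.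
  by move/lfunP/(_ m): E; rewrite !comp_lfunE.
apply: gen_group => t; rewrite !comp_lfunE.
apply: (etrans (congr1 (lact GB s) (group_ract p t))).
apply: (etrans (group_lact _ _)); apply/esym.
apply: (etrans (congr1 (ract GB p) (group_lact s t))).
by apply: (etrans (group_ract _ _)); rewrite /pcomp mulgA.
Qed.

Variables (M : opmod F 'S_k) (N : opmod F 'S_l).

Lemma ind_actE s (g : GB) (z : outer_tensor M N) :
  act (young_ind M N) s (tensp g z) = tensp (lact GB s g) z.
Proof. by apply: tensor_actE => p m; apply: group_com. Qed.

Lemma ind_rep : is_rep (young_ind M N).
Proof.
have gen := gen_tensp gen_group (@gen_id F (outer_tensor M N)).
have act1 : act (young_ind M N) 1%g = \1%VF.
  apply: gen => -[t z]; apply: (etrans (ind_actE _ _ _)).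
  by rewrite group_lact /pcomp mulg1 id_lfunE.
have actM s t : act (young_ind M N) (pcomp s t)
    = (act (young_ind M N) s \o act (young_ind M N) t)%VF.
  apply: gen => -[u z]; apply: (etrans (ind_actE _ _ _)).
  apply: (etrans _ (esym (comp_lfunE _ _ _))).
  apply: (etrans _ (congr1 (act _ s) (esym (ind_actE _ _ _)))).
  apply: (etrans _ (esym (ind_actE _ _ _))).
  by rewrite !group_lact /pcomp mulgA.
by split=> [v|s t v]; rewrite ?act1 ?actM ?id_lfunE ?comp_lfunE.
Qed.

Lemma outer_actE (p : 'S_k * 'S_l) (v : M) (w : N) :
  act (outer_tensor M N) p (pure_tens v w)
    = pure_tens (act M p.1 v) (act N p.2 w).
Proof. exact: tens_endE. Qed.

End Induced.

(** * The actions on basis diagrams of a cell *)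

Section CellAction.

Variables (F : fieldType) (delta delta' : F) (n k : nat) (S : {set diagram n}).

Notation basis := {d : diagram n | d \in S}.

Lemma cell_lactE b (d e : basis) : val e = comp_diagram b (val d) ->
  cell_lact delta delta' S b (basis_vec F d)
    = comp_coef b (val d) delta delta' *: basis_vec F e.
Proof. by move=> E; rewrite /cell_lact lin_ext_basis -E valK. Qed.

Lemma cell_lact0 b (d : basis) :
  comp_diagram b (val d) \notin S \/ comp_coef b (val d) delta delta' = 0 ->
  cell_lact delta delta' S b (basis_vec F d) = 0.
Proof.
rewrite /cell_lact lin_ext_basis => -[nS|->]; first by rewrite insubN.
by case: insubP => // *; rewrite scale0r.
Qed.

Lemma cell_ractE (s : 'S_k) (d e : basis) : val e = right_act s (val d) ->
  cell_ract F S s (basis_vec F d) = basis_vec F e.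
Proof. by move=> E; rewrite /cell_ract lin_ext_basis -E valK. Qed.

Lemma mem_cell_filt m (d : basis) : (m <= #|upper_singletons (val d)|)%N ->
  basis_vec F d \in cell_filt F S m.
Proof. by move=> md; apply/memv_span/image_f. Qed.

Lemma cell_filt_sub m (V : {vspace {ffun basis -> F^o}}) :
  (forall d : basis, (m <= #|upper_singletons (val d)|)%N
    -> basis_vec F d \in V) ->
  (cell_filt F S m <= V)%VS.
Proof. by move=> H; apply/span_subvP=> _ /imageP[d dm ->]; apply: H. Qed.

End CellAction.

Section Parity.

Variables (n k : nat) (L : {set diagram n}) (d0 : diagram n) (t : 'I_k -> 'I_n).
Hypothesis frL : is_frame L d0 t.

(** The upper vertices that lie on arcs are even in number; the others are the [k] left ends of
    propagating lines and the singletons. *)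
Lemma odd_singletons d : d \in L -> odd n = odd (k + #|upper_singletons d|).
Proof.
move=> dL; have [hp hl hi] := half_valid frL dL.
pose f i := if half t d i is inl j then j else i.
have fK : involutive f.
  move=> i; rewrite /f; case E: (half t d i) => [j|m]; last by rewrite E.
  by rewrite (hp _ _ E).
pose K := [set i | f i != i].
have evK : ~~ odd #|K|.
  apply: (invol_card_even fK) => i; rewrite !inE //.
  by rewrite fK eq_sym.
pose P := [set i | if half t d i is inr _ then true else false].
have cP : #|P| = k.
  have hb m : exists i, half t d i == inr m by have [i <-] := hl m; exists i.
  pose g m := xchoose (hb m); have gP m : half t d (g m) = inr m.
    exact: (eqP (xchooseP (hb m))).
  have g_inj : injective g by move=> m m' E; have := gP m; rewrite E gP => -[].
  rewrite -[RHS]card_ord -(card_codom g_inj); apply: eq_card => i; rewrite inE.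
  apply/idP/codomP => [|[m ->]]; last by rewrite gP.
  case E: (half t d i) => [//|m] _; exists m; exact: hi E (gP m).
have KE : ~: K = P :|: upper_singletons d.
  apply/setP=> i; rewrite in_setU (upper_single_half frL) // !inE negbK /f.
  by case: (half t d i) => [j|m]; rewrite ?eqxx.
have dis : P :&: upper_singletons d = set0.
  apply/setP=> i; rewrite in_setI in_set0 (upper_single_half frL) // inE.
  by case: (half t d i).
rewrite -[n in LHS]card_ord -(cardC (mem K)) -[#|[predC _]|]/(#|[predC K]|).
have -> : #|[predC K]| = #|~: K| by apply: eq_card => i; rewrite !inE.
by rewrite KE cardsU dis cards0 subn0 cP oddD (negPf evK).
Qed.

End Parity.

(** * Comparison of a layer with the Brauer cell module *)

Section Cells.

Variables (F : fieldType) (delta : F) (n k l : nat).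
Variables (L Lb : {set diagram n}) (d0 e0 : diagram n).
Variables (t : 'I_k -> 'I_n) (q : 'I_(k + l) -> 'I_n).
Hypotheses (frL : is_frame L d0 t) (frLb : is_frame Lb e0 q).

Notation BE := (Lb :&: brauer_set n).
Notation BS := {d : diagram n | d \in L}.
Notation BB := {d : diagram n | d \in BE}.

Hypotheses (BE0 : BE != set0) (l_odd : odd n = odd (k + l)).

Notation CB := (cell_bimod delta 0 (k + l) BE (@brauer_val n)).
Notation Layer := (cell_layer delta 0 k L l).

Let BE_L (e : BB) : val e \in Lb.
Proof. by have := valP e; rewrite inE => /andP[]. Qed.

Let b_brauer (b : brauer n) : is_brauer (brauer_val b). Proof. exact: (valP b).
  Qed.

Definition brauer_vec (e : BB) : CB := basis_vec F e.

Lemma gen_brauer : generates brauer_vec. Proof. exact: gen_basis. Qed.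

Definition brauer_act (s : 'S_(k + l)) (e : BB) : BB :=
  exist _ (right_act s (val e)) (brauer_right_act frLb s (valP e)).

Lemma brauer_ract s e : ract CB s (brauer_vec e) = brauer_vec (brauer_act s e).
Proof. exact: cell_ractE. Qed.

Lemma good_brauer_act b s e : good b (val (brauer_act s e)) = good b (val e).
Proof.
rewrite -[val (brauer_act s e)]/(right_act s (val e)).
by rewrite /good /core (upper_mate_act frLb s (BE_L e)).
Qed.

Lemma loops_brauer_act b s e :
  core_loops b (val (brauer_act s e)) = core_loops b (val e).
Proof.
rewrite -[val (brauer_act s e)]/(right_act s (val e)).
by rewrite /core_loops /core_comp /core (upper_mate_act frLb s (BE_L e)).
Qed.

Lemma brauer_comp_exists (b : brauer n) (e : BB) :
  good (brauer_val b) (val e) ->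
  exists e' : BB, val e' = comp_diagram (brauer_val b) (val e).
Proof. by move=> g; exists (exist (fun d =>
  is_true (d \in BE)) _ (brauer_comp frLb (b_brauer b) (valP e) g)). Qed.

Lemma brauer_lact (b : brauer n) (e e' : BB) : good (brauer_val b) (val e) ->
  val e' = comp_diagram (brauer_val b) (val e) ->
  lact CB b (brauer_vec e)
    = delta ^+ #|core_loops (brauer_val b) (val e)| *: brauer_vec e'.
Proof.
move=> g E; rewrite -(good_coef (b_brauer b) delta g).
exact: cell_lactE.
Qed.

Lemma brauer_lact0 (b : brauer n) (e : BB) : ~~ good (brauer_val b) (val e) ->
  lact CB b (brauer_vec e) = 0.
Proof.
move=> ng; apply: cell_lact0.
have [cL|c0] := bad_cell frLb (b_brauer b) (BE_L e) delta ng; last by right.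
by left; rewrite inE negb_and cL.
Qed.

Lemma brauer_com (b : brauer n) s (m : CB) :
  lact CB b (ract CB s m) = ract CB s (lact CB b m).
Proof.
rewrite -!comp_lfunE; congr (fun_of_lfun _ m); apply: gen_brauer => e.
rewrite !comp_lfunE brauer_ract;
  have [g|ng] := boolP (good (brauer_val b) (val e)).
  have [e' e'E] := brauer_comp_exists g.
  have gs : good (brauer_val b) (val (brauer_act s e)) by rewrite
    good_brauer_act.
  have es : val (brauer_act s e')
    = comp_diagram (brauer_val b) (val (brauer_act s e)).
    have E := right_act_comp frLb s (b_brauer b) (BE_L e) g.
    by rewrite [LHS]/= e'E -E.
  apply: (etrans (brauer_lact gs es)).
  apply: (etrans _ (congr1 (ract CB s) (esym (brauer_lact g e'E)))).
  rewrite loops_brauer_act; apply: (etrans _ (esym (linearZ _ _))).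
  by congr (_ *: _); apply/esym/brauer_ract.
have ngs : ~~ good (brauer_val b) (val (brauer_act s e)) by rewrite
  good_brauer_act.
apply: (etrans (brauer_lact0 ngs)).
apply: (etrans _ (congr1 (ract CB s) (esym (brauer_lact0 ng)))).
exact/esym/linear0.
Qed.

(** Products in the bad case vanish, and those in the good case keep at least as many singletons by
    [comp_singletons]. *)
Lemma filt_lact b m : is_brauer b ->
  (cell_lact delta 0 L b @: cell_filt F L m <= cell_filt F L m)%VS.
Proof.
move=> bb; rewrite limg_span; apply/span_subvP=> _ /mapP[_ /imageP[d dm ->] ->].
have [g|ng] := boolP (good b (val d)).
  have cL := good_cell frL bb (valP d) g.
  rewrite (cell_lactE delta 0 (e := exist (fun d =>
    is_true (d \in L)) _ cL)) // memvZ // mem_cell_filt //=.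
  apply: leq_trans dm _; exact: (comp_singletons frL bb (valP d) g).
by rewrite cell_lact0 ?mem0v //; apply: (bad_cell frL bb (valP d) delta ng).
Qed.

Lemma right_act_singletons (a : 'S_k) d : d \in L ->
  upper_singletons (right_act a d) = upper_singletons d.
Proof.
move=> dL; apply/setP=> i; rewrite !(upper_single_half frL) ?(right_act_cell
  frL) //.
by rewrite (half_act frL) //; case: (half t d i).
Qed.

Lemma filt_ract (a : 'S_k) m :
  (cell_ract F L a @: cell_filt F L m <= cell_filt F L m)%VS.
Proof.
rewrite limg_span; apply/span_subvP=> _ /mapP[_ /imageP[d dm ->] ->].
have cL := right_act_cell frL a (valP d).
rewrite (cell_ractE F (e := exist (fun d =>
  is_true (d \in L)) _ cL)) // mem_cell_filt //=.
by rewrite right_act_singletons ?(valP d).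
Qed.

Lemma filt_le : (cell_filt F L l.+2 <= cell_filt F L l)%VS.
Proof.
apply: cell_filt_sub => d dm; apply: mem_cell_filt.
by apply: leq_trans dm; rewrite -addn2 leq_addr.
Qed.

Definition forget_elt (e : BB) : BS :=
  exist _ (forget_labels L d0 t q (val e)) (forget_labels_cell frL frLb (valP
    e)).

Lemma forget_elt_sing e : #|upper_singletons (val (forget_elt e))| = l.
Proof. exact: (forget_singletons frL frLb (valP e)). Qed.

Let forget_mem e : basis_vec F (forget_elt e) \in cell_filt F L l.
Proof. by apply: mem_cell_filt; rewrite forget_elt_sing. Qed.

(** Vectors of the layer are indexed by Brauer diagrams, with repetitions along $S_l$-orbits, so
    that both sides of the comparison share an index set. *)
Definition layer_vec (e : BB) : Layer :=
  subquot_proj (cell_filt F L l) (cell_filt F L l.+2) (basis_vec F (forget_elt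
    e)).

Lemma layer_ract (p : 'S_k * 'S_l) e :
  ract Layer p.1 (layer_vec e) = layer_vec (brauer_act (young_emb p) e).
Proof.
rewrite [LHS](subquot_endE filt_le) ?filt_ract ?forget_mem //.
rewrite (cell_ractE F (e := forget_elt (brauer_act (young_emb p) e))) //.
exact: (forget_act frL frLb p (valP e)).
Qed.

Lemma good_forget b e : good b (val (forget_elt e)) = good b (val e).
Proof.
rewrite -[val (forget_elt e)]/(forget_labels L d0 t q (val e)).
by rewrite /good /core (forget_upper_mate frL frLb (valP e)).
Qed.

Lemma loops_forget b e : core_loops b (val (forget_elt e))
  = core_loops b (val e).
Proof.
rewrite -[val (forget_elt e)]/(forget_labels L d0 t q (val e)).
by rewrite /core_loops /core_comp /core (forget_upper_mate frL frLb (valP e)).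
Qed.

(** The structure constants agree with those of [brauer_lact], which is the heart of the
    comparison. *)
Lemma layer_lact (b : brauer n) (e e' : BB) : good (brauer_val b) (val e) ->
  val e' = comp_diagram (brauer_val b) (val e) ->
  lact Layer (brauer_val b) (layer_vec e)
    = delta ^+ #|core_loops (brauer_val b) (val e)| *: layer_vec e'.
Proof.
move=> g E; rewrite [LHS](subquot_endE filt_le) ?filt_lact ?forget_mem ?b_brauer
  //.
have gD : good (brauer_val b) (val (forget_elt e)) by rewrite good_forget.
rewrite (cell_lactE delta 0 (e := forget_elt e')); last first.
  by rewrite /= E (forget_comp frL frLb (b_brauer b) (valP e) g).
by rewrite (good_coef (b_brauer b) delta gD) loops_forget linearZ.
Qed.

Lemma layer_lact0 (b : brauer n) (e : BB) : ~~ good (brauer_val b) (val e) ->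
  lact Layer (brauer_val b) (layer_vec e) = 0.
Proof.
move=> ng; rewrite [LHS](subquot_endE filt_le) ?filt_lact ?forget_mem ?b_brauer
  //.
rewrite cell_lact0 ?linear0 //; apply: (bad_cell frL (b_brauer b) (valP _)).
by rewrite good_forget.
Qed.

Lemma forget_elt_surj (d : BS) : #|upper_singletons (val d)| = l ->
  exists e, forget_elt e = d.
Proof.
move=> dl; have [e eB eD] := forget_labels_surj frL frLb BE0 (valP d) dl.
by exists (exist (fun d => is_true (d \in BE)) e eB); apply: val_inj.
Qed.

(** Diagrams with exactly [l] singletons come from Brauer diagrams, [l + 1] singletons are excluded
    by parity, and diagrams with more vanish in the quotient. *)
Lemma gen_layer : generates layer_vec.
Proof.
move=> P h h' E; pose pr := linfun (@subquot_proj F _ (cell_filt F L l)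
  (cell_filt F L l.+2)).
have sub : (cell_filt F L l <= lker ((h \o pr)%VF - (h' \o pr)%VF))%VS.
  apply: cell_filt_sub => d; rewrite leq_eqVlt => /orP[/eqP dl|].
    apply/eqlfunP; rewrite !comp_lfunE !lfunE /=.
    by have [e <-] := forget_elt_surj (esym dl); apply: E.
  rewrite leq_eqVlt => /orP[/eqP dl|dl].
    have := odd_singletons frL (valP d); rewrite -dl addnS /= l_odd.
    by case: (odd _).
  have d2 := mem_cell_filt F dl; apply/eqlfunP; rewrite !comp_lfunE !lfunE /=.
  have dU := subvP filt_le _ d2.
  have /eqP -> : subquot_proj (cell_filt F L l) (cell_filt F L l.+2) (basis_vec
    F d) == 0.
    by rewrite subquot_proj_eq0 ?filt_le.
  by rewrite !linear0.
apply/lfunP=> x; rewrite -(subquot_proj_val x).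
have xU : vsval x \in cell_filt F L l by apply: (subvP (diffvSl _ _));
  apply: subvsP.
by have /eqlfunP := subvP sub _ xU; rewrite !comp_lfunE !lfunE.
Qed.

Lemma layer_com (b : brauer n) (a : 'S_k) (m : Layer) :
  lact Layer (brauer_val b) (ract Layer a m)
    = ract Layer a (lact Layer (brauer_val b) m).
Proof.
rewrite -!comp_lfunE; congr (fun_of_lfun _ m); apply: gen_layer => e.
(* The action of $S_k$ on the layer is lifted to Brauer diagrams through the Young subgroup. *)
pose p : 'S_k * 'S_l := (a, 1%g); rewrite !comp_lfunE -[a]/p.1 layer_ract.
have [g|ng] := boolP (good (brauer_val b) (val e)).
  have [e' e'E] := brauer_comp_exists g.
  have gs : good (brauer_val b) (val (brauer_act (young_emb p) e)).
    by rewrite good_brauer_act.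
  have es : val (brauer_act (young_emb p) e')
      = comp_diagram (brauer_val b) (val (brauer_act (young_emb p) e)).
    have E := right_act_comp frLb (young_emb p) (b_brauer b) (BE_L e) g.
    by rewrite [LHS]/= e'E -E.
  apply: (etrans (layer_lact gs es)).
  apply: (etrans _ (congr1 (ract Layer p.1) (esym (layer_lact g e'E)))).
  rewrite loops_brauer_act; apply: (etrans _ (esym (linearZ _ _))).
  by congr (_ *: _); apply/esym/layer_ract.
have ngs : ~~ good (brauer_val b) (val (brauer_act (young_emb p) e)).
  by rewrite good_brauer_act.
apply: (etrans (layer_lact0 ngs)).
apply: (etrans _ (congr1 (ract Layer p.1) (esym (layer_lact0 ng)))).
exact/esym/linear0.
Qed.

Lemma forget_elt_fiber e e' : forget_elt e = forget_elt e' ->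
  exists c : 'S_l, e' = brauer_act (young_emb (1%g : 'S_k, c)) e.
Proof.
move=> /(congr1 val) /= E; have [c cE] :=
  forget_fiber frL frLb (valP e) (valP e') E.
by exists c; apply: val_inj.
Qed.

Lemma brauer_actM s s' e : brauer_act (pcomp s s') e
  = brauer_act s' (brauer_act s e).
Proof. by apply: val_inj; apply: (right_act_pcomp frLb s s' (BE_L e)). Qed.

Lemma brauer_act1 e : brauer_act 1%g e = e.
Proof. by apply: val_inj; apply: (right_act1 frLb (BE_L e)). Qed.

End Cells.

Section TenspScale.

Variables (F : fieldType) (X : Type) (Y : finType).
Variables (M : bimod F X Y) (N : opmod F Y).

Lemma tenspZl a (m : M) (v : N) : tensp (a *: m) v = a *: tensp m v.
Proof. by have [h hE] := ex_lfun (@tensp_linl F X Y M N v);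
  rewrite -!hE linearZ. Qed.

Lemma tensp0l (v : N) : tensp (0 : M) v = 0.
Proof. by rewrite -[0](scale0r (0 : M)) tenspZl scale0r. Qed.

End TenspScale.

(** * The layer as a tensor product with the induced module *)

Section LayerInduced.

Variables (F : fieldType) (delta : F) (n k l : nat).
Variables (L Lb : {set diagram n}) (d0 e0 : diagram n).
Variables (t : 'I_k -> 'I_n) (q : 'I_(k + l) -> 'I_n).
Hypotheses (frL : is_frame L d0 t) (frLb : is_frame Lb e0 q).

Notation BE := (Lb :&: brauer_set n).
Notation BS := {d : diagram n | d \in L}.
Notation BB := {d : diagram n | d \in BE}.

Hypotheses (BE0 : BE != set0) (l_odd : odd n = odd (k + l)).

Notation CB := (cell_bimod delta 0 (k + l) BE (@brauer_val n)).
Notation Layer := (cell_layer delta 0 k L l).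

Variables (S : opmod F 'S_k) (Srep : is_rep S).

Notation T := (specht F l [:: l]).
Notation O := (outer_tensor S T).
Notation Ind := (young_ind S T).
Notation GB := (group_bimod F k l).
Notation bvec := (brauer_vec delta k l (Lb := Lb)).
Notation lvec := (layer_vec delta frL frLb).
Notation bact := (brauer_act frLb).

(* The second factor is the trivial module, so that the outer tensor product  *)
(* is [S] with the action of the first factor.                                *)
Lemma outer_trivial : exists (i : 'Hom(S, O)) (c : 'Hom(O, S)),
  [/\ cancel i c, cancel c i
    & forall p v, act O p (i v) = i (act S p.1 v)].
Proof.
have [w0 [tau [tau1 tauE actT]]] := specht_trivial F l.
have [|i iE] := @ex_lfun F S O (fun v => pure_tens v w0).
  exact: pure_tens_linl.
pose b (v : S) : 'Hom(T, S) := linfun (fun w => (tau w : F) *: v).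
have bE v w : b v w = (tau w : F) *: v.
  by rewrite lin_lfunE // => a u1 u2; rewrite linearP scalerDl scalerA.
have lb : linear b.
  move=> a u v; apply/lfunP=> w; rewrite add_lfunE scale_lfunE !bE.
  by rewrite scalerDr !scalerA mulrC.
pose c : 'Hom(O, S) := tens_lift b.
have cE v w : c (pure_tens v w) = (tau w : F) *: v by rewrite [LHS]tens_liftE.
have ic : (i \o c = \1 :> 'End(O))%VF.
  apply: tens_ext => v w; rewrite comp_lfunE cE id_lfunE linearZ /= iE.
  rewrite [in RHS](tauE w); pose f := linfun (pure_tens v : T -> O).
  have fE u : f u = pure_tens v u by rewrite lin_lfunE //;
    apply: pure_tens_linr.
  by rewrite -!fE linearZ.
exists i, c; split=> [v|z|p v].
- by rewrite iE cE tau1 scale1r.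
- by rewrite -comp_lfunE ic id_lfunE.
- by rewrite !iE outer_actE actT.
Qed.

Notation TL := (tensor Layer S).
Notation TC := (tensor CB Ind).

(** The universal property of induction; [gam s] prescribes the map on the translate by [s]. *)
Lemma ind_lift (P : vectType F) (gam : 'S_(k + l) -> 'Hom(O, P)) :
  (forall p s z, gam (pcomp s (young_emb p)) z = gam s (act O p z)) ->
  exists psi : 'Hom(Ind, P), forall s z,
    psi (tensp (group_vec F s) z) = gam s z.
Proof.
move=> gamY; have [b lb bE] : exists2 b : GB -> 'Hom(O, P),
    linear b & forall s, b (group_vec F s) = gam s.
  exists (fun g => lin_ext gam g) => [a x y|s]; first by rewrite linearP.
  exact: lin_ext_basis.
have bal : forall p g z, b (ract GB p g) z = b g (act O p z).
  apply: (gen_balanced (@gen_group F k l) (@gen_id F O) lb) => p s z.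
  apply: (etrans (congr1 (fun g => b g z) (group_ract F p s))).
  by rewrite !bE gamY.
exists (tensor_lift b) => s z.
by apply: (etrans (tensor_liftE _ _ lb bal)); rewrite bE.
Qed.

Lemma gen_ind : generates (fun sz : 'S_(k + l) * O =>
  tensp (group_vec F sz.1) sz.2 : Ind).
Proof. exact: (gen_tensp (@gen_group F k l) (@gen_id F O)). Qed.

Lemma brauer_lift (P : vectType F) (psi : BB -> 'Hom(Ind, P)) :
  (forall s e u z, psi (bact s e) (tensp (group_vec F u) z)
    = psi e (tensp (group_vec F (pcomp s u)) z)) ->
  exists Psi : 'Hom(TC, P), forall e x, Psi (tensp (bvec e) x) = psi e x.
Proof.
move=> psiY; have [b lb bE] : exists2 b : CB -> 'Hom(Ind, P),
    linear b & forall e, b (bvec e) = psi e.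
  exists (fun m => lin_ext psi m) => [a x y|e]; first by rewrite linearP.
  exact: lin_ext_basis.
have bal : forall s (m : CB) x, b (ract CB s m) x = b m (act Ind s x).
  apply: (gen_balanced (@gen_brauer F delta n k l Lb) gen_ind lb) => s e [u z].
  have E : act Ind s (tensp (group_vec F u) z)
    = tensp (group_vec F (pcomp s u)) z.
    by rewrite ind_actE group_lact.
  apply: (etrans (congr1 (fun m => b m _) (brauer_ract delta frLb s e))).
  apply: (etrans _ (congr1 (b (bvec e)) (esym E))).
  have bv e1 x : b (bvec e1) x = psi e1 x by rewrite bE.
  by apply: (etrans (bv _ _)); apply: (etrans (psiY _ _ _ _)); apply/esym/bv.
exists (tensor_lift b) => e x.
by apply: (etrans (tensor_liftE _ _ lb bal)); rewrite bE.
Qed.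

(** The condition at $p=(1,c)$ makes [up] constant on the fibres of [forget_elt], and the condition
    at $p=(a,1)$ makes the resulting map balanced over $S_k$. *)
Lemma layer_lift (P : vectType F) (up : BB -> 'Hom(S, P)) :
  (forall p e v, up (bact (young_emb p) e) v = up e (act S p.1 v)) ->
  exists Phi : 'Hom(TL, P), forall e v, Phi (tensp (lvec e) v) = up e v.
Proof.
(* Diagrams outside the image of [forget_elt] get the value 0. Those with at least [l + 2]
   singletons are among them, so the map descends to the quotient. *)
move=> upY; pose phi (d : BS) : 'Hom(S, P) :=
  if [pick e | forget_elt frL frLb e == d] is Some e then up e else 0.
have phiE e : phi (forget_elt frL frLb e) = up e.
  rewrite /phi; case: pickP => [e' /eqP /esym ee|/(_ e)]; last by rewrite eqxx.
  have [s ->] := forget_elt_fiber ee; apply/lfunP=> v.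
  by apply: (etrans (upY _ _ _)); congr fun_of_lfun; apply: (rep1 Srep).
have [b lb bE] : exists2 b : Layer -> 'Hom(S, P),
    linear b & forall e, b (lvec e) = up e.
  exists (fun x => lin_ext phi (vsval x)) => [a x y|e];
    first by rewrite !linearP.
  rewrite subquot_val_hom ?filt_le ?mem_cell_filt ?forget_elt_sing //.
    by rewrite lin_ext_basis phiE.
  apply: cell_filt_sub => d dl; rewrite memv_ker lin_ext_basis /phi.
  case: pickP => [e' /eqP ed|]; last by rewrite eqxx.
  have := forget_elt_sing frL frLb e'; rewrite ed => sd.
  by move: dl; rewrite sd ltnNge leqnSn.
have bal : forall a (x : Layer) v, b (ract Layer a x) v = b x (act S a v).
  apply: (gen_balanced (gen_layer (delta := delta) (frL := frL) (frLb :=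
    frLb) BE0 l_odd)
    (@gen_id F S) lb) => a e v.
  pose p : 'S_k * 'S_l := (a, 1%g).
  apply: (etrans (congr1 (fun x => b x v) (layer_ract delta frL frLb p e))).
  have bv e1 x : b (lvec e1) x = up e1 x by rewrite bE.
  by apply: (etrans (bv _ _)); apply: (etrans (upY _ _ _)); apply/esym/bv.
exists (tensor_lift b) => e v.
by apply: (etrans (tensor_liftE _ _ lb bal)); rewrite bE.
Qed.

Lemma brauer_vec_act e s (z : O) :
  tensp (bvec (bact s e)) (tensp (group_vec F 1%g) z : Ind)
    = tensp (bvec e) (tensp (group_vec F s) z : Ind).
Proof.
apply: (etrans (congr1 (fun m =>
  tensp m _) (esym (brauer_ract delta frLb s e)))).
apply: (etrans (tensp_balanced _ _ _)); congr tensp.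
apply: (etrans (ind_actE _ _ _)); congr tensp.
by apply: (etrans (group_lact _ _ _)); rewrite /pcomp mul1g.
Qed.

Lemma group_vec_young s p (z : O) :
  tensp (group_vec F (pcomp s (young_emb p))) z
    = tensp (group_vec F s) (act O p z) :> Ind.
Proof.
by rewrite -tensp_balanced; congr tensp; apply/esym/group_ract.
Qed.

Lemma brauer_tensor_act (b : brauer n) (m : CB) (x : Ind) :
  act TC b (tensp m x) = tensp (lact CB b m) x.
Proof. by apply: tensor_actE => s u; apply: (brauer_com frLb). Qed.

Lemma layer_tensor_act (b : brauer n) (m : Layer) (x : S) :
  act TL (brauer_val b) (tensp m x) = tensp (lact Layer (brauer_val b) m) x.
Proof. by apply: tensor_actE => s u; apply: (layer_com frL frLb). Qed.

(** Let $[e]$ be the layer vector of [e]. The inverse maps are $[e]\otimes v\mapsto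
    e\otimes(1\otimes i(v))$ and $e\otimes(s\otimes z)\mapsto[e\cdot s]\otimes c(z)$, where [i] and
    [c] identify [S] with its outer tensor product with the trivial module. *)
Lemma layer_induced_iso : iso (restrict (@brauer_val n) TL) TC.
Proof.
have [i [c [ic ci iE]]] := outer_trivial.
have cE p z : c (act O p z) = act S p.1 (c z) by rewrite -{1}[z]ci iE ic.
have [up upE] : exists up : BB -> 'Hom(S, TC),
    forall e v, up e v = tensp (bvec e) (tensp (group_vec F 1%g) (i v)).
  exists (fun e => tenspl Ind (bvec e) \o tenspl O (group_vec F 1%g) \o i)%VF =>
    e v.
  by rewrite !comp_lfunE !tensplE.
have [|Phi PhiE] := @layer_lift TC up.
  move=> p e v; rewrite !upE; apply: (etrans (brauer_vec_act _ _ _));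
    congr tensp.
  rewrite -iE; apply: (etrans _ (group_vec_young _ _ _)).
  by rewrite /pcomp mulg1.
have [psi psiE] : exists psi : BB -> 'Hom(Ind, TL),
    forall e s z, psi e (tensp (group_vec F s) z)
      = tensp (lvec (bact s e)) (c z).
  have ex e : exists h : 'Hom(Ind, TL),
      forall s z, h (tensp (group_vec F s) z) = tensp (lvec (bact s e)) (c z).
    have [gam gamE] : exists gam : 'S_(k + l) -> 'Hom(O, TL),
        forall s z, gam s z = tensp (lvec (bact s e)) (c z).
      exists (fun s => tenspl S (lvec (bact s e)) \o c)%VF => s z.
      by rewrite comp_lfunE tensplE.
    have [|h hE] := @ind_lift TL gam; last by exists h => s z; rewrite hE gamE.
    move=> p s z; rewrite !gamE cE brauer_actM.
    apply: (etrans _ (tensp_balanced _ _ _)).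
    exact: (congr1 (fun m => tensp m _) (esym (layer_ract delta frL frLb p _))).
  by have [h hE] := choice ex; exists h.
have [|Psi PsiE] := @brauer_lift TL psi.
  by move=> s e u z; rewrite !psiE brauer_actM.
have genL := gen_tensp (gen_layer (delta := delta) (frL := frL) (frLb :=
  frLb) BE0 l_odd) (@gen_id F S).
have genC := gen_tensp (@gen_brauer F delta n k l Lb) gen_ind.
have PhiK0 e v : Psi (Phi (tensp (lvec e) v)) = tensp (lvec e) v.
  apply: (etrans (congr1 Psi (etrans (PhiE _ _) (upE _ _)))).
  by apply: (etrans (PsiE _ _)); apply: (etrans (psiE _ _ _));
    rewrite brauer_act1 ic.
have PsiK0 e s z : Phi (Psi (tensp (bvec e) (tensp (group_vec F s) z : Ind)))
    = tensp (bvec e) (tensp (group_vec F s) z : Ind).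
  apply: (etrans (congr1 Phi (etrans (PsiE _ _) (psiE _ _ _)))).
  apply: (etrans (etrans (PhiE _ _) (upE _ _))); rewrite ci.
  exact: brauer_vec_act.
have PhiK : (Psi \o Phi = \1)%VF.
  apply: (genL _ (Psi \o Phi)%VF) => -[e v].
  exact: (etrans (comp_lfunE _ _ _) (etrans (PhiK0 e v) (esym (id_lfunE _)))).
have PsiK : (Phi \o Psi = \1)%VF.
  apply: (genC _ (Phi \o Psi)%VF) => -[e [s z]].
  exact: (etrans (comp_lfunE _ _ _) (etrans (PsiK0 e s z) (esym (id_lfunE _)))).
exists Phi, Psi; split=> [x|x|b x].
- by rewrite -comp_lfunE PhiK id_lfunE.
- by rewrite -comp_lfunE PsiK id_lfunE.
have act_e e v : Phi (act TL (brauer_val b) (tensp (lvec e) v))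
    = act TC b (Phi (tensp (lvec e) v)).
  have PhiU e1 : Phi (tensp (lvec e1) v)
      = tensp (bvec e1) (tensp (group_vec F 1%g) (i v)).
    exact: (etrans (PhiE _ _) (upE _ _)).
  apply: (etrans (congr1 Phi (layer_tensor_act _ _ _))).
  apply: (etrans _ (congr1 (act TC b) (esym (PhiU _)))).
  apply: (etrans _ (esym (brauer_tensor_act _ _ _))).
  (* Either both actions give the same power of [delta] times the vector of the same Brauer diagram,
     or both give 0. *)
  have [g|ng] := boolP (good (brauer_val b) (val e)).
    have [e' e'E] := brauer_comp_exists frLb g.
    apply: (etrans (congr1 (fun m =>
      Phi (tensp m v)) (layer_lact delta frL frLb g e'E))).
    apply: (etrans _ (congr1 (fun m =>
      tensp m _) (esym (brauer_lact delta k l g e'E)))).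
    apply: (etrans (congr1 Phi (tenspZl _ _ _))).
    apply: (etrans (linearZ _ _)); apply: (etrans _ (esym (tenspZl _ _ _))).
    by congr (_ *: _); apply: PhiU.
  apply: (etrans (congr1 (fun m =>
    Phi (tensp m v)) (layer_lact0 delta frL frLb ng))).
  apply: (etrans _ (congr1 (fun m =>
    tensp m _) (esym (brauer_lact0 delta frLb ng)))).
  by rewrite !tensp0l linear0.
have /lfunP/(_ x) : (Phi \o act TL (brauer_val b) = act TC b \o Phi)%VF.
  apply: (genL _ (Phi \o act TL (brauer_val b))%VF) => -[e v].
  exact: (etrans (comp_lfunE _ _ _) (etrans (act_e e v) (esym (comp_lfunE _ _
    _)))).
by rewrite !comp_lfunE.
Qed.

End LayerInduced.

Theorem theorem26 (R : realType) (delta : complex R) (n k l : nat)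
    (la : intpartn k) (L Lb : {set diagram n})
    (k_le_n : (k <= n)%N)
    (L_cell : is_left_cell L)
    (L_prop : forall d, d \in L -> prop_number d = k)
    (l_le : (l <= n - k)%N)
    (l_parity : ~~ odd (n - k - l))
    (Lb_cell : is_left_cell Lb)
    (Lb_prop : forall d, d \in Lb -> prop_number d = (k + l)%N)
    (Lb_brauer : Lb :&: brauer_set n != set0) :
  let Ind := young_ind (specht (complex R) k la) (specht (complex R) l [:: l]) in
  isomorphic (layer_module delta 0 L l la)
    (\big[@dsum (complex R) (brauer n) / zero_mod (complex R) (brauer n)]_(mu : intpartn (k + l)
        | `[< occurs (specht (complex R) (k + l) mu) Ind >])
       copies (multiplicity (specht (complex R) (k + l) mu) Ind)
         (brauer_specht delta Lb mu)).
Proof.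
move=> Ind.
have char0 m : m.+1%:R != 0 :> complex R by rewrite Num.Theory.pnatr_eq0.
(* This is the condition $l\in\{n-k,n-k-2,\dots\}$, in the form that excludes diagrams with [l + 1]
   singletons. *)
have l_odd : odd n = odd (k + l).
  rewrite -{1}(subnKC k_le_n) -(subnKC l_le) addnA oddD (negPf l_parity).
  by rewrite addbF.
have [d0 [t frL]] := frame_exists L_cell L_prop.
have [e0 [q frLb]] := frame_exists Lb_cell Lb_prop.
have Ind_iso := specht_isotypic char0 (ind_rep (specht (complex R) k la)
  (specht (complex R) l [:: l])).
apply: iso_isomorphic.
apply: (iso_trans (layer_induced_iso delta frL frLb Lb_brauer l_odd
  (specht_rep (complex R) k la))).
(* Tensoring with the Brauer cell module sends the decomposition of [Ind] into Specht modules to the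
   asserted one. *)
apply: (iso_trans (iso_tensor (brauer_com (delta := delta) frLb) Ind_iso)).
exact: (tensor_bigdsum (brauer_com (delta := delta) frLb)
  (fun mu : intpartn (k + l) => `[< occurs (specht (complex R) (k + l) mu) Ind >])
  (fun mu => multiplicity (specht (complex R) (k + l) mu) Ind)
  (fun mu => specht (complex R) (k + l) mu)).
Qed.
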